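(* Let $X_d=\otimes_{j=1}^dX_{1,j}$. Let $(a_d)$ be a real sequence and $(b_d)$ a positive sequence with $b_d\to\infty$. Assume the uniform negligibility condition $$\lim_{d\to\infty}\max_{j=1,\dots,d}\sum_{k=1}^\infty\bar\lambda^{X_{1,j}}_k\,\mathbf 1\bigl(\bar\lambda^{X_{1,j}}_k<e^{-\tau b_d}\bigr)=0\quad\text{for all }\tau>0.$$ Let $q:(0,1)\to\mathbb R$ be non-increasing and $G$ a distribution function with $q(\varepsilon)=G^{-1}(1-\varepsilon^2)$ for all $\varepsilon\in C(q)$, and suppose $$\ln n^{X_d}(\varepsilon)=a_d+q(\varepsilon)b_d+o(b_d),\quad d\to\infty,\quad\text{for all }\varepsilon\in C(q).$$ Then $G$ is self-decomposable and its Lévy spectral function $L$ vanishes on $(-\infty,0)$. If moreover $G$ is non-degenerate, then $b_{d+1}/b_d\to1$ as $d\to\infty$.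
   Context: For a centered Hilbert-space random element $Z$ with finite second moment, $\lambda^Z_1\ge\lambda^Z_2\ge\dots\ge 0$ denote the eigenvalues of its covariance operator $K^Z$ with multiplicity (padded with zeros), $\Lambda^Z=\sum_k\lambda^Z_k$, $\bar\lambda^Z_k=\lambda^Z_k/\Lambda^Z$. Let $X_{1,j}$ be centered random elements of separable Hilbert spaces $H_{1,j}$ with $\mathbb E\|X_{1,j}\|^2<\infty$ and $\lambda^{X_{1,j}}_1>0$; $X_d=\otimes_{j=1}^dX_{1,j}$ means $X_d$ is a centered random element of $H_d=\otimes_{j=1}^dH_{1,j}$ with covariance operator $\otimes_{j=1}^dK^{X_{1,j}}$ (eigenvalues $\prod_j\lambda^{X_{1,j}}_{k_j}$). The complexity is $n^{X_d}(\varepsilon)=\min\{n\in\mathbb N:\sum_{k>n}\bar\lambda^{X_d}_k\le\varepsilon^2\}$, equivalently the minimal rank $n$ of a linear approximation $\sum_{m=1}^nl_m(X_d)\psi_m$ ($l_m\in H_d^*$, $\psi_m\in H_d$) with $\mathbb E\|X_d-\sum l_m(X_d)\psi_m\|^2\le\varepsilon^2\mathbb E\|X_d\|^2$. A distribution function is non-decreasing, right-continuous, with limits $0,1$ at $\mp\infty$; degenerate means $F(x)=\mathbf 1(x\ge a)$. $C(f)$: continuity points of $f$; $f^{-1}(y)=\inf\{x:f(x)\ge y\}$. A distribution function $F$ is self-decomposable if for every $\alpha>1$ there is a distribution function $F_\alpha$ with $F(x)=\int_{\mathbb R}F_\alpha(x-y)\,dF(\alpha y)$ for all $x$. Such $F$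 is infinitely divisible and its characteristic function has the Lévy representation $f(t)=\exp\{i\gamma t-\sigma^2t^2/2+\int_{|x|>0}(e^{itx}-1-\frac{itx}{1+x^2})\,dL(x)\}$ with $\gamma\in\mathbb R$, $\sigma^2\ge0$, and Lévy spectral function $L:\mathbb R\setminus\{0\}\to\mathbb R$ non-decreasing on $(-\infty,0)$ and on $(0,\infty)$, $L(\pm\infty)=0$, $\int_{0<|x|<\tau}x^2dL(x)<\infty$. *)

(* Defs.v *)
From mathcomp Require Import all_boot all_algebra all_classical all_reals all_analysis.
Import numFieldNormedType.Exports.
Import GRing.Theory Num.Theory.
Local Open Scope ring_scope.
Local Open Scope classical_set_scope.

Set Implicit Arguments.
Unset Strict Implicit.
Unset Printing Implicit Defensive.

Section Defs.
Context {R : realType}.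

(* [lam] is the eigenvalue sequence (with multiplicity, non-increasing,
   padded with zeros) of the covariance operator of a centered random element
   with finite second moment and lambda_1 > 0.  0-indexed: lam k = lambda_{k+1}. *)
Definition eigen_seq (lam : nat -> R) : Prop :=
  [/\ (forall k, 0 <= lam k), (forall k, lam k.+1 <= lam k),
      (\sum_(0 <= k <oo) (lam k)%:E < +oo)%E & 0 < lam 0%N].

Definition Lam (lam : nat -> R) : R := fine (\sum_(0 <= k <oo) (lam k)%:E)%E.

Definition lbar (lam : nat -> R) (k : nat) : R := lam k / Lam lam.

(* The (k+1)-th largest value, counted with multiplicity, of a nonnegative
   family f (0 if f has at most k positive values). *)
Definition kth_largest (I : eqType) (f : I -> R) (k : nat) : R :=
  sup [set t | 0 <= t /\ exists s : seq I,
         [/\ uniq s, size s = k.+1 & all (fun i => t <= f i) s]].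

(* eigenvalues of the covariance operator (x)_{j<d} K^{X_{1,j}} of X_d,
   indexed by multi-indices (k_0,...,k_{d-1}) *)
Definition tensor_family (lam : nat -> nat -> R) (d : nat)
  (kk : {ffun 'I_d -> nat}) : R := \prod_(j < d) lam j (kk j).

Definition tensor_eig (lam : nat -> nat -> R) (d k : nat) : R :=
  kth_largest (@tensor_family lam d) k.

(* sum_{k > n} bar lambda^{X_d}_k  (1-indexed), i.e. 0-indexed k >= n *)
Definition tail_sum (lam : nat -> nat -> R) (d n : nat) : \bar R :=
  (\sum_(n <= k <oo) (lbar (tensor_eig lam d) k)%:E)%E.

Definition complexity (lam : nat -> nat -> R) (d : nat) (eps : R) : nat :=
  xget 0%N [set n | (tail_sum lam d n <= (eps ^+ 2)%:E)%E /\
                    forall m, (m < n)%N -> ((eps ^+ 2)%:E < tail_sum lam d m)%E].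

Definition distribution_function (F : R -> R) : Prop :=
  [/\ {homo F : x y / x <= y},
      (forall a, F x @[x --> a^'+] --> F a),
      F x @[x --> -oo] --> (0:R) &
      F x @[x --> +oo] --> (1:R)].

Definition degenerate (F : R -> R) : Prop :=
  exists a : R, forall x, F x = (if a <= x then 1 else 0).

Definition is_law (mu : probability R R) (F : R -> R) : Prop :=
  forall x, mu `]-oo, x] = (F x)%:E.

Definition self_decomposable (F : R -> R) : Prop :=
  forall alpha : R, 1 < alpha ->
    exists Fa : R -> R, distribution_function Fa /\
      exists nu : probability R R, is_law nu (fun y => F (alpha * y)) /\
        forall x, (F x)%:E = (\int[nu]_y (Fa (x - y))%:E)%E.

(* nu = dL, the measure induced by the Levy spectral function on R \ {0}:
   no mass at 0, int_{0<|x|<tau} x^2 dL < oo and L(+-oo) = 0 *)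
Definition levy_measure (nu : {measure set R -> \bar R}) : Prop :=
  nu [set 0] = 0%E /\ (\int[nu]_x (Num.min 1 (x ^+ 2))%:E < +oo)%E.

(* the Levy spectral function L determined by dL = nu, L(+-oo) = 0 *)
Definition levy_spectral (nu : {measure set R -> \bar R}) (x : R) : R :=
  if x < 0 then fine (nu `]-oo, x]) else - fine (nu `]x, +oo[).

(* the characteristic function f(t) = int e^{itx} dF(x) equals
   exp{ i gamma t - sigma2 t^2/2 + int_{|x|>0} (e^{itx} - 1 - itx/(1+x^2)) dL(x) },
   written out in real and imaginary parts. *)
Definition levy_representation (F : R -> R) (gamma sigma2 : R)
  (nu : {measure set R -> \bar R}) : Prop :=
  exists mu : probability R R, is_law mu F /\
    forall t : R,
      let A := Rintegral nu [set~ 0] (fun x => cos (t * x) - 1) in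
      let B := gamma * t +
               Rintegral nu [set~ 0] (fun x => sin (t * x) - t * x / (1 + x ^+ 2)) in
      Rintegral mu setT (fun x => cos (t * x)) = expR (- sigma2 * t ^+ 2 / 2 + A) * cos B /\
      Rintegral mu setT (fun x => sin (t * x)) = expR (- sigma2 * t ^+ 2 / 2 + A) * sin B.

Definition levy_spectral_vanishes_neg (F : R -> R) : Prop :=
  exists (gamma sigma2 : R) (nu : {measure set R -> \bar R}),
    [/\ 0 <= sigma2, levy_measure nu, levy_representation F gamma sigma2 nu &
        forall x, x < 0 -> levy_spectral nu x = 0].

End Defs.

(* Main.v *)
(** Write [U_j] for the random variable equal to [- ln lbar_(j,k)] with
    probability [lbar_(j,k)], the [U_j] being independent, and
    [S_d = U_0 + ... + U_(d-1)]. The normalized eigenvalues of [X_d] are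
    products, so their total mass above [exp (- y)] is [P (S_d <= y)]. Hence
    [n(eps) <= exp y] as soon as [P (S_d <= y) >= 1 - eps^2], and conversely
    [1 - eps^2 <= P (S_d <= y) + n(eps) exp (- y)]; the hypothesis on
    [ln n(eps)] therefore says that [Z_d = (S_d - a_d) / b_d] converges in law
    to [G]. By uniform negligibility, adding one summand does not move
    [S_d / b_d], which gives [b_(d+1) / b_d -> 1] for a nondegenerate [G].

    Self-decomposability: for [alpha > 1] let [m <= d] be maximal with
    [alpha b_m <= b_d]; then [b_d / b_m -> alpha], so the first [m] summands
    contribute the law of [G] contracted by [alpha], and the law of the
    remaining ones has a limit along an ultrafilter, which is the other factor.

    Levy representation: let [theta] be the clipping to [[-1, 1]] and
    [X_(d,j) = U_j / b_d - c_(d,j)] with [E theta(X_(d,j)) = 0]. Averaging the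
    identity [|E exp (i t Z_d)|^2 = prod_j |phi_(d,j) t|^2] over small [t] bounds
    [sum_j E theta(X_(d,j))^2] and the tails of [sum_j P (X_(d,j) in .)]. The
    functionals [f |-> sum_j E (theta^2 f)(X_(d,j))] have a limit [m M] along an
    ultrafilter, with [M] a probability and [m >= 0], and
    [E exp (i t Z_d)] is asymptotic to the exponential of their values at
    [(exp (i t x) - 1 - i t theta x) / theta(x)^2], up to a bounded drift. The
    atom of [m M] at [0] is the Gaussian variance and [m M / theta^2] is the Levy
    measure; it does not charge the negative half-line because [U_j >= 0] and
    [c_(d,j) -> 0] uniformly in [j]. *)

From HB Require Import structures.
Require Import Defs.
From mathcomp Require Import all_boot all_order all_algebra all_classical all_reals all_analysis.
From mathcomp Require Import complex measurable_realfun ring lra.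
Import numFieldNormedType.Exports.
Import Order.TTheory GRing.Theory Num.Theory.
Local Open Scope ring_scope.
Local Open Scope classical_set_scope.

Set Implicit Arguments.
Unset Strict Implicit.
Unset Printing Implicit Defensive.

(** * Largest values of a family and minimal rank *)

(** The [U_j] may have infinite mean, so no moment can be used and all test functions are bounded.
    Clipping replaces truncated moments because it is Lipschitz and monotone: a centre exists by the
    intermediate value theorem, and centring removes the linear term, so [E exp (i t X) - 1] equals,
    without error, the integral of [clip^2] times a bounded continuous kernel. Ultrafilters replace
    the extraction of subsequences; uniqueness of the auxiliary limits never matters, since [G] is
    given beforehand. A limit of integrals along an ultrafilter is only finitely additive, so it is
    kept as a positive linear functional and represented by a probability on continuous functions
    only. The ratio of the [b_d] comes from comparing two levels [eps], as the unknown [a_d] cancels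
    in a difference; this needs two values of [q], so a degenerate [G] is treated apart. The drift
    is bounded because a large one would turn the characteristic function to [-1] at a small [t],
    where it must be close to [1]. *)

Section KthLargest.
Context {R : realType} {I : eqType} (f : I -> R) (M : R).
Hypotheses (f0 : forall i, 0 <= f i) (fM : forall i, f i <= M).

Definition kth_witnesses (k : nat) : set R :=
  [set t | 0 <= t /\ exists s : seq I,
         [/\ uniq s, size s = k.+1 & all (fun i => t <= f i) s]].

Lemma kth_witnesses_ubound k : ubound (kth_witnesses k) M.
Proof.
move=> t [_ [[|i s] [_ //= _ /andP[ti _]]]].
exact: le_trans ti (fM i).
Qed.

Lemma kth_largest_ge k t : kth_witnesses k t -> t <= kth_largest f k.
Proof.
move=> tk; apply: ub_le_sup => //; exists M; exact: kth_witnesses_ubound.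
Qed.

Lemma kth_largest_ge0 k : 0 <= kth_largest f k.
Proof.
rewrite /kth_largest; have [|/set0P[t tk]] := eqVneq (kth_witnesses k) set0.
  by rewrite /kth_witnesses => e; rewrite e sup0.
by case: (tk) => t0 _; exact: le_trans t0 (kth_largest_ge tk).
Qed.

Lemma kth_largest_gt k t : t < kth_largest f k -> 0 < kth_largest f k ->
  exists s : seq I, [/\ uniq s, size s = k.+1 & all (fun i => t <= f i) s].
Proof.
move=> tk k0; have ne : kth_witnesses k !=set0.
  apply/set0P; apply: contraTneq k0 => e.
  by rewrite /kth_largest -/(kth_witnesses k) e sup0 ltxx.
have [u [_ [s [us ss /allP al]]] tu] := sup_gt ne tk.
by exists s; split=> //; apply/allP => i /al; apply: le_trans; exact: ltW.
Qed.

(** Remove a minimal term [f m]: all [size s] terms are at least [f m], so it lies below the last of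
    the largest values, and induction treats the rest. *)
Lemma sum_le_kth_largest (s : seq I) : uniq s ->
  \sum_(i <- s) f i <= \sum_(k < size s) kth_largest f k.
Proof.
have [n] := ubnP (size s); elim: n s => // n IH s /ltnSE sn us.
have [->|s0] := eqVneq s [::]; first by rewrite big_nil big_ord0.
have [m ms mmin] : exists2 m, m \in s & all (fun i => f m <= f i) s.
  clear -s0; elim: s s0 => // i [|j s] IH _; first by exists i; rewrite ?inE //= lexx.
  have [//|m mjs al] := IH.
  have [im|mi] := leP (f i) (f m).
    exists i; rewrite ?inE ?eqxx //=; rewrite lexx /=.
    by apply: sub_all al => k; exact: le_trans.
  by exists m; [rewrite inE mjs orbT | rewrite /= (ltW mi) /=].
have ss : size s = (size (rem m s)).+1.
  by rewrite size_rem// prednK//; case: (s) s0.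
rewrite (perm_big _ (perm_to_rem ms)) big_cons ss big_ord_recr/= addrC.
apply: lerD.
  by apply: IH; [rewrite -ss | exact: rem_uniq].
by apply: kth_largest_ge; split=> //; exists s.
Qed.

(** Greedy choice of the indices. The supremum in [kth_largest] is only approached, hence a loss of
    [e] per term. *)
Lemma kth_largest_sum_le n (e : R) : 0 < e -> exists s : seq I,
  [/\ uniq s, (size s <= n)%N &
      \sum_(k < n) kth_largest f k <= \sum_(i <- s) f i + n%:R * e].
Proof.
move=> e0; elim: n => [|n [s [us sn IH]]].
  by exists [::]; rewrite big_nil big_ord0 mul0r addr0; split.
rewrite big_ord_recr/=.
have [k0|k0] := leP (kth_largest f n) 0.
  exists s; split=> //; first exact: leqW.
  rewrite -natr1 mulrDl mul1r; lra.
have [t [ut st al]] := @kth_largest_gt n (kth_largest f n - e) ltac:(lra) k0.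
(* Pigeonhole: [t] has [n.+1] distinct entries and [s] at most [n]. *)
have [i it is_] : exists2 i, i \in t & i \notin s.
  apply/hasP; apply: contraLR sn; rewrite -all_predC -ltnNge => /allP al'.
  rewrite -st; apply: uniq_leq_size => // x xt.
  by have := al' _ xt; rewrite /= negbK.
exists (i :: s); split; rewrite /= ?is_ //.
rewrite big_cons -natr1 mulrDl mul1r.
have := allP al _ it; lra.
Qed.

End KthLargest.

Section EsumSeq.
Context {R : realType} {I : choiceType} (f : I -> R).
Hypothesis f0 : forall i, 0 <= f i.

Lemma sum_seq_le_esum (s : seq I) : uniq s ->
  ((\sum_(i <- s) f i)%:E <= \esum_(i in [set: I]) (f i)%:E)%E.
Proof.
move=> us; apply: esum_ge; exists [set` s]; first by split => //; exact: finite_seq.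
by rewrite -fsbig_seq// sumEFin.
Qed.

Lemma esum_gt_seq (v : R) : (v%:E < \esum_(i in [set: I]) (f i)%:E)%E ->
  exists2 s : seq I, uniq s & v < \sum_(i <- s) f i.
Proof.
move=> /ereal_sup_gt[_ [A [finA _] <-]]; rewrite fsbig_finite// sumEFin lte_fin.
by exists (finmap.enum_fset (fset_set A)) => //; exact: finmap.fset_uniq.
Qed.

Lemma esum_le_seq (t : R) : (forall s, uniq s -> \sum_(i <- s) f i <= t) ->
  (\esum_(i in [set: I]) (f i)%:E <= t%:E)%E.
Proof.
move=> h; rewrite leNgt; apply/negP => /esum_gt_seq[s us].
by rewrite ltNge h.
Qed.

End EsumSeq.

Section KthLargestSum.
Context {R : realType} {I : choiceType} (f : I -> R) (T : R).
Hypotheses (f0 : forall i, 0 <= f i) (T0 : 0 < T).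
Hypothesis fT : (\esum_(i in [set: I]) (f i)%:E = T%:E)%E.

Let e := kth_largest f.

Lemma sum_seq_le (s : seq I) : uniq s -> \sum_(i <- s) f i <= T.
Proof. by move=> us; rewrite -lee_fin -fT; exact: sum_seq_le_esum. Qed.

Let fleT i : f i <= T.
Proof. by have := @sum_seq_le [:: i] isT; rewrite big_seq1. Qed.

Let e0 k : 0 <= e k. Proof. exact: (kth_largest_ge0 fleT). Qed.

Lemma sum_kth_largest_le n : \sum_(k < n) e k <= T.
Proof.
apply/ler_addgt0Pr => d d0.
have d0' : 0 < d / n.+1%:R by rewrite divr_gt0.
have [s [us _ h]] := kth_largest_sum_le f n d0'.
apply: le_trans h _; apply: lerD; first exact: sum_seq_le.
rewrite mulrCA ler_piMr//; first exact: ltW.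
by rewrite ler_pdivrMr ?mul1r ?ler_nat.
Qed.

Lemma series_kth_largest : (\sum_(0 <= k <oo) (e k)%:E)%E = T%:E.
Proof.
apply/eqP; rewrite eq_le; apply/andP; split.
  apply: lime_le; first by apply: is_cvg_nneseries => k _ _; rewrite lee_fin.
  by apply: nearW => n; rewrite sumEFin lee_fin big_mkord sum_kth_largest_le.
rewrite -fT; apply: ge_ereal_sup => _ [A [finA _] <-].
rewrite fsbig_finite// sumEFin.
apply: (@le_trans _ _ (\sum_(0 <= k < size (finmap.enum_fset (fset_set A))) (e k)%:E)%E).
  rewrite sumEFin lee_fin big_mkord; exact: sum_le_kth_largest.
by apply: nneseries_lim_ge => k _ _; rewrite lee_fin.
Qed.

Lemma Lam_kth_largest : Lam e = T.
Proof. by rewrite /Lam series_kth_largest. Qed.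

Definition tail n : \bar R := (\sum_(n <= k <oo) (lbar e k)%:E)%E.

Lemma tail_kth_largest n : tail n = (1 - \sum_(k < n) e k / T)%:E.
Proof.
have l0 k : 0 <= lbar e k by rewrite /lbar Lam_kth_largest divr_ge0// ltW.
have tot : (\sum_(0 <= k <oo) (lbar e k)%:E)%E = 1%:E.
  rewrite /lbar Lam_kth_largest.
  under eq_eseriesr do rewrite mulrC EFinM.
  rewrite nneseriesZl//= ?series_kth_largest.
    by rewrite -EFinM mulVf// gt_eqF.
  by move=> k _; rewrite lee_fin.
have := @nneseries_split R (fun k => (lbar e k)%:E) 0%N n (fun k _ => l0 k).
rewrite add0n tot sumEFin big_mkord => h.
have -> : \sum_(k < n) e k / T = \sum_(k < n) lbar e k.
  by apply: eq_bigr => k _; rewrite /lbar Lam_kth_largest.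
by rewrite EFinB h [X in _ = (X - _)%E]addeC addeK.
Qed.

Variable eps : R.
Hypothesis eps01 : 0 < eps < 1.

(** Convertible to [complexity] when [f] is the tensor family, so the bounds below transfer without
    rewriting. *)
Definition min_rank : nat := xget 0%N [set n | (tail n <= (eps ^+ 2)%:E)%E /\
  forall m, (m < n)%N -> ((eps ^+ 2)%:E < tail m)%E].

Lemma min_rankP : (tail min_rank <= (eps ^+ 2)%:E)%E /\
  forall m, (m < min_rank)%N -> ((eps ^+ 2)%:E < tail m)%E.
Proof.
rewrite /min_rank; case: xgetP => [n _ //|none].
suff [n0 hn0] : exists n, (tail n <= (eps ^+ 2)%:E)%E.
  have [n hn nmin] := ex_minnP (ex_intro (fun n => (tail n <= (eps ^+ 2)%:E)%E) n0 hn0).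
  case: (none n); split=> // m mn; rewrite ltNge; apply/negP => /nmin.
  by rewrite leqNgt mn.
have c : (tail n @[n --> \oo] --> 0)%E.
  apply: nneseries_tail_cvg => [|k _]; last first.
    by rewrite lee_fin /lbar Lam_kth_largest divr_ge0// ltW.
  by have := tail_kth_largest 0; rewrite /tail => ->; rewrite ltry.
have [n _ /(_ n (leqnn n)) /=] : \forall n \near \oo, fine (tail n) < eps ^+ 2.
  by apply: (cvgr_lt 0 (fine_cvg c)); rewrite exprn_gt0//; case/andP: eps01.
by move=> /ltW h; exists n; move: h; rewrite tail_kth_largest.
Qed.

Lemma min_rank_gt0 : (0 < min_rank)%N.
Proof.
rewrite lt0n; apply/eqP => h; have [] := min_rankP; rewrite h tail_kth_largest.
rewrite big_ord0 subr0 lee_fin => le _; move: le; apply/negP; rewrite -ltNge.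
by case/andP: eps01 => e1 e2; rewrite expr_lt1// ltW.
Qed.

Lemma min_rank_le (n : nat) :
  (forall d, 0 < d -> exists s : seq I,
    [/\ uniq s, (size s <= n)%N & 1 - eps ^+ 2 - d <= \sum_(i <- s) f i / T]) ->
  (min_rank <= n)%N.
Proof.
move=> h; rewrite leqNgt; apply/negP => /(proj2 min_rankP).
rewrite tail_kth_largest lte_fin => lt.
set A := \sum_(k < n) e k / T in lt.
(* Half of the positive gap left if the [n] largest values fell short of mass [1 - eps ^+ 2]. *)
have [s [us sn]] := h ((1 - eps ^+ 2 - A) / 2) ltac:(lra).
suff : \sum_(i <- s) f i / T <= A by lra.
rewrite /A -!mulr_suml ler_pM2r ?invr_gt0//.
apply: (@le_trans _ _ (\sum_(k < size s) e k)); first exact: sum_le_kth_largest.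
by rewrite -(subnKC sn) big_split_ord /= lerDl sumr_ge0.
Qed.

Lemma min_rank_mass (d : R) : 0 < d -> exists s : seq I,
  [/\ uniq s, (size s <= min_rank)%N & 1 - eps ^+ 2 <= \sum_(i <- s) f i / T + d].
Proof.
move=> d0; have d0' : 0 < d * T / min_rank%:R.
  by rewrite divr_gt0 ?mulr_gt0// ltr0n min_rank_gt0.
have [s [us ss h]] := kth_largest_sum_le f min_rank d0'.
exists s; split=> //; have [+ _] := min_rankP.
rewrite tail_kth_largest lee_fin -!mulr_suml.
rewrite mulrC divfK in h; last by rewrite gt_eqF// ltr0n min_rank_gt0.
have : (\sum_(k < min_rank) kth_largest f k) / T <=
   (\sum_(i <- s) f i) / T + d.
  by rewrite ler_pdivrMr// mulrDl divfK// gt_eqF.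
rewrite -/e; lra.
Qed.

End KthLargestSum.

(** * Bounded measurable functions, convolution and laws of sums *)

Section BoundedMeasurable.
Context d (T : measurableType d) {R : realType}.
Implicit Types f g : T -> R.

(** On this class every integral against a finite measure is finite, so [Rintegral] is linear and
    monotone there without integrability side conditions. *)
Definition bmeas f := measurable_fun setT f /\ exists K, forall x, `|f x| <= K.

Lemma bmeas_cst (c : R) : bmeas (fun=> c).
Proof. by split; [exact: measurable_cst | exists `|c|]. Qed.

Lemma bmeasD f g : bmeas f -> bmeas g -> bmeas (fun x => f x + g x).
Proof.
move=> [mf [K fK]] [mg [L gL]]; split; first exact: measurable_funD.
by exists (K + L) => x; rewrite (le_trans (ler_normD _ _))// lerD.
Qed.

Lemma bmeasM f g : bmeas f -> bmeas g -> bmeas (fun x => f x * g x).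
Proof.
move=> [mf [K fK]] [mg [L gL]]; split; first exact: measurable_funM.
by exists (K * L) => x; rewrite normrM ler_pM.
Qed.

Lemma bmeasN f : bmeas f -> bmeas (fun x => - f x).
Proof.
move=> [mf [K fK]]; split; first exact: measurable_funN.
by exists K => x; rewrite normrN.
Qed.

Lemma bmeasB f g : bmeas f -> bmeas g -> bmeas (fun x => f x - g x).
Proof. by move=> bf bg; apply: bmeasD => //; exact: bmeasN. Qed.

Lemma bmeasZ (c : R) f : bmeas f -> bmeas (fun x => c * f x).
Proof. by move=> bf; apply: bmeasM => //; exact: bmeas_cst. Qed.

Lemma bmeas_sum (I : Type) (s : seq I) (f : I -> T -> R) :
  (forall i, bmeas (f i)) -> bmeas (fun x => \sum_(i <- s) f i x).
Proof.
move=> bf; elim: s => [|i s IH].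
  by under eq_fun do rewrite big_nil; exact: bmeas_cst.
by under eq_fun do rewrite big_cons; exact: bmeasD.
Qed.

Lemma bmeas_indic (A : set T) : measurable A -> bmeas (\1_A : T -> R).
Proof.
move=> mA; split; first exact: measurable_indic.
by exists 1 => x; rewrite indicE ger0_norm// lern1 leq_b1.
Qed.

Lemma bmeas_integrable_lty (mu : {measure set T -> \bar R}) f :
  (mu setT < +oo)%E -> bmeas f -> mu.-integrable setT (EFin \o f).
Proof.
move=> muoo [mf [K fK]]; apply: measurable_bounded_integrable => //.
exists K; split; first exact: num_real.
by move=> M KM x _ /=; exact: le_trans (fK x) (ltW KM).
Qed.

Variable mu : {finite_measure set T -> \bar R}.

Lemma bmeas_integrable f : bmeas f -> mu.-integrable setT (EFin \o f).
Proof. by apply: bmeas_integrable_lty; exact: fin_num_fun_lty. Qed.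

Lemma integral_bmeas f : bmeas f -> (\int[mu]_x (f x)%:E)%E = (\int[mu]_x f x)%:E.
Proof.
by move=> bf; rewrite fineK//; apply: integrable_fin_num => //; exact: bmeas_integrable.
Qed.

Lemma RintD f g : bmeas f -> bmeas g ->
  \int[mu]_x (f x + g x) = \int[mu]_x f x + \int[mu]_x g x.
Proof. by move=> bf bg; rewrite RintegralD//; exact: bmeas_integrable. Qed.

Lemma RintZ (c : R) f : bmeas f -> \int[mu]_x (c * f x) = c * \int[mu]_x f x.
Proof. by move=> bf; rewrite RintegralZl//; exact: bmeas_integrable. Qed.

Lemma RintN f : bmeas f -> \int[mu]_x (- f x) = - \int[mu]_x f x.
Proof. by move=> bf; under eq_Rintegral do rewrite -mulN1r; rewrite RintZ// mulN1r. Qed.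

Lemma RintB f g : bmeas f -> bmeas g ->
  \int[mu]_x (f x - g x) = \int[mu]_x f x - \int[mu]_x g x.
Proof. by move=> bf bg; rewrite RintD ?RintN//; exact: bmeasN. Qed.

Lemma le_Rint f g : bmeas f -> bmeas g -> (forall x, f x <= g x) ->
  \int[mu]_x f x <= \int[mu]_x g x.
Proof. by move=> bf bg fg; apply: le_Rintegral => //; exact: bmeas_integrable. Qed.

Lemma le_norm_Rint f g : bmeas f -> bmeas g -> (forall x, `|f x| <= g x) ->
  `|\int[mu]_x f x| <= \int[mu]_x g x.
Proof.
move=> bf bg fg; rewrite ler_norml -RintN//; apply/andP; split.
  by apply: le_Rint => // [|x]; [exact: bmeasN | have := fg x; rewrite ler_norml => /andP[]].
by apply: le_Rint => // x; rewrite (le_trans (ler_norm _)).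
Qed.

Lemma Rint_indic (A : set T) : measurable A -> \int[mu]_x (\1_A x : R) = fine (mu A).
Proof. by move=> mA; rewrite /Rintegral integral_indic// setIT. Qed.

Lemma Rint_cst (c : R) : \int[mu]_x c = c * fine (mu setT).
Proof. by rewrite Rintegral_cst. Qed.

End BoundedMeasurable.

Lemma bmeas_comp d d' (T : measurableType d) (T' : measurableType d')
    {R : realType} (h : T' -> T) (f : T -> R) :
  measurable_fun setT h -> bmeas f -> bmeas (fun x => f (h x)).
Proof. by move=> mh [mf [K fK]]; split; [exact: measurableT_comp | exists K]. Qed.

Lemma probability_Rint_cst d (T : measurableType d) {R : realType}
  (mu : probability T R) (c : R) : \int[mu]_x c = c.
Proof.
rewrite Rintegral_cst// -[RHS]mulr1; congr (_ * _).
by rewrite -[RHS]/(fine 1%E); congr fine; exact: probability_setT.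
Qed.

Section ProductBounded.
Context d1 d2 (T1 : measurableType d1) (T2 : measurableType d2) {R : realType}.
Variables (mu : probability T1 R) (nu : probability T2 R).

Lemma bmeas_slice (f : T1 * T2 -> R) x : bmeas f -> bmeas (fun y => f (x, y)).
Proof. by move=> bf; apply: bmeas_comp bf; exact: measurable_pair1. Qed.

Lemma bmeas_slice2 (f : T1 * T2 -> R) y : bmeas f -> bmeas (fun x => f (x, y)).
Proof. by move=> bf; apply: bmeas_comp bf; exact: measurable_pair2. Qed.

Lemma bmeas_prod_integrable (f : T1 * T2 -> R) : bmeas f ->
  (mu \x nu)%E.-integrable setT (EFin \o f).
Proof.
move=> bf; apply: bmeas_integrable_lty bf.
suff h : (mu \x nu)%E setT = 1%E by apply: le_lt_trans (ltry 1); rewrite -h.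
rewrite -setXTT (product_measure1E mu nu)//.
by rewrite -[RHS]mul1e; congr (_ * _)%E; exact: probability_setT.
Qed.

Lemma bmeas_marginal (f : T1 * T2 -> R) : bmeas f ->
  bmeas (fun x => \int[nu]_y f (x, y)).
Proof.
move=> bf; split.
  apply/measurable_EFinP.
  have -> : EFin \o (fun x => \int[nu]_y f (x, y)) = fubini_F nu (EFin \o f).
    by apply/funext => x; rewrite /fubini_F /= -integral_bmeas//; exact: bmeas_slice.
  by apply: (@measurable_fubini_F _ _ _ _ _ mu); exact: bmeas_prod_integrable.
case: (bf) => mf [K fK]; exists K => x.
rewrite -[leRHS](probability_Rint_cst nu); apply: le_norm_Rint => //.
  exact: bmeas_slice.
exact: bmeas_cst.
Qed.

Lemma Rint_prod (f : T1 * T2 -> R) : bmeas f ->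
  \int[(mu \x nu)%E]_z f z = \int[mu]_x \int[nu]_y f (x, y).
Proof.
move=> bf; rewrite /Rintegral; congr fine.
rewrite -(@integral12_prod_meas1 _ _ _ _ _ mu nu); last exact: bmeas_prod_integrable.
by apply: eq_integral => x _; rewrite /fubini_F /= integral_bmeas//; exact: bmeas_slice.
Qed.

End ProductBounded.

Lemma Rint_exchange d1 d2 (T1 : measurableType d1) (T2 : measurableType d2)
    {R : realType} (mu : probability T1 R) (nu : probability T2 R)
    (f : T1 * T2 -> R) : bmeas f ->
  \int[mu]_x \int[nu]_y f (x, y) = \int[nu]_y \int[mu]_x f (x, y).
Proof.
move=> bf; rewrite /Rintegral; congr fine.
have /Fubini : (mu \x nu)%E.-integrable setT (EFin \o f) by exact: bmeas_prod_integrable.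
move=> h; transitivity (\int[mu]_x \int[nu]_y (f (x, y))%:E)%E.
  by apply: eq_integral => x _; apply/esym/integral_bmeas; exact: bmeas_slice.
rewrite [LHS]h; apply: eq_integral => y _; apply: integral_bmeas.
exact: bmeas_slice2.
Qed.

Section Convolution.
Context {R : realType}.
Implicit Types mu nu : probability R R.

Lemma Rint_distribution d (T : measurableType d) (P : probability T R) (X : {mfun T >-> R})
    (f : R -> R) : bmeas f -> \int[distribution P X]_x f x = \int[P]_z f (X z).
Proof.
move=> bf; rewrite /Rintegral; congr fine; rewrite /distribution integral_pushforward//.
  by apply/measurable_EFinP; case: bf.
by apply: bmeas_integrable; exact: bmeas_comp bf.
Qed.

Definition add_pair (z : R * R) : R := z.1 + z.2.

Lemma measurable_add_pair : measurable_fun setT add_pair.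
Proof. by apply: measurable_funD; [exact: measurable_fst | exact: measurable_snd]. Qed.

HB.instance Definition _ := @isMeasurableFun.Build _ _ _ _ add_pair measurable_add_pair.

Definition convolution mu nu : probability R R :=
  distribution (mu \x nu)%E add_pair.

Lemma ge0_integral_conv mu nu (f : R -> \bar R) :
  measurable_fun setT f -> (forall x, 0 <= f x)%E ->
  (\int[convolution mu nu]_z f z = \int[mu]_x \int[nu]_y f (x + y)%R)%E.
Proof.
move=> mf f0; rewrite /convolution ge0_integral_distribution//.
rewrite (@fubini_tonelli1 _ _ _ _ _ mu nu)//; last by move=> x; exact: f0.
by apply: measurableT_comp => //; exact: measurable_add_pair.
Qed.

Lemma Rint_conv mu nu (f : R -> R) : bmeas f ->
  \int[convolution mu nu]_z f z = \int[mu]_x \int[nu]_y f (x + y).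
Proof.
move=> bf; rewrite Rint_distribution// (Rint_prod mu nu (f := fun z => f (add_pair z)))//.
by apply: bmeas_comp bf; exact: measurable_add_pair.
Qed.

End Convolution.

Section ProbabilityOfMeasure.
Context d (T : measurableType d) {R : realType} (m : {measure set T -> \bar R}).
Hypothesis mT : m setT = 1%E.

(** The proof is an argument so that the probability structure can be attached to the head constant
    [mass1]. *)
Definition mass1 & m setT = 1%E : set T -> \bar R := m.

HB.instance Definition _ := Measure.on (mass1 mT).

HB.instance Definition _ := @Measure_isProbability.Build _ _ _ (mass1 mT) mT.

Definition probability_of_measure : probability T R := mass1 mT.

End ProbabilityOfMeasure.

Section DiscreteLaw.
Context {R : realType} (p u : nat -> R).
Hypotheses (p0 : forall k, 0 <= p k) (p1 : (\sum_(0 <= k <oo) (p k)%:E = 1)%E).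

Let atom (k : nat) : {measure set R -> \bar R} := mscale (NngNum (p0 k)) (dirac (u k)).

Let discrete : {measure set R -> \bar R} := mseries atom 0.

Let integral_discrete (f : R -> \bar R) :
  measurable_fun setT f -> (forall x, 0 <= f x)%E ->
  (\int[discrete]_x f x = \sum_(0 <= k <oo) (p k)%:E * f (u k))%E.
Proof.
move=> mf f0; rewrite ge0_integral_measure_series//.
apply: eq_eseriesr => k _.
by rewrite ge0_integral_mscale// integral_dirac//= diracT mul1e.
Qed.

Let discreteT : discrete setT = 1%E.
Proof.
rewrite -[LHS]mul1e -integral_cst// (_ : cst 1%E = (fun=> 1%E))// integral_discrete//.
by under eq_eseriesr do rewrite mule1.
Qed.

Lemma discrete_law_exists : exists P : probability R R,
  forall f : R -> \bar R, measurable_fun setT f -> (forall x, 0 <= f x)%E ->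
  (\int[P]_x f x = \sum_(0 <= k <oo) (p k)%:E * f (u k))%E.
Proof.
by exists (probability_of_measure discreteT) => f mf f0; exact: integral_discrete.
Qed.

End DiscreteLaw.

Section SumLaw.
Context {R : realType}.

(** The law of a sum of [n] independent variables, numbered from [m] on. The offset serves the
    splitting of [S_d] into two blocks. *)
Fixpoint sum_law (P : nat -> probability R R) (m n : nat) : probability R R :=
  if n is n'.+1 then convolution (sum_law P m n') (P (m + n')%N) else dirac (0 : R).

Variables (P : nat -> probability R R) (p u : nat -> nat -> R).
Hypothesis p0 : forall j k, 0 <= p j k.
Hypothesis Pp : forall j (f : R -> \bar R),
  measurable_fun setT f -> (forall x, 0 <= f x)%E ->
  (\int[P j]_x f x = \sum_(0 <= k <oo) (p j k)%:E * f (u j k))%E.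

Let snoc d (z : {ffun 'I_d -> nat} * nat) : {ffun 'I_d.+1 -> nat} :=
  [ffun i => if unlift ord_max i is Some j then z.1 j else z.2].

Let snoc_max d (z : {ffun 'I_d -> nat} * nat) : snoc z ord_max = z.2.
Proof. by rewrite ffunE unlift_none. Qed.

Let snoc_widen d (z : {ffun 'I_d -> nat} * nat) (i : 'I_d) :
  snoc z (widen_ord (leqnSn d) i) = z.1 i.
Proof.
rewrite ffunE; have -> : widen_ord (leqnSn d) i = lift ord_max i.
  by apply: val_inj; rewrite /= /bump leqNgt ltn_ord.
by rewrite liftK.
Qed.

Let snoc_bij d : set_bij setT setT (@snoc d).
Proof.
rewrite setTT_bijective.
exists (fun kk : {ffun 'I_d.+1 -> nat} => ([ffun i => kk (widen_ord (leqnSn d) i)], kk ord_max)).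
  move=> [k1 k2]; congr pair; last by rewrite snoc_max.
  by apply/ffunP => i; rewrite ffunE snoc_widen.
move=> kk; apply/ffunP => i; rewrite ffunE.
case: unliftP => [j ->|->//] /=; rewrite ffunE; congr (kk _).
by apply: val_inj; rewrite /= /bump leqNgt ltn_ord.
Qed.

(** Links the analytic side (convolutions) with the combinatorial one (multi-indices). Induction
    with Tonelli; [snoc] splits off the last coordinate. *)
Lemma integral_sum_law d (f : R -> \bar R) :
  measurable_fun setT f -> (forall x, 0 <= f x)%E ->
  (\int[sum_law P 0 d]_x f x = \esum_(kk in [set: {ffun 'I_d -> nat}])
     (\prod_(j < d) p j (kk j))%:E * f (\sum_(j < d) u j (kk j))%R)%E.
Proof.
elim: d f => [|d IH] f mf f0.
  rewrite /= integral_dirac// diracT mul1e.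
  have -> : [set: {ffun 'I_0 -> nat}] = [set [ffun=> 0%N]].
    by apply/seteqP; split => // kk _; apply/ffunP => -[].
  by rewrite esum_set1 ?big_ord0 ?mul1e.
rewrite /= add0n ge0_integral_conv//.
have fx (x : R) : measurable_fun setT (fun y : R => f (x + y)%R).
  by apply: measurableT_comp => //; exact: measurable_funD.
rewrite IH; last 2 first.
- apply: (@measurable_fun_fubini_tonelli_F _ _ _ _ _ (P d) (fun z : R * R => f (z.1 + z.2)%R)) => //.
  by apply: measurableT_comp => //; exact: measurable_add_pair.
- by move=> x; exact: integral_ge0.
rewrite (reindex_esum _ _ _ _ (@snoc_bij d)).
have -> : [set: {ffun 'I_d -> nat} * nat] = [set: {ffun 'I_d -> nat}] `*`` (fun=> setT).
  by apply/seteqP; split.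
rewrite -(esum_esum (a := fun k1 k2 => ((\prod_(j < d.+1) p j (snoc (k1, k2) j))%:E
   * f (\sum_(j < d.+1) u j (snoc (k1, k2) j))%R)%E)); last first.
  by move=> k1 k2 _ _; rewrite mule_ge0// lee_fin prodr_ge0.
apply: eq_esum => k1 _; rewrite Pp//.
rewrite -nneseriesZl//; last by move=> k _; rewrite mule_ge0// lee_fin.
rewrite nneseries_esumT; last first.
  by move=> k; rewrite !mule_ge0// lee_fin// prodr_ge0.
apply: eq_esum => k2 _.
rewrite !big_ord_recr/= !snoc_max/= muleA -EFinM.
by congr ((_ * _)%:E * f (_ + _)%R)%E; apply: eq_bigr => i _; rewrite snoc_widen.
Qed.

End SumLaw.

(** * Complexity and the law of the information *)

Section EigenSeq.
Context {R : realType} (lam : nat -> R).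
Hypothesis lamP : eigen_seq lam.

Lemma series_eigen_seq : (\sum_(0 <= k <oo) (lam k)%:E = (Lam lam)%:E)%E.
Proof.
case: lamP => lam0 _ fin _; rewrite /Lam fineK// ge0_fin_numE//.
by apply: nneseries_ge0 => k _ _; rewrite lee_fin.
Qed.

Lemma Lam_gt0 : 0 < Lam lam.
Proof.
case: lamP => lam0 _ _ l0; rewrite -lte_fin -series_eigen_seq.
apply: (@lt_le_trans _ _ (\sum_(0 <= k < 1) (lam k)%:E)%E).
  by rewrite big_nat1 lte_fin.
by apply: nneseries_lim_ge => k _ _; rewrite lee_fin.
Qed.

Lemma lbar_ge0 k : 0 <= lbar lam k.
Proof. by case: lamP => lam0 _ _ _; rewrite divr_ge0// ltW// Lam_gt0. Qed.

Lemma series_lbar : (\sum_(0 <= k <oo) (lbar lam k)%:E = 1)%E.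
Proof.
case: (lamP) => lam0 _ _ _; rewrite /lbar.
under eq_eseriesr do rewrite mulrC EFinM.
rewrite nneseriesZl//=; last by move=> k _; rewrite lee_fin.
by rewrite series_eigen_seq -EFinM mulVf// gt_eqF// Lam_gt0.
Qed.

Lemma lbar_le1 k : lbar lam k <= 1.
Proof.
rewrite -lee_fin -series_lbar.
apply: (@le_trans _ _ (\sum_(0 <= i < k.+1) (lbar lam i)%:E)%E).
  rewrite sumEFin lee_fin big_nat_recr//= lerDr.
  by apply: sumr_ge0 => i _; exact: lbar_ge0.
by apply: nneseries_lim_ge => i _ _; rewrite lee_fin lbar_ge0.
Qed.

End EigenSeq.

Section Information.
Context {R : realType} (lam : nat -> nat -> R).
Hypothesis lamP : forall j, eigen_seq (lam j).

(** At a padding zero this is [- ln 0 = 0], a value that carries weight [0]. *)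
Definition info j k : R := - ln (lbar (lam j) k).

Lemma info_ge0 j k : 0 <= info j k.
Proof. by rewrite oppr_ge0 ln_le0// lbar_le1. Qed.

Lemma info_laws : exists P : nat -> probability R R,
  forall j (f : R -> \bar R), measurable_fun setT f -> (forall x, 0 <= f x)%E ->
  (\int[P j]_x f x = \sum_(0 <= k <oo) (lbar (lam j) k)%:E * f (info j k))%E.
Proof.
have /choice[P PP] j : exists Pj : probability R R, forall f : R -> \bar R,
    measurable_fun setT f -> (forall x, 0 <= f x)%E ->
    (\int[Pj]_x f x = \sum_(0 <= k <oo) (lbar (lam j) k)%:E * f (info j k))%E.
  by apply: discrete_law_exists; [exact: lbar_ge0 | exact: series_lbar].
by exists P.
Qed.

Variable P : nat -> probability R R.
Hypothesis PP : forall j (f : R -> \bar R),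
  measurable_fun setT f -> (forall x, 0 <= f x)%E ->
  (\int[P j]_x f x = \sum_(0 <= k <oo) (lbar (lam j) k)%:E * f (info j k))%E.

Let prob d (kk : {ffun 'I_d -> nat}) : R := \prod_(j < d) lbar (lam j) (kk j).

Let prob_ge0 d (kk : {ffun 'I_d -> nat}) : 0 <= prob kk.
Proof. by apply: prodr_ge0 => j _; exact: lbar_ge0. Qed.

Let total d : R := \prod_(j < d) Lam (lam j).

Let total_gt0 d : 0 < total d.
Proof. by apply: prodr_gt0 => j _; exact: Lam_gt0. Qed.

Let tensor_familyE d (kk : {ffun 'I_d -> nat}) :
  tensor_family lam kk / total d = prob kk.
Proof. by rewrite /tensor_family /total -prodf_div. Qed.

Let tensor_family_ge0 d (kk : {ffun 'I_d -> nat}) : 0 <= tensor_family lam kk.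
Proof. by apply: prodr_ge0 => j _; case: (lamP j). Qed.

Let esum_prob d : (\esum_(kk in [set: {ffun 'I_d -> nat}]) (prob kk)%:E = 1)%E.
Proof.
have := integral_sum_law (fun j k => lbar_ge0 (lamP j) k) PP d
   (measurable_cst 1%E) (fun x => lee01).
have -> : (\int[sum_law P 0 d]_x cst 1 x = 1)%E.
  by rewrite integral_cst// mul1e; exact: probability_setT.
by move=> ->; apply: eq_esum => kk _; rewrite mule1.
Qed.

Let esum_tensor d :
  (\esum_(kk in [set: {ffun 'I_d -> nat}]) (tensor_family lam kk)%:E = (total d)%:E)%E.
Proof.
apply/eqP; rewrite eq_le; apply/andP; split.
  apply: esum_le_seq => s us.
  rewrite -[leRHS]mul1r -ler_pdivrMr// mulr_suml.
  under eq_bigr do rewrite tensor_familyE.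
  by rewrite -lee_fin -(esum_prob d); exact: sum_seq_le_esum.
rewrite leNgt; apply/negP => /[dup] lt.
have fin : (\esum_(kk in [set: {ffun 'I_d -> nat}]) (tensor_family lam kk)%:E)%E \is a fin_num.
  by rewrite ge0_fin_numE ?(lt_trans lt) ?ltry// esum_ge0// => kk _; rewrite lee_fin.
rewrite -(fineK fin) lte_fin; set t := fine _ => tT.
have : ((t / total d)%:E < \esum_(kk in [set: {ffun 'I_d -> nat}]) (prob kk)%:E)%E.
  by rewrite esum_prob lte_fin ltr_pdivrMr// mul1r.
move=> /esum_gt_seq[s us]; apply/negP; rewrite -leNgt.
under eq_bigr do rewrite -tensor_familyE.
rewrite -mulr_suml ler_pM2r ?invr_gt0// -lee_fin /t fineK//.
exact: sum_seq_le_esum.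
Qed.

Definition sum_cdf d (y : R) : R := fine (sum_law P 0 d `]-oo, y]).

Lemma sum_cdf_ge0 d y : 0 <= sum_cdf d y. Proof. exact: fine_ge0. Qed.

Let sum_cdfE d y : (\esum_(kk in [set: {ffun 'I_d -> nat}])
  (prob kk * (\sum_(j < d) info j (kk j) <= y)%R%:R)%:E)%E = (sum_cdf d y)%:E.
Proof.
rewrite /sum_cdf fineK ?fin_num_measure//.
transitivity (\int[sum_law P 0 d]_x (\1_(`]-oo, y]) x)%:E)%E; last first.
  by rewrite integral_indic// setIT.
rewrite (integral_sum_law (fun j k => lbar_ge0 (lamP j) k) PP); last 2 first.
- by apply/measurable_EFinP; exact: measurable_indic.
- by move=> x; rewrite lee_fin.
by apply: eq_esum => kk _; rewrite EFinM indicE mem_setE in_itv.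
Qed.

Let prob_info d (kk : {ffun 'I_d -> nat}) : 0 < prob kk ->
  prob kk = expR (- \sum_(j < d) info j (kk j)).
Proof.
move=> pk; rewrite -sumrN.
under [in RHS]eq_bigr do rewrite opprK.
rewrite expR_sum; apply: eq_bigr => j _; rewrite lnK// posrE lt0r lbar_ge0// andbT.
by move: pk; rewrite lt_neqAle => /andP[+ _]; rewrite eq_sym; apply: contra_neq => h; rewrite /prob (bigD1 j)//= h mul0r.
Qed.

Lemma complexity_gt0 d eps : 0 < eps < 1 -> (0 < complexity lam d eps)%N.
Proof.
move=> e01; exact: (min_rank_gt0 (@tensor_family_ge0 d) (total_gt0 d) (esum_tensor d) e01).
Qed.

(** Multi-indices of information at most [y] and positive weight have weight at least [expR (- y)].
    The weights sum to one, so there are at most [expR y] of them, and together they carry the mass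
    [sum_cdf d y]. *)
Lemma complexity_le d eps y : 0 < eps < 1 -> 1 - eps ^+ 2 <= sum_cdf d y ->
  (complexity lam d eps)%:R <= expR y.
Proof.
move=> e01 h.
have /andP[tl tu] := truncn_itv (expR_ge0 y).
apply: le_trans tl; rewrite ler_nat.
apply: (min_rank_le (@tensor_family_ge0 d) (total_gt0 d) (esum_tensor d) e01) => δ δ0.
have : ((sum_cdf d y - δ)%:E < (sum_cdf d y)%:E)%E by rewrite lte_fin; lra.
rewrite -sum_cdfE => /esum_gt_seq[s us hs].
(* Multi-indices of weight zero are dropped: their information does not determine their weight, so
   they would escape the count. *)
pose light (kk : {ffun 'I_d -> nat}) := (\sum_(j < d) info j (kk j) <= y) && (0 < prob kk).
have sumE : \sum_(kk <- s) prob kk * (\sum_(j < d) info j (kk j) <= y)%R%:R =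
    \sum_(kk <- seq.filter light s) prob kk.
  rewrite big_filter [RHS]big_mkcond; apply: eq_bigr => kk _ /=; rewrite /light.
  case: (_ <= y); last by rewrite mulr0.
  by rewrite mulr1 lt0r prob_ge0 andbT; case: eqP => [->|].
exists (seq.filter light s); split; first exact: filter_uniq.
  rewrite -ltnS -(ltr_nat R); apply: le_lt_trans tu.
  have : \sum_(kk <- seq.filter light s) expR (- y) <= 1.
    apply: (@le_trans _ _ (\sum_(kk <- seq.filter light s) prob kk)).
      rewrite [leRHS]big_seq [leLHS]big_seq; apply: ler_sum => kk.
      rewrite mem_filter => /andP[/andP[ky kp] _].
      by rewrite prob_info// ler_expR lerN2.
    rewrite -lee_fin -(esum_prob d); apply: sum_seq_le_esum => //.
    exact: filter_uniq.
  rewrite big_const_seq count_predT iter_addr_0 expRN -[X in X <= 1]mulr_natl.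
  by rewrite ler_pdivrMr ?expR_gt0// mul1r.
under eq_bigr do rewrite tensor_familyE.
by rewrite -sumE; lra.
Qed.

(** Among the [complexity] many largest weights, those of information at most [y] have total mass at
    most [sum_cdf d y]; each of the others is at most [expR (- y)]. *)
Lemma complexity_ge d eps y : 0 < eps < 1 ->
  1 - eps ^+ 2 <= sum_cdf d y + (complexity lam d eps)%:R * expR (- y).
Proof.
move=> e01; apply/ler_addgt0Pr => /= δ δ0.
have [s [us ss h]] :=
  min_rank_mass (@tensor_family_ge0 d) (total_gt0 d) (esum_tensor d) e01 δ0.
apply: le_trans h _; rewrite lerD2r.
under eq_bigr do rewrite tensor_familyE.
apply: (@le_trans _ _ (\sum_(kk <- s) (prob kk * (\sum_(j < d) info j (kk j) <= y)%R%:R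
   + expR (- y)))).
  apply: ler_sum => kk _.
  have [_|lt] := leP (\sum_(j < d) info j (kk j)) y; first by rewrite mulr1 lerDl expR_ge0.
  rewrite mulr0 add0r; have [->|pk] := eqVneq (prob kk) 0; first exact: expR_ge0.
  rewrite prob_info ?ler_expR ?lerN2 ?ltW// lt0r pk; exact: prob_ge0.
rewrite big_split/= lerD//.
  by rewrite -lee_fin -sum_cdfE; exact: sum_seq_le_esum.
rewrite big_const_seq count_predT iter_addr_0 -[leLHS]mulr_natl.
by rewrite ler_wpM2r ?expR_ge0// ler_nat.
Qed.

End Information.

(** * Positive functionals on bounded measurable functions *)

Section MonotoneContinuity.
Context {R : realType}.
Implicit Types (f : R -> R) (a b : R).

(* among two disjoint inner subintervals of z, one carries at most half of the
   increment of f *)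
Let step f (z : R * R) : R * R :=
  let w := (z.2 - z.1) / 4 in
  if f (z.1 + 2 * w) - f (z.1 + w) <= (f z.2 - f z.1) / 2
  then (z.1 + w, z.1 + 2 * w) else (z.1 + 2 * w, z.1 + 3 * w).

(** Iterating [step] gives nested intervals over which the increment of [f] is halved each time.
    Both ends move strictly, so a common point is interior to all of them, and [f] is continuous
    there. *)
Lemma nondecreasing_continuity_point f a b : a < b ->
  (forall x y, a <= x -> x <= y -> y <= b -> f x <= f y) ->
  exists2 c, a < c < b & {for c, continuous f}.
Proof.
move=> ab ndf; pose I n := iter n (step f) (a, b).
have stepP z : a <= z.1 -> z.1 < z.2 -> z.2 <= b ->
    [/\ z.1 < (step f z).1, (step f z).1 < (step f z).2, (step f z).2 < z.2 &
      f (step f z).2 - f (step f z).1 <= (f z.2 - f z.1) / 2].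
  case: z => u v /= au uv vb; rewrite /step /=; set w := (v - u) / 4.
  have w0 : 0 < w by rewrite /w; lra.
  have e4 : v = u + 4 * w by rewrite /w; lra.
  have := ndf u (u + w) au ltac:(lra) ltac:(lra).
  have := ndf (u + 3 * w) v ltac:(lra) ltac:(lra) ltac:(lra).
  by case: (leP (f (u + 2 * w) - f (u + w))) => h /= h1 h2; split => //; lra.
have IP n : [/\ a <= (I n).1, (I n).1 < (I n).2, (I n).2 <= b &
    f (I n).2 - f (I n).1 <= (f b - f a) / 2 ^+ n].
  elim: n => [|n [h1 h2 h3 h4]]; first by rewrite /I /= expr0 divr1; split.
  have [s1 s2 s3 s4] := stepP _ h1 h2 h3.
  rewrite /I iterS -/(I n); split => //; [lra|lra|].
  apply: le_trans s4 _; rewrite exprS invfM [X in _ <= _ * X]mulrC mulrA.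
  by rewrite ler_pM2r ?invr_gt0.
have Imono n k : (I n).1 <= (I (n + k)%N).1 /\ (I (n + k)%N).2 <= (I n).2.
  elim: k => [|k [m1 m2]]; first by rewrite addn0.
  rewrite addnS /I iterS -/(I (n + k)%N).
  have [h1 h2 h3 _] := IP (n + k)%N; have [s1 s2 s3 _] := stepP _ h1 h2 h3.
  by split; lra.
have Icross n k : (I n).1 < (I k).2.
  have [nk|/ltnW kn] := leqP n k.
    have [m1 _] := Imono n (k - n)%N; rewrite subnKC// in m1.
    by have [_ h _ _] := IP k; lra.
  have [_ m2] := Imono k (n - k)%N; rewrite subnKC// in m2.
  by have [_ h _ _] := IP n; lra.
pose S := range (fun n => (I n).1).
have S0 : S !=set0 by exists (I 0%N).1; exists 0%N.
have Sub k : ubound S (I k).2 by move=> _ [n _ <-]; exact: ltW.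
have hs : has_sup S by split => //; exists (I 0%N).2; exact: Sub.
pose c := sup S.
have cle n : (I n).1 <= c by apply: ub_le_sup; [case: hs | exists n].
have cge n : c <= (I n).2 by apply: ge_sup.
have clt n : (I n).1 < c < (I n).2.
  have [h1 h2 h3 _] := IP n; have [s1 s2 s3 _] := stepP _ h1 h2 h3.
  have := cle n.+1; have := cge n.+1; rewrite /I !iterS -!/(I n) => *.
  by apply/andP; split; lra.
exists c; first exact: (clt 0%N).
apply/cvgrPdist_le => e e0.
have [n hn] : exists n, (f b - f a) / 2 ^+ n <= e.
  have D0 : 0 <= f b - f a by rewrite subr_ge0 ndf// ltW.
  have [n _ /(_ n (leqnn n)) /= h] : \forall n \near \oo, `|0 - geometric (f b - f a) (2^-1) n| <= e.
    apply: (@cvgr_dist_le _ _ _ _ _ (geometric (f b - f a) (2^-1)) 0) => //.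
    by apply: cvg_geometric; rewrite ger0_norm; lra.
  by exists n; move: h; rewrite sub0r normrN /geometric /= exprVn ger0_norm// divr_ge0// exprn_ge0.
have /andP[c1 c2] := clt n; have [h1 h2 h3 h4] := IP n.
near=> y.
have y1 : (I n).1 < y by near: y; exact: lt_nbhsr.
have y2 : y < (I n).2 by near: y; exact: lt_nbhsl.
have u1 := ndf _ _ h1 (ltW c1) (ltW (lt_le_trans c2 h3)).
have u2 := ndf _ _ h1 (ltW y1) (ltW (lt_le_trans y2 h3)).
have v1 := ndf _ _ (ltW (le_lt_trans h1 c1)) (ltW c2) h3.
have v2 := ndf _ _ (ltW (le_lt_trans h1 y1)) (ltW y2) h3.
by clear -u1 u2 v1 v2 h4 hn; rewrite ler_norml; apply/andP; split; lra.
Unshelve. all: by end_near. Qed.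

Lemma nonincreasing_continuity_point f a b : a < b ->
  (forall x y, a <= x -> x <= y -> y <= b -> f y <= f x) ->
  exists2 c, a < c < b & {for c, continuous f}.
Proof.
move=> ab nif; have [|c cab cf] := @nondecreasing_continuity_point (fun x => - f x) a b ab.
  by move=> x y *; rewrite lerN2 nif.
exists c => //.
have -> : f = (fun x => - - f x) by apply/funext => x; rewrite opprK.
exact: cvgN.
Qed.

Lemma continuous_uniform_itv f a b e : continuous f -> 0 < e ->
  exists2 d, 0 < d & forall x y, a <= x <= b -> `|y - x| < d -> `|f y - f x| <= e.
Proof.
move=> cf e0.
have /compact_near_coveringP := @segment_compact R a b.
move=> /(_ _ (0 : R)^'+ (fun d x => forall y, `|y - x| < d -> `|f y - f x| <= e) _)[].
  move=> x _; have e2 : 0 < e / 2 by lra.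
  have /cvgrPdist_le/(_ _ e2) [r /= r0 hr] := cf x.
  near=> x' d; rewrite /= => y yx'.
  have xx' : `|x - x'| < r / 2.
    by near: x'; apply/nbhs_ballP; exists (r / 2) => //=; rewrite divr_gt0.
  have dr : d < r / 2 by near: d; apply: nbhs_right_lt; lra.
  have h1 := hr x' ltac:(rewrite /=; lra).
  have h2 : `|f x - f y| <= e / 2.
    by apply: hr; have := ler_distD x' x y; rewrite /= (distrC x' y); lra.
  by have := ler_distD (f x) (f y) (f x'); have := distrC (f x) (f y); lra.
move=> d0 /= d00 h; have d02 : 0 < d0 / 2 by rewrite divr_gt0.
exists (d0 / 2) => // x y xab; apply: h => //=.
by rewrite sub0r normrN ger0_norm ?ltW// ltr_pdivrMr// ltr_pMr// ltr1n.
Unshelve. all: by end_near. Qed.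

End MonotoneContinuity.

Lemma le0_eps_mul {R : realFieldType} (x c : R) : 0 <= c ->
  (forall e, 0 < e -> x <= e * c) -> x <= 0.
Proof.
move=> c0 h; apply/ler_addgt0Pr => e e0; rewrite add0r.
have c1 : 0 < c + 1 by rewrite ltr_wpDl.
apply: le_trans (h (e / (c + 1)) _) _; first by rewrite divr_gt0.
by rewrite mulrAC ler_pdivrMr// ler_pM2l// lerDl.
Qed.

(** The image of an ultrafilter is an ultrafilter, and it contains the compact segment
    [[- K, K]]. *)
Lemma ultra_bounded_cvg {R : realType} (U : set_system nat) (u : nat -> R) (K : R) :
  UltraFilter U -> (\forall n \near U, `|u n| <= K) -> cvg (u @ U).
Proof.
move=> UU uK; have PU : ProperFilter U by exact: ultra_proper.
have := @segment_compact R (- K) K; rewrite compact_ultra => /(_ (u @ U)).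
case.
- apply: Build_UltraFilter => V PV UV; apply/seteqP; split => // A VA.
  have [//|UnA] := in_ultra_setVsetC (u @^-1` A) UU.
  have /UV VnA : (u @ U) (~` A) by [].
  by have [x []] := @filter_ex _ V _ _ (filterI VA VnA).
- apply: filterS uK => n; rewrite ler_norml /= => /andP[h1 h2].
  by rewrite in_itv/= h1 h2.
- by move=> l [_ ul]; apply/cvg_ex; exists l.
Qed.

Section PositiveFunctional.
Context {R : realType}.
Implicit Types (L : (R -> R) -> R) (f g h : R -> R) (x y : R).

(** A common frame for integrals, finite sums of integrals and their limits along an ultrafilter.
    Countable additivity is left out because such limits do not inherit it. *)
Definition posfun L := [/\ forall f g, bmeas f -> bmeas g ->
    L (fun x => f x + g x) = L f + L g,
  forall c f, bmeas f -> L (fun x => c * f x) = c * L f &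
  forall f g, bmeas f -> bmeas g -> (forall x, f x <= g x) -> L f <= L g].

Definition ind x : R -> R := \1_(`]-oo, x]).

Lemma indE x y : ind x y = (y <= x)%R%:R.
Proof. by rewrite /ind indicE mem_setE in_itv. Qed.

Lemma bmeas_ind x : bmeas (ind x).
Proof. exact: bmeas_indic. Qed.

Lemma bmeas_ind_compl x : bmeas (fun y => 1 - ind x y).
Proof. by apply: bmeasB; [exact: bmeas_cst|exact: bmeas_ind]. Qed.

Lemma ind_ge0 x y : 0 <= ind x y. Proof. by rewrite indE. Qed.

Lemma ind_le1 x y : ind x y <= 1. Proof. by rewrite indE lern1 leq_b1. Qed.

Definition tight L := forall e, 0 < e -> exists2 K, 0 < K &
  L (ind (- K)) <= e /\ L (fun=> 1) - L (ind K) <= e.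

Section Theory.
Variable L : (R -> R) -> R.
Hypothesis LP : posfun L.

Lemma posfunD f g : bmeas f -> bmeas g -> L (fun x => f x + g x) = L f + L g.
Proof. by case: LP => + _ _; exact. Qed.

Lemma posfunZ c f : bmeas f -> L (fun x => c * f x) = c * L f.
Proof. by case: LP => _ + _; exact. Qed.

Lemma le_posfun f g : bmeas f -> bmeas g -> (forall x, f x <= g x) -> L f <= L g.
Proof. by case: LP => _ _; exact. Qed.

Lemma posfun_cst c : L (fun=> c) = c * L (fun=> 1).
Proof.
rewrite -posfunZ; last exact: bmeas_cst.
by congr L; apply/funext => x; rewrite mulr1.
Qed.

Lemma posfunN f : bmeas f -> L (fun x => - f x) = - L f.
Proof.
move=> bf; rewrite -mulN1r -posfunZ//.
by congr L; apply/funext => x; rewrite mulN1r.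
Qed.

Lemma posfunB f g : bmeas f -> bmeas g -> L (fun x => f x - g x) = L f - L g.
Proof. by move=> bf bg; rewrite posfunD ?posfunN//; exact: bmeasN. Qed.

Lemma posfun_ge0 f : bmeas f -> (forall x, 0 <= f x) -> 0 <= L f.
Proof.
move=> bf f0; rewrite -[leLHS](mul0r (L (fun=> 1))) -posfun_cst.
by apply: le_posfun => //; exact: bmeas_cst.
Qed.

Lemma norm_posfun f g : bmeas f -> bmeas g -> (forall x, `|f x| <= g x) ->
  `|L f| <= L g.
Proof.
move=> bf bg fg; rewrite ler_norml -posfunN//; apply/andP; split.
  by apply: le_posfun => // [|x]; [exact: bmeasN | have := fg x; rewrite ler_norml => /andP[]].
by apply: le_posfun => // x; rewrite (le_trans (ler_norm _)).
Qed.

Lemma norm_posfun_cst f K : bmeas f -> (forall x, `|f x| <= K) ->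
  `|L f| <= K * L (fun=> 1).
Proof. by move=> bf fK; rewrite -posfun_cst; apply: norm_posfun => //; exact: bmeas_cst. Qed.

Lemma posfun_ind_le x y : x <= y -> L (ind x) <= L (ind y).
Proof.
move=> xy; apply: le_posfun; [exact: bmeas_ind..|] => z; rewrite !indE ler_nat.
by case: (leP z x) => // /le_trans ->.
Qed.

Lemma posfun_ind_ge0 x : 0 <= L (ind x).
Proof. by apply: posfun_ge0; [exact: bmeas_ind | exact: ind_ge0]. Qed.

Lemma posfun_ind_le1 x : L (ind x) <= L (fun=> 1).
Proof.
by apply: le_posfun; [exact: bmeas_ind | exact: bmeas_cst | exact: ind_le1].
Qed.

(** The step function with value [h x1] on each cell []x0, x1]]; [step_sum] is the matching
    Stieltjes sum for a distribution function [D]. *)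
Fixpoint step_fun h (x0 : R) (xs : seq R) : R -> R :=
  if xs is x1 :: xs' then
    fun y => h x1 * (ind x1 y - ind x0 y) + step_fun h x1 xs' y
  else fun=> 0.

Fixpoint step_sum (D : R -> R) h (x0 : R) (xs : seq R) : R :=
  if xs is x1 :: xs' then h x1 * (D x1 - D x0) + step_sum D h x1 xs' else 0.

Lemma bmeas_step_fun h x0 xs : bmeas (step_fun h x0 xs).
Proof.
elim: xs x0 => [|x1 xs IH] x0 /=; first exact: bmeas_cst.
by apply: bmeasD => //; apply: bmeasZ; apply: bmeasB; exact: bmeas_ind.
Qed.

Lemma posfun_step_fun h x0 xs :
  L (step_fun h x0 xs) = step_sum (fun x => L (ind x)) h x0 xs.
Proof.
elim: xs x0 => [|x1 xs IH] x0 /=; first by rewrite posfun_cst mul0r.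
have bi : bmeas (fun y => ind x1 y - ind x0 y) by apply: bmeasB; exact: bmeas_ind.
rewrite posfunD ?posfunZ ?posfunB ?IH//; by [exact: bmeas_ind|exact: bmeas_step_fun|exact: bmeasZ].
Qed.

Lemma step_fun_approx h (n : R) (r : rel R) x0 xs :
  (forall u v, r u v -> u < v /\ forall y, u < y <= v -> `|h y - h v| <= n) ->
  0 <= n -> path r x0 xs -> forall y,
  `|h y * (ind (last x0 xs) y - ind x0 y) - step_fun h x0 xs y|
     <= n * (ind (last x0 xs) y - ind x0 y).
Proof.
move=> rP n0; elim: xs x0 => [|x1 xs IH] x0 /=.
  by move=> _ y; rewrite subrr !mulr0 subrr normr0.
move=> /andP[/rP[x01 osc] pxs] y; have := IH _ pxs y.
set l := last x1 xs; set s := step_fun _ _ _ _ => h1.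
suff h2 : `|(h y - h x1) * (ind x1 y - ind x0 y)| <= n * (ind x1 y - ind x0 y).
  have -> : h y * (ind l y - ind x0 y) - (h x1 * (ind x1 y - ind x0 y) + s) =
    (h y * (ind l y - ind x1 y) - s) + (h y - h x1) * (ind x1 y - ind x0 y) by ring.
  apply: le_trans (ler_normD _ _) _.
  have -> : n * (ind l y - ind x0 y) =
    n * (ind l y - ind x1 y) + n * (ind x1 y - ind x0 y) by ring.
  exact: lerD.
rewrite !indE; have [yx0|yx0] := leP y x0.
  by rewrite (le_trans yx0 (ltW x01)) subrr !mulr0 normr0.
rewrite subr0; have [yx1|yx1] := leP y x1; last by rewrite !mulr0 normr0.
by rewrite !mulr1 osc// yx0.
Qed.

(** The Stieltjes sum sees [L] only through half-lines. The error is the oscillation [n] on the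
    cells plus [K] times the mass outside the partition. *)
Lemma posfun_step_approx h (n K : R) (r : rel R) x0 xs : bmeas h ->
  (forall x, `|h x| <= K) ->
  (forall u v, r u v -> u < v /\ forall y, u < y <= v -> `|h y - h v| <= n) ->
  0 <= n -> path r x0 xs ->
  `|L h - step_sum (fun x => L (ind x)) h x0 xs| <= n * L (fun=> 1) +
    K * (L (ind x0) + (L (fun=> 1) - L (ind (last x0 xs)))).
Proof.
move=> bh hK rP n0 pxs; rewrite -posfun_step_fun.
have bs := bmeas_step_fun h x0 xs.
set s := step_fun h x0 xs in bs *; set l := last x0 xs.
rewrite -posfunB//.
have bl := bmeas_ind l; have b0 := bmeas_ind x0; have b1 : bmeas ((fun=> 1) : R -> R) by exact: bmeas_cst.
have bo := bmeasD b0 (bmeasB b1 bl).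
pose g y := n * 1 + K * (ind x0 y + (1 - ind l y)).
have -> : n * L (fun=> 1) + K * (L (ind x0) + (L (fun=> 1) - L (ind l))) = L g.
  rewrite /g (posfunD (bmeasZ n b1) (bmeasZ K bo)) (posfunZ n b1) (posfunZ K bo).
  by rewrite (posfunD b0 (bmeasB b1 bl)) (posfunB b1 bl).
apply: norm_posfun => [||y]; [exact: bmeasB|by apply: bmeasD; exact: bmeasZ|].
have h1 := step_fun_approx rP n0 pxs y; rewrite -/l -/s in h1.
have il : x0 <= l.
  rewrite /l; clear -rP pxs; elim: xs x0 pxs => //= x1 xs IH x0 /andP[/rP[x01 _] /IH].
  by apply: le_trans; exact: ltW.
have o0 : 0 <= ind x0 y + (1 - ind l y) by rewrite addr_ge0 ?ind_ge0// subr_ge0 ind_le1.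
have m1 : 0 <= ind l y - ind x0 y <= 1.
  rewrite !indE; case: (leP y x0) => [/le_trans -> //|_]; first by rewrite subrr lexx ler01.
  by rewrite subr0 ler0n lern1 leq_b1.
have -> : h y - s y = (h y * (ind l y - ind x0 y) - s y) + h y * (ind x0 y + (1 - ind l y)).
  by ring.
apply: le_trans (ler_normD _ _) _; rewrite /g; apply: lerD.
  apply: le_trans h1 _; rewrite ler_wpM2l//; by case/andP: m1.
by rewrite normrM (ger0_norm o0) ler_wpM2r.
Qed.

End Theory.

(** [C] keeps the original left end in the invariant while [A] advances during the induction. *)
Lemma mesh_partition (Dn : set R) (d C A B : R) :
  (forall a b, a < b -> exists2 c, Dn c & a < c < b) -> 0 < d -> C <= A -> A < B ->
  Dn B -> exists xs, [/\ path (fun u v => (u < v < u + d) && (C <= v <= B)) A xs,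
    last A xs = B & forall x, x \in xs -> Dn x].
Proof.
move=> dense d0 CA AB DB.
(* Each point inserted from the dense set advances by more than [d / 2], so [n] bounds their
   number. *)
have [n] : exists n : nat, B - A < n%:R * (d / 2).
  exists (Num.truncn ((B - A) / (d / 2))).+1.
  by rewrite -ltr_pdivrMr ?divr_gt0// truncnS_gt.
elim: n A CA AB => [|n IH] A CA AB; first by rewrite mul0r; lra.
rewrite -natr1 mulrDl mul1r => lt.
have [h|h] := ltP (B - A) d.
  exists [:: B]; split => //=.
    by rewrite AB lexx !andbT (le_trans CA (ltW AB)) andbT -ltrBlDl.
  by move=> x; rewrite inE => /eqP ->.
have [c Dc /andP[c1 c2]] := dense (A + d / 2) (A + d) ltac:(lra).
have [xs [pxs lxs xsD]] := IH c ltac:(lra) ltac:(lra) ltac:(lra).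
exists (c :: xs); split => //=; last first.
  by move=> x; rewrite inE => /orP[/eqP -> //|/xsD].
by rewrite pxs andbT; apply/andP; split; apply/andP; split; lra.
Qed.

Lemma step_sum_eq (D1 D2 : R -> R) h x0 xs :
  (forall x, x \in x0 :: xs -> D1 x = D2 x) -> step_sum D1 h x0 xs = step_sum D2 h x0 xs.
Proof.
elim: xs x0 => //= x1 xs IH x0 e.
rewrite (e x0) ?mem_head// (e x1) ?inE ?eqxx ?orbT// IH// => x xx.
by rewrite e// inE xx orbT.
Qed.

(** Along a fine partition with points in [Dn] both functionals have the same Stieltjes sum, and
    tightness controls what lies outside. *)
Lemma posfun_eq_continuous L1 L2 (Dn : set R) h :
  posfun L1 -> posfun L2 -> tight L1 -> tight L2 ->
  (forall a b, a < b -> exists2 c, Dn c & a < c < b) ->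
  L1 (fun=> 1) = L2 (fun=> 1) -> (forall x, Dn x -> L1 (ind x) = L2 (ind x)) ->
  bmeas h -> continuous h -> L1 h = L2 h.
Proof.
move=> P1 P2 T1 T2 dense e1 eD bh ch; have [_ [K hK]] := bh.
have K0 : 0 <= K := le_trans (normr_ge0 _) (hK 0).
set m := L1 (fun=> 1).
have m0 : 0 <= m by apply: (posfun_ge0 P1) => //; exact: bmeas_cst.
suff H e : 0 < e -> `|L1 h - L2 h| <= e * (2 * m + 4 * K).
  have c0 : 0 <= 2 * m + 4 * K by rewrite addr_ge0// mulr_ge0.
  by apply/eqP; rewrite -subr_eq0 -normr_le0; exact: le0_eps_mul c0 H.
move=> e0; have [K1 K10 [t1 t1']] := T1 e e0; have [K2 K20 [t2 t2']] := T2 e e0.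
have [Q QE] : exists Q : R, Q = K1 + K2 by exists (K1 + K2).
have [A DA /andP[A1 A2]] := dense (- Q - 1) (- Q) ltac:(lra).
have [B DB /andP[B1 B2]] := dense Q (Q + 1) ltac:(lra).
have Q0 : 0 < Q by rewrite QE addr_gt0.
have [d d0 hd] := @continuous_uniform_itv R h A B e ch e0.
have AB : A < B by lra.
have [xs [pxs lxs xsD]] := mesh_partition dense d0 (lexx A) AB DB.
have rP u v : (u < v < u + d) && (A <= v <= B) ->
    u < v /\ forall y, u < y <= v -> `|h y - h v| <= e.
  move=> /andP[/andP[uv vu] vAB]; split => // y /andP[uy yv].
  by apply: hd => //; rewrite ler0_norm ?subr_le0//; lra.
have tA1 := posfun_ind_le P1 (ltac:(lra) : A <= - K1).
have tA2 := posfun_ind_le P2 (ltac:(lra) : A <= - K2).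
have tB1 := posfun_ind_le P1 (ltac:(lra) : K1 <= B).
have tB2 := posfun_ind_le P2 (ltac:(lra) : K2 <= B).
have := posfun_step_approx P1 bh hK rP (ltW e0) pxs.
have := posfun_step_approx P2 bh hK rP (ltW e0) pxs.
rewrite lxs -e1 -/m -(@step_sum_eq (fun x => L1 (ind x))); last first.
  by move=> x; rewrite inE => /orP[/eqP ->|/xsD]; exact: eD.
set ss := step_sum _ _ _ _ => s2 s1.
rewrite -/m in t1'; rewrite -e1 -/m in t2'.
have k1 : K * (L1 (ind A) + (m - L1 (ind B))) <= K * (2 * e) by rewrite ler_wpM2l//; lra.
have k2 : K * (L2 (ind A) + (m - L2 (ind B))) <= K * (2 * e) by rewrite ler_wpM2l//; lra.
have := ler_distD ss (L1 h) (L2 h); rewrite (distrC ss); lra.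
Qed.

End PositiveFunctional.

(** * Limits along an ultrafilter and their representing laws *)

Section LawExists.
Context {R : realType} (F : R -> R).
Hypothesis FP : distribution_function F.

(** Carries the proof along so that the cumulative structures can be attached to it. *)
Definition cdf_fun & distribution_function F : R -> R := F.

Let nd : {homo cdf_fun FP : x y / x <= y}. Proof. by case: FP. Qed.
Let rc : right_continuous (cdf_fun FP). Proof. by case: FP. Qed.
Let cNy : cdf_fun FP @ -oo --> (0:R). Proof. by case: FP. Qed.
Let cy : cdf_fun FP @ +oo --> (1:R). Proof. by case: FP. Qed.

#[local] HB.instance Definition _ := isCumulative.Build R _ R (cdf_fun FP) nd rc.
#[local] HB.instance Definition _ := isCumulativeBounded.Build R 0 1 (cdf_fun FP) cNy cy.

Let idTR : measurableTypeR R -> R := idfun.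

#[local] HB.instance Definition _ :=
  @isMeasurableFun.Build _ _ _ _ idTR (@measurable_id _ _ setT).

Lemma law_exists : exists mu : probability R R, is_law mu F.
Proof.
exists (distribution (lebesgue_stieltjes_measure (cdf_fun FP)) idTR) => x.
exact: (cdf_lebesgue_stieltjes_id (cdf_fun FP) x).
Qed.

End LawExists.

Section RintFunctional.
Context {R : realType} (mu : probability R R).

Lemma Rint_posfun : posfun (fun f : R -> R => \int[mu]_x f x).
Proof.
split; first by move=> f g bf bg; exact: RintD.
- by move=> c f bf; exact: RintZ.
- by move=> f g bf bg fg; exact: le_Rint.
Qed.

Lemma Rint_ind x : \int[mu]_y ind x y = fine (mu `]-oo, x]).
Proof. by rewrite Rint_indic. Qed.

Lemma Rint_ind_law (F : R -> R) x : is_law mu F -> \int[mu]_y ind x y = F x.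
Proof. by move=> muF; rewrite Rint_ind muF. Qed.

End RintFunctional.

Section UltraLimit.
Context {R : realType} (U : set_system nat) {UU : UltraFilter U}.
Variables (Ld : nat -> (R -> R) -> R) (C : R).
Hypothesis LdP : forall d, posfun (Ld d).
Hypothesis LdC : \forall d \near U, Ld d (fun=> 1) <= C.

Definition ulim f := lim (Ld d f @[d --> U]).

Let PU : ProperFilter U. Proof. exact: ultra_proper. Qed.

Lemma cvg_ulim f : bmeas f -> Ld d f @[d --> U] --> ulim f.
Proof.
move=> bf; have [_ [K fK]] := bf.
apply: (@ultra_bounded_cvg _ _ _ (K * C)) => //.
have K0 : 0 <= K := le_trans (normr_ge0 _) (fK 0).
apply: filterS LdC => d dC; apply: le_trans (norm_posfun_cst (LdP d) bf fK) _.
exact: ler_wpM2l.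
Qed.

Lemma ulim_posfun : posfun ulim.
Proof.
split.
- move=> f g bf bg; apply: cvg_lim => //.
  have -> : (fun d => Ld d (fun x => f x + g x)) = (fun d => Ld d f + Ld d g).
    by apply/funext => d; rewrite (posfunD (LdP d)).
  by apply: cvgD; exact: cvg_ulim.
- move=> c f bf; apply: cvg_lim => //.
  have -> : (fun d => Ld d (fun x => c * f x)) = (fun d => c * Ld d f).
    by apply/funext => d; rewrite (posfunZ (LdP d)).
  by apply: cvgM; [exact: cvg_cst|exact: cvg_ulim].
- move=> f g bf bg fg; apply: (ler_lim (cvgP _ (cvg_ulim bf)) (cvgP _ (cvg_ulim bg))).
  by apply: nearW => d; exact: (le_posfun (LdP d)).
Qed.

Lemma ulim_le f c : bmeas f -> (\forall d \near U, Ld d f <= c) -> ulim f <= c.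
Proof. by move=> bf h; apply: limr_le => //; exact: cvgP (cvg_ulim bf). Qed.

Lemma ulim_ge f c : bmeas f -> (\forall d \near U, c <= Ld d f) -> c <= ulim f.
Proof. by move=> bf h; apply: limr_ge => //; exact: cvgP (cvg_ulim bf). Qed.

Lemma ulim_tight : (forall e, 0 < e -> exists2 K, 0 < K & \forall d \near U,
    Ld d (ind (- K)) <= e /\ Ld d (fun=> 1) - Ld d (ind K) <= e) -> tight ulim.
Proof.
move=> h e e0; have [K K0 hK] := h e e0; exists K => //; split.
  by apply: ulim_le; [exact: bmeas_ind | apply: filterS hK => d []].
have b1 : bmeas ((fun=> 1) : R -> R) by exact: bmeas_cst.
rewrite -(posfunB ulim_posfun b1 (bmeas_ind K)).
apply: ulim_le; first by apply: bmeasB => //; exact: bmeas_ind.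
apply: filterS hK => d [_]; rewrite (posfunB (LdP d))//; exact: bmeas_ind.
Qed.

End UltraLimit.

Section Representation.
Context {R : realType} (L : (R -> R) -> R).
Hypotheses (LP : posfun L) (LT : tight L).

Let m := L (fun=> 1).
Let b1 : bmeas ((fun=> 1) : R -> R). Proof. exact: bmeas_cst. Qed.
Let m0 : 0 <= m. Proof. by apply: (posfun_ge0 LP). Qed.

(** [L (ind x) / m] need not be right-continuous in [x], as [L] is only finitely additive; [F] is
    its right-continuous regularization. *)
Let A x := [set L (ind y) / m | y in [set y | x < y]].
Let F x := inf (A x).

Lemma posfun_distribution : 0 < m ->
  distribution_function F /\ forall x, L (ind x) <= m * F x /\
    forall y, x < y -> m * F x <= L (ind y).
Proof.
move=> mp.
have A0 x : A x !=set0 by exists (L (ind (x + 1)) / m); exists (x + 1) => //=; lra.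
have lbA x : lbound (A x) (L (ind x) / m).
  move=> _ [y /= xy <-]; rewrite ler_pM2r ?invr_gt0//.
  exact: (posfun_ind_le LP (ltW xy)).
have hi x : has_inf (A x) by split => //; exists (L (ind x) / m); exact: lbA.
have Fge x : L (ind x) / m <= F x by exact: lb_le_inf.
have Fle x y : x < y -> F x <= L (ind y) / m.
  by move=> xy; apply: ge_inf; [case: (hi x) | exists y].
have Fnd : {homo F : x y / x <= y}.
  move=> x y xy; apply: lb_le_inf => // _ [z /= yz <-].
  by apply: Fle; exact: le_lt_trans yz.
split; last first.
  move=> x; split; first by rewrite mulrC -ler_pdivrMr.
  by move=> y xy; rewrite mulrC -ler_pdivlMr// Fle.
split => //.
- move=> x; apply/cvgrPdist_le => e e0.
  have [_ [z /= xz <-] hz] := inf_adherent e0 (hi x).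
  near=> y.
  have xy : x < y by near: y; exact: nbhs_right_gt.
  have yz : y < z by near: y; exact: nbhs_right_lt.
  have := Fnd _ _ (ltW xy); have := Fle _ _ yz; rewrite /F in hz *.
  by move=> h1 h2; rewrite ler_norml; apply/andP; split; lra.
- apply/cvgrPdist_le => e e0; have em : 0 < e * m by rewrite mulr_gt0.
  have [K K0 [hK _]] := LT em.
  near=> y; have yK : y < - K by near: y; apply: nbhs_ninfty_lt; exact: num_real.
  have := Fle _ _ yK; have := Fge y.
  have : 0 <= L (ind y) / m by rewrite divr_ge0// (posfun_ind_ge0 LP).
  have : L (ind (- K)) / m <= e by rewrite ler_pdivrMr.
  by move=> *; rewrite ler_norml; apply/andP; split; lra.
- apply/cvgrPdist_le => e e0; have em : 0 < e * m by rewrite mulr_gt0.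
  have [K K0 [_ hK]] := LT em.
  near=> y; have yK : K < y by near: y; apply: nbhs_pinfty_gt; exact: num_real.
  have := Fge y; have := Fle y (y + 1) ltac:(lra).
  have : L (ind (y + 1)) / m <= 1.
    by rewrite ler_pdivrMr// mul1r (posfun_ind_le1 LP).
  have : 1 - e <= L (ind y) / m.
    rewrite ler_pdivlMr// mulrBl mul1r; have := posfun_ind_le LP (ltW yK).
    by rewrite -/m in hK *; lra.
  by move=> *; rewrite ler_norml; apply/andP; split; lra.
Unshelve. all: by end_near. Qed.

(** Mass of [L] may sit just to the right of a point without being seen by [ind], so equality is
    claimed for continuous functions only. The half-line bound with [x < y] is what survives for
    indicators. *)
Lemma posfun_representation : exists mu : probability R R,
  (forall h : R -> R, bmeas h -> continuous h -> L h = L (fun=> 1) * \int[mu]_x h x) /\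
  forall x y : R, x < y -> L (fun=> 1) * fine (mu `]-oo, x]) <= L (ind y).
Proof.
rewrite -/m; have [mp|mn] := ltP 0 m; last first.
  have me : m = 0 by apply/eqP; rewrite eq_le mn m0.
  (* With total mass zero any probability would serve. *)
  exists (dirac (0 : R)); split; last first.
    by move=> x y _; rewrite me mul0r; exact: (posfun_ind_ge0 LP).
  move=> h bh _; have [_ [K hK]] := bh; rewrite me mul0r.
  apply/eqP; rewrite -normr_le0; apply: le_trans (norm_posfun_cst LP bh hK) _.
  by rewrite -/m me mulr0.
have [FP FL] := posfun_distribution mp; have [mu muF] := law_exists FP.
exists mu; split; last by move=> x y xy; rewrite muF /=; apply: (proj2 (FL x)).
move=> h bh ch.
have MP : posfun (fun f => m * \int[mu]_x f x).
  have [p1 p2 p3] := Rint_posfun mu; split.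
  - by move=> f g bf bg; rewrite p1// mulrDr.
  - by move=> c f bf; rewrite p2// mulrCA.
  - by move=> f g bf bg fg; rewrite ler_pM2l// p3.
apply: (@posfun_eq_continuous _ L (fun f => m * \int[mu]_x f x)
  [set c | {for c, continuous (fun x => L (ind x))}]) => //.
- case: FP => nd rc Ny Ny1 e e0.
  have em : 0 < e / m by rewrite divr_gt0.
  have h1 : \forall K \near +oo, F (- K) <= e / m.
    move: Ny => /cvgrPdist_le/(_ _ em) [M [Mr hM]].
    exists (- M); split; first by rewrite realN.
    move=> K MK /=; have := hM (- K) ltac:(rewrite ltrNl//).
    by rewrite sub0r normrN; apply: le_trans; exact: ler_norm.
  have h2 : \forall K \near +oo, 1 - F K <= e / m.
    move: Ny1 => /cvgrPdist_le/(_ _ em); apply: filterS => K.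
    by apply: le_trans; exact: ler_norm.
  have [K [[k1 k2] k3]] := filter_ex (filterI (filterI h1 h2) (nbhs_pinfty_gt (num_real 0))).
  exists K => //; rewrite !(Rint_ind_law _ muF) probability_Rint_cst.
  by rewrite -mulrBr; split; rewrite mulrC -ler_pdivlMr.
- move=> a b ab; have [c cab cf] := @nondecreasing_continuity_point _
    (fun x => L (ind x)) a b ab (fun x y _ xy _ => posfun_ind_le LP xy).
  by exists c.
- by rewrite probability_Rint_cst mulr1.
- move=> x cx; rewrite (Rint_ind_law _ muF); have [f1 f2] := FL x.
  apply/eqP; rewrite eq_le f1 /=.
  have cx' : L (ind y) @[y --> x^'+] --> L (ind x) by apply: cvg_at_right_filter; exact: cx.
  apply: (cvgr_to_ge cx'); near=> y; apply: f2.
  by near: y; exact: nbhs_right_gt.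
Unshelve. all: by end_near. Qed.

End Representation.

(** * Convergence in law of the normed sums *)

Section DistributionFunction.
Context {R : realType} (G : R -> R).
Hypothesis GP : distribution_function G.

Lemma df_ge0 x : 0 <= G x.
Proof.
case: GP => nd _ Ny _; apply: (cvgr_to_le Ny).
near=> y; apply: nd; near: y; apply: nbhs_ninfty_le; exact: num_real.
Unshelve. all: by end_near. Qed.

Lemma df_le1 x : G x <= 1.
Proof.
case: GP => nd _ _ y1; apply: (cvgr_to_ge y1).
near=> y; apply: nd; near: y; apply: nbhs_pinfty_ge; exact: num_real.
Unshelve. all: by end_near. Qed.

Lemma df_tails e : 0 < e -> exists2 K, 0 < K & G (- K) < e /\ 1 - G K < e.
Proof.
move=> e0; case: GP => nd _ Ny y1.
have [M [Mr hM]] : \forall x \near -oo, G x < e by exact: (cvgr_lt 0 Ny).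
have [N [Nr hN]] : \forall x \near +oo, 1 - e < G x.
  by apply: (cvgr_gt 1 y1); rewrite ltrBlDr ltrDl.
exists (`|M| + `|N| + 1); first by rewrite ltr_wpDl// addr_ge0.
split.
  by apply: hM; have := ler_norm (- M); have := normr_ge0 N; rewrite normrN; lra.
have /= := hN (`|M| + `|N| + 1); have := ler_norm N; have := normr_ge0 M.
by move=> h1 h2 h; have := h ltac:(lra); lra.
Qed.

Lemma df_quantile_gt (p x : R) : 0 < p < 1 -> G x < p -> x < inf [set y | p <= G y].
Proof.
move=> /andP[p0 p1] Gx; case: GP => nd rc _ y1.
have [z xz Gz] : exists2 z, x < z & G z < p.
  have [d /= d0 hd] := cvgr_lt (G x) (rc x) p Gx.
  exists (x + d / 2); first by rewrite ltrDl divr_gt0.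
  apply: hd; last by rewrite ltrDl divr_gt0.
  by rewrite /= opprD addNKr normrN gtr0_norm ?divr_gt0// ltr_pdivrMr// ltr_pMr// ltr1n.
apply: lt_le_trans xz _; apply: lb_le_inf.
  have [K _ [_ hK]] := @df_tails (1 - p) ltac:(lra).
  by exists K => /=; lra.
move=> y /= py; rewrite leNgt; apply/negP => /ltW/nd; lra.
Qed.

Lemma df_quantile_le (p x : R) : 0 < p < 1 -> p <= G x -> inf [set y | p <= G y] <= x.
Proof.
move=> /andP[p0 p1] Gx; case: GP => nd _ _ _; apply: ge_inf => //.
have [K _ [hK _]] := df_tails p0.
exists (- K) => y /= py; rewrite leNgt; apply/negP => /ltW/nd; lra.
Qed.

End DistributionFunction.

Section CvLaw.
Context {R : realType}.

(* convergence at the continuity points of G, stated without mentioning them *)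
Definition cv_law (U : set_system nat) (Ld : nat -> (R -> R) -> R) (G : R -> R) :=
  (forall x v, G x < v -> \forall d \near U, Ld d (ind x) < v) /\
  (forall x x' v, x' < x -> v < G x' -> \forall d \near U, v < Ld d (ind x)).

Lemma cv_law_sub (U V : set_system nat) Ld G : U `<=` V ->
  cv_law U Ld G -> cv_law V Ld G.
Proof. by move=> UV [h1 h2]; split => [x v xv|x x' v xx v1]; apply: UV; [exact: h1|exact: h2 v1]. Qed.

Variables (U : set_system nat) (Ld : nat -> (R -> R) -> R) (G : R -> R).
Hypotheses (GP : distribution_function G) (LdG : cv_law U Ld G).

Lemma cv_law_tight {UF : Filter U} e : (forall d, Ld d (fun=> 1) = 1) ->
  0 < e -> exists2 K, 0 < K & \forall d \near U,
    Ld d (ind (- K)) <= e /\ Ld d (fun=> 1) - Ld d (ind K) <= e.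
Proof.
move=> L1 e0; have [K K0 [h1 h2]] := df_tails GP e0; case: LdG => c1 c2.
exists (K + 1); first by rewrite addr_gt0.
have i1 : G (- (K + 1)) < e.
  by apply: le_lt_trans h1; case: GP => nd _ _ _; apply: nd; lra.
apply: filterS2 (c1 _ _ i1) (c2 (K + 1) K (1 - e) ltac:(lra) ltac:(lra)) => d.
by rewrite L1 => /ltW ? ?; split => //; lra.
Qed.

(** The ultralimit agrees with the law of [G] on half-lines ending at continuity points of [G],
    which are dense; both are tight, so they agree on bounded continuous functions. *)
Lemma cv_law_ulim {UU : UltraFilter U} (mu : probability R R) (h : R -> R) :
  (forall d, posfun (Ld d)) -> (forall d, Ld d (fun=> 1) = 1) ->
  is_law mu G -> bmeas h -> continuous h -> ulim U Ld h = \int[mu]_x h x.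
Proof.
move=> LdP L1 muG bh ch; have PU : ProperFilter U by exact: ultra_proper.
have LC : \forall d \near U, Ld d (fun=> 1) <= 1 by apply: nearW => d; rewrite L1.
have b1 : bmeas ((fun=> 1) : R -> R) by exact: bmeas_cst.
have Gnd : {homo G : x y / x <= y} by case: GP.
apply: (@posfun_eq_continuous _ (ulim U Ld) (fun f => \int[mu]_x f x)
  [set c | {for c, continuous G}]) => //.
- exact: ulim_posfun LdP LC.
- exact: Rint_posfun.
- by apply: (ulim_tight LdP LC) => e e0; exact: cv_law_tight.
- move=> e e0; have [K K0 [h1 h2]] := df_tails GP e0; exists K => //.
  by rewrite !(Rint_ind_law _ muG) probability_Rint_cst; split; exact: ltW.
- move=> x y xy; have [c cab cf] := @nondecreasing_continuity_point _ G x y xy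
    (fun x y _ xy _ => Gnd _ _ xy).
  by exists c.
- rewrite probability_Rint_cst; apply: cvg_lim => //.
  by under eq_fun do rewrite L1; exact: cvg_cst.
- move=> x /= cx; rewrite (Rint_ind_law _ muG); case: LdG => c1 c2.
  apply/eqP; rewrite eq_le; apply/andP; split.
    apply/ler_addgt0Pr => e e0; apply: (ulim_le LdP LC (bmeas_ind x)).
    by have := c1 x (G x + e) ltac:(by rewrite ltrDl); apply: filterS => d /ltW.
  apply/ler_addgt0Pr => e e0; rewrite -lerBlDr.
  have [d /= d0 hd] := cvgr_gt (G x) cx (G x - e) ltac:(by rewrite ltrBlDr ltrDl).
  apply: (ulim_ge LdP LC (bmeas_ind x)).
  have Gd : G x - e < G (x - d / 2).
    apply: hd; rewrite /= opprB addrC subrK gtr0_norm ?divr_gt0//.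
    by rewrite ltr_pdivrMr// ltr_pMr// ltr1n.
  have := c2 x (x - d / 2) (G x - e) ltac:(by rewrite ltrBlDr ltrDl divr_gt0) Gd.
  by apply: filterS => d1 /ltW.
Qed.

End CvLaw.

Section Sums.
Context {R : realType} (lam : nat -> nat -> R) (a b : nat -> R) (q G : R -> R).
Hypothesis lamP : forall j, eigen_seq (lam j).
Hypothesis b0 : forall d, 0 < b d.
Hypothesis boo : b d @[d --> \oo] --> +oo.
Hypothesis negl : forall tau : R, 0 < tau ->
  (fun d => \big[maxe/0%E]_(j < d) (\sum_(0 <= k <oo)
     (lbar (lam j) k * (lbar (lam j) k < expR (- tau * b d))%R%:R)%:E)%E) @ \oo --> 0%E.
Hypothesis qni : forall x y : R, 0 < x -> x <= y -> y < 1 -> q y <= q x.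
Hypothesis GP : distribution_function G.
Hypothesis qG : forall eps : R, 0 < eps < 1 -> {for eps, continuous q} ->
  q eps = inf [set x | 1 - eps ^+ 2 <= G x].
Hypothesis lnn : forall eps : R, 0 < eps < 1 -> {for eps, continuous q} ->
  (fun d => (ln ((complexity lam d eps)%:R) - a d - q eps * b d) / b d) @ \oo --> (0:R).
Variable P : nat -> probability R R.
Hypothesis PP : forall j (f : R -> \bar R),
  measurable_fun setT f -> (forall x, 0 <= f x)%E ->
  (\int[P j]_x f x = \sum_(0 <= k <oo) (lbar (lam j) k)%:E * f (info lam j k))%E.

Definition good (eps : R) := 0 < eps < 1 /\ {for eps, continuous q}.

Definition lnrank d eps : R := ln ((complexity lam d eps)%:R).

Lemma lnrank_asymp eps tau : good eps -> 0 < tau -> \forall d \near \oo,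
  `|lnrank d eps - a d - q eps * b d| <= tau * b d.
Proof.
move=> [e01 ce] t0; have /cvgrPdist_le/(_ _ t0) := lnn e01 ce.
apply: filterS => d; rewrite sub0r normrN normrM normfV (gtr0_norm (b0 d)).
by rewrite ler_pdivrMr.
Qed.

Lemma lnrankK d eps : good eps -> expR (lnrank d eps) = (complexity lam d eps)%:R.
Proof. by move=> [e01 _]; rewrite lnK// posrE ltr0n (complexity_gt0 lamP PP). Qed.

Lemma good_dense u v : 0 <= u -> u < v -> v <= 1 -> exists2 eps, good eps & u < eps < v.
Proof.
(* The margins stay inside the open unit interval even if [u = 0] or [v = 1]; outside it [q] is not
   known to be monotone. *)
move=> u0 uv v1; have [|eps eps1 ce] :=
    @nonincreasing_continuity_point _ q (u + (v - u) / 4) (u + 3 * (v - u) / 4) ltac:(lra).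
  by move=> x y h1 h2 h3; apply: qni; lra.
by exists eps; [split => //; lra | lra].
Qed.

Lemma level_dense s t : 0 <= s -> s < t -> t <= 1 ->
  exists2 eps, good eps & s < 1 - eps ^+ 2 < t.
Proof.
move=> s0 st t1; have [|||eps ge /andP[e1 e2]] := @good_dense (Num.sqrt (1 - t)) (Num.sqrt (1 - s)).
- exact: sqrtr_ge0.
- by rewrite ltr_sqrt; lra.
- by rewrite -[leRHS]sqrtr1 ler_sqrt//; lra.
exists eps => //; case: ge => /andP[p0 p1] _.
have : 1 - t < eps ^+ 2.
  by rewrite -[ltLHS]sqr_sqrtr ?subr_ge0// ltr_pXn2r// ?nnegrE ?sqrtr_ge0// ltW.
have : eps ^+ 2 < 1 - s.
  rewrite -[ltRHS]sqr_sqrtr; last lra.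
  by rewrite ltr_pXn2r// ?nnegrE ?sqrtr_ge0// ltW.
by move=> h1 h2; apply/andP; split; lra.
Qed.

Lemma good_level eps : good eps -> 0 < 1 - eps ^+ 2 < 1.
Proof.
move=> [/andP[e0 e1] _]; have : 0 < eps ^+ 2 by rewrite exprn_gt0.
have : eps ^+ 2 < 1 by rewrite expr_lt1// ltW.
by move=> *; apply/andP; split; lra.
Qed.

Lemma q_gt eps x : good eps -> G x < 1 - eps ^+ 2 -> x < q eps.
Proof.
move=> ge Gx; have [e01 ce] := ge; rewrite qG//.
by apply: df_quantile_gt => //; exact: good_level.
Qed.

Lemma q_le eps x : good eps -> 1 - eps ^+ 2 <= G x -> q eps <= x.
Proof.
move=> ge Gx; have [e01 ce] := ge; rewrite qG//.
by apply: df_quantile_le => //; exact: good_level.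
Qed.

Lemma near_b_large M : \forall d \near \oo, M <= b d.
Proof. by move/cvgryPge : boo; exact. Qed.

Lemma expR_small tau e : 0 < tau -> 0 < e -> \forall d \near \oo, expR (- (tau * b d)) <= e.
Proof.
move=> t0 e0; apply: filterS (near_b_large (- ln e / tau)) => d h.
rewrite -[leRHS](@lnK _ e)// ler_expR lerNl.
by rewrite mulrC -ler_pdivrMr.
Qed.

(** Take a good level strictly between [G x] and [v], so that [x < q eps]. If the distribution
    function reached [v], [complexity_le] would put [lnrank d eps] below [a d + x * b d], against
    its asymptotics [a d + q eps * b d]. *)
Lemma sum_cdf_lt x v : G x < v ->
  \forall d \near \oo, sum_cdf P d (a d + x * b d) < v.
Proof.
move=> Gv; have c1 d y : sum_cdf P d y <= 1.
  by rewrite -lee_fin fineK ?fin_num_measure// probability_le1.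
have [v1|v1] := ltP 1 v; first by apply: nearW => d; exact: le_lt_trans v1.
have [eps ge /andP[l1 l2]] := level_dense (df_ge0 GP x) Gv v1.
have qx := q_gt ge l1; have t0 : 0 < (q eps - x) / 2 by rewrite divr_gt0// subr_gt0.
apply: filterS (lnrank_asymp ge t0) => d; rewrite ler_norml => /andP[h _].
rewrite ltNge; apply/negP => vF.
have := complexity_le lamP PP ge.1 (ltW (lt_le_trans l2 vF)).
rewrite -lnrankK// ler_expR => h2.
have : (q eps - x) / 2 * b d > 0 by rewrite mulr_gt0.
by move: h h2; rewrite mulrBl => *; have := mulrBl (b d) (q eps) x; lra.
Qed.

(** Now [q eps <= x' < x], so the term of [complexity_ge] involving the rank is at most
    [expR (- ((x - x') / 2 * b d))], which vanishes because [b d] tends to infinity. *)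
Lemma sum_cdf_gt x x' v : x' < x -> v < G x' ->
  \forall d \near \oo, v < sum_cdf P d (a d + x * b d).
Proof.
move=> xx vG; have [v0|v0] := ltP v 0.
  by apply: nearW => d; apply: lt_le_trans v0 _; exact: sum_cdf_ge0.
have [eps ge /andP[l1 l2]] := level_dense v0 vG (df_le1 GP x').
have qx := q_le ge (ltW l2).
have t0 : 0 < (x - x') / 2 by rewrite divr_gt0// subr_gt0.
have e0 : 0 < (1 - eps ^+ 2 - v) / 2 by rewrite divr_gt0// subr_gt0.
apply: filterS2 (lnrank_asymp ge t0) (expR_small t0 e0) => d.
rewrite ler_norml => /andP[_ h] h2.
have := complexity_ge lamP PP d (a d + x * b d) ge.1.
rewrite -lnrankK// -expRD.
have : expR (lnrank d eps + - (a d + x * b d)) <= expR (- ((x - x') / 2 * b d)).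
  rewrite ler_expR; have : q eps * b d <= x' * b d by rewrite ler_pM2r.
  by move: h; rewrite mulrAC mulrBl; lra.
lra.
Qed.

Definition norm_sum d (h : R -> R) : R :=
  \int[sum_law P 0 d]_s h ((s - a d) / b d).

Lemma measurable_affine (c e : R) : measurable_fun setT (fun s : R => (s - c) / e).
Proof. by apply: measurable_funM => //; exact: measurable_funB. Qed.

Lemma norm_sum_posfun d : posfun (norm_sum d).
Proof.
have m := measurable_affine (a d) (b d); split.
- by move=> f g bf bg; rewrite /norm_sum RintD//; exact: bmeas_comp.
- by move=> c f bf; rewrite /norm_sum RintZ//; exact: bmeas_comp.
- by move=> f g bf bg fg; apply: le_Rint => //; exact: bmeas_comp.
Qed.

Lemma norm_sum1 d : norm_sum d (fun=> 1) = 1.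
Proof. exact: probability_Rint_cst. Qed.

Lemma norm_sum_ind d x : norm_sum d (ind x) = sum_cdf P d (a d + x * b d).
Proof.
rewrite /sum_cdf -Rint_ind; congr (Rintegral _ _ _); apply/funext => s.
by rewrite !indE ler_pdivrMr// lerBlDl.
Qed.

Lemma norm_sum_cv_law : cv_law \oo norm_sum G.
Proof.
split=> [x v Gv|x x' v xx Gv].
  by apply: filterS (sum_cdf_lt Gv) => d; rewrite norm_sum_ind.
by apply: filterS (sum_cdf_gt xx Gv) => d; rewrite norm_sum_ind.
Qed.

(** [P j] does not charge the negative half-line. This comparison form is the one abstracted later
    as [nonneg_law]. *)
Lemma info_law_support j (f g : R -> R) : bmeas f -> bmeas g ->
  (forall u, 0 <= u -> f u <= g u) -> \int[P j]_u f u <= \int[P j]_u g u.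
Proof.
move=> bf bg fg; have bn : bmeas (\1_(`]-oo, 0[) : R -> R) by exact: bmeas_indic.
have n0 : \int[P j]_u (\1_(`]-oo, 0[) u : R) = 0.
  rewrite /Rintegral PP; last 2 first.
  - by apply/measurable_EFinP; exact: measurable_indic.
  - by move=> x; rewrite lee_fin.
  rewrite eseries0// => k _ _; rewrite indicE memNset ?mule0//=.
  by rewrite in_itv/=; apply/negP; rewrite -leNgt; exact: info_ge0.
have [[_ [K hK]] [_ [K' hK']]] := (bf, bg).
suff : \int[P j]_u f u <= \int[P j]_u (g u + (K + K') * \1_(`]-oo, 0[) u).
  by rewrite RintD ?RintZ ?n0 ?mulr0 ?addr0//; exact: bmeasZ.
apply: le_Rint => //; first by apply: bmeasD => //; exact: bmeasZ.
move=> u; rewrite indicE; have [u0|u0] := leP 0 u.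
  by rewrite memNset ?mulr0 ?addr0 ?fg//= in_itv/=; apply/negP; rewrite -leNgt.
rewrite mem_set ?mulr1/= ?in_itv//=.
by have := hK u; have := hK' u; rewrite !ler_norml => /andP[h1 _] /andP[_ h2]; lra.
Qed.

Lemma info_law_negligible tau e : 0 < tau -> 0 < e -> \forall d \near \oo,
  forall j, (j < d)%N -> \int[P j]_u (1 - ind (tau * b d) u) <= e.
Proof.
move=> t0 e0.
have := negl t0; move/fine_cvgP => [fin /cvgr_lt/(_ e e0)].
apply: filterS2 fin => d fin h j jd; apply: le_trans (ltW h).
have b1 := bmeas_ind_compl (tau * b d).
rewrite -lee_fin /= (fineK fin).
apply: le_trans (le_bigmax _ _ (Ordinal jd)) => /=.
rewrite -integral_bmeas// PP; last 2 first.
- by apply/measurable_EFinP; case: b1.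
- by move=> x; rewrite lee_fin subr_ge0 ind_le1.
apply: lee_nneseries => k _; first by rewrite -EFinM lee_fin mulr_ge0 ?lbar_ge0 ?subr_ge0 ?ind_le1.
rewrite -EFinM lee_fin indE /info; have := lbar_ge0 (lamP j) k.
rewrite le0r => /orP[/eqP ->|l0]; first by rewrite !mul0r.
apply: ler_wpM2l; rewrite ?(ltW l0)// mulNr; have [h1|h1] := leP (- ln (lbar (lam j) k)) (tau * b d).
  by rewrite subrr.
by rewrite subr0 -{1}[lbar _ _]lnK ?posrE// ltr_expR ltrNr h1.
Qed.

(** The added summand is nonnegative, whence the first bound, and exceeds [z] only with the
    subtracted probability, whence the second. *)
Lemma sum_cdf_mono d y z : 
  sum_cdf P d.+1 y <= sum_cdf P d y /\
  sum_cdf P d y - \int[P d]_u (1 - ind z u) <= sum_cdf P d.+1 (y + z).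
Proof.
have bi (y' x : R) : bmeas (fun u : R => ind y' (x + u)).
  by apply: bmeas_comp (bmeas_ind y'); exact: measurable_funD.
have bi2 (y' : R) : bmeas (fun x : R => \int[P d]_u ind y' (x + u)).
  apply: (bmeas_marginal (P d) (P d) (f := fun z => ind y' (z.1 + z.2))).
  by apply: bmeas_comp (bmeas_ind y'); exact: measurable_add_pair.
have b1z := bmeas_ind_compl z.
rewrite /sum_cdf -!Rint_ind /= add0n !Rint_conv; [|exact: bmeas_ind..].
split.
  apply: le_Rint => //; first exact: bmeas_ind.
  move=> x; rewrite -[leRHS](probability_Rint_cst (P d)).
  apply: info_law_support => // [|u u0]; first exact: bmeas_cst.
  rewrite !indE ler_nat; case: (leP (x + u) y) => // h.
  by rewrite (le_trans _ h)// lerDl.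
set c := \int[P d]_u _; rewrite -[c](probability_Rint_cst (sum_law P 0 d)) -RintB//; last 2 first.
- exact: bmeas_ind.
- exact: bmeas_cst.
apply: le_Rint => //; first by apply: bmeasB; [exact: bmeas_ind|exact: bmeas_cst].
move=> x; rewrite lerBlDr -RintD// -[leLHS](probability_Rint_cst (P d)).
apply: le_Rint; [exact: bmeas_cst|exact: bmeasD|] => u.
rewrite !indE; have [xy|xy] := leP x y; last by rewrite addr_ge0// subr_ge0 lern1 leq_b1.
have [uz|uz] := leP u z; first by rewrite lerD// subrr addr0.
by rewrite subr0 lerDr.
Qed.

Lemma lnrank_le eps d y : good eps -> 1 - eps ^+ 2 <= sum_cdf P d y -> lnrank d eps <= y.
Proof.
by move=> ge h; rewrite -ler_expR lnrankK//; apply: (complexity_le lamP PP) => //; case: ge.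
Qed.

Lemma lnrank_ge eps d tau : good eps -> 0 < tau ->
  1 - eps ^+ 2 - expR (- (tau * b d)) <= sum_cdf P d (lnrank d eps + tau * b d).
Proof.
move=> ge t0; have := complexity_ge lamP PP d (lnrank d eps + tau * b d) ge.1.
rewrite -lnrankK// -expRD; have -> : lnrank d eps + - (lnrank d eps + tau * b d) = - (tau * b d) by ring.
by rewrite -lerBlDr.
Qed.

Lemma near_succ (Q : nat -> Prop) : (\forall d \near \oo, Q d) -> \forall d \near \oo, Q d.+1.
Proof. by move=> [N _ hN]; exists N => // d /= Nd; apply: hN; rewrite /= ltnW. Qed.

(** The gap between the levels [1 - eps ^+ 2] and [1 - eps' ^+ 2] absorbs, half each, the
    exponential error of [lnrank_ge] and the mass of a large new summand. *)
Lemma lnrank_compare eps eps' tau : good eps -> good eps' -> eps < eps' -> 0 < tau ->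
  \forall d \near \oo, lnrank d.+1 eps' <= lnrank d eps + tau * (b d + b d.+1) /\
    lnrank d eps' <= lnrank d.+1 eps + tau * b d.+1.
Proof.
move=> ge ge' ee t0; have [/andP[p0 p1] _] := ge; have [/andP[p0' p1'] _] := ge'.
have e0 : 0 < (eps' ^+ 2 - eps ^+ 2) / 2.
  by rewrite divr_gt0// subr_gt0 ltr_pXn2r// ?nnegrE ltW.
have E := expR_small t0 e0.
apply: filterS3 E (near_succ E) (near_succ (info_law_negligible t0 e0)) => d h1 h2 h3.
have hn := h3 d (ltnSn d); split.
  rewrite mulrDr addrA; apply: lnrank_le => //.
  have [_] := sum_cdf_mono d (lnrank d eps + tau * b d) (tau * b d.+1).
  by have := lnrank_ge d ge t0; lra.
apply: lnrank_le => //.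
have [h _] := sum_cdf_mono d (lnrank d.+1 eps + tau * b d.+1) 0.
by have := lnrank_ge d.+1 ge t0; lra.
Qed.

Lemma good_left eps e : good eps -> 0 < e -> exists2 eps', good eps' & eps' < eps /\ q eps' <= q eps + e.
Proof.
move=> [/andP[e0 e1] ce] ep; have [d /= d0 hd] := cvgr_lt _ ce (q eps + e) ltac:(by rewrite ltrDl).
have [|||eps' ge' /andP[l1 l2]] := @good_dense (Num.max 0 (eps - d)) eps.
- by rewrite le_max lexx.
- by rewrite gt_max e0 ltrBlDr ltrDl.
- exact: ltW.
exists eps' => //; split => //; apply/ltW/hd; move: l1; rewrite gt_max => /andP[_ l1].
by rewrite /= gtr0_norm ?subr_gt0// ltrBlDr -ltrBlDl.
Qed.

Lemma good_right eps e : good eps -> 0 < e -> exists2 eps', good eps' & eps < eps' /\ q eps - e <= q eps'.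
Proof.
move=> [/andP[e0 e1] ce] ep; have [d /= d0 hd] := cvgr_gt _ ce (q eps - e) ltac:(by rewrite ltrBlDr ltrDl).
have [|||eps' ge' /andP[l1 l2]] := @good_dense eps (Num.min 1 (eps + d)).
- exact: ltW.
- by rewrite lt_min e1 ltrDl.
- by rewrite ge_min lexx.
exists eps' => //; split => //; apply/ltW/hd; move: l2; rewrite lt_min => /andP[_ l2].
by rewrite /= distrC gtr0_norm ?subr_gt0// ltrBlDl.
Qed.

(** If [q] took one value at all good levels, [G] would be the unit step at that value. *)
Lemma nondegenerate_levels : ~ degenerate G ->
  exists e1 e2, [/\ good e1, good e2, e1 < e2 & q e2 < q e1].
Proof.
move=> nd; apply: contrapT => no; apply: nd.
have cst e1 e2 : good e1 -> good e2 -> q e1 = q e2.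
  wlog : e1 e2 / e1 <= e2.
    by move=> W g1 g2; have [/W ->//|/ltW/W ->//] := leP e1 e2.
  rewrite le_eqVlt => /predU1P[->//|lt] g1 g2.
  have : q e2 <= q e1.
    by apply: qni; [case: g1 => /andP[]|exact: ltW|case: g2 => /andP[]].
  rewrite le_eqVlt => /predU1P[->//|qlt].
  by case: no; exists e1, e2.
have [e0 g0 _] := @good_dense 0 1 (lexx _) ltr01 (lexx _).
exists (q e0) => x; have [qx|xq] := leP (q e0) x; apply/eqP; rewrite eq_le.
  rewrite df_le1//= leNgt; apply/negP => Gx.
  have [eps ge /andP[l1 _]] := level_dense (df_ge0 GP x) Gx (lexx _).
  by have := q_gt ge l1; rewrite (cst _ _ ge g0); lra.
rewrite df_ge0// andbT leNgt; apply/negP => Gx.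
have [eps ge /andP[_ l2]] := level_dense (lexx _) Gx (df_le1 GP x).
by have := q_le ge (ltW l2); rewrite (cst _ _ ge g0); lra.
Qed.

(** Here [u], [A] and the [l] are the scale, shift and log-ranks at [d], while [v], [B] and the [k]
    are those at [d.+1]; primes mark neighbouring levels. The differences between two levels,
    [D * u] and [D * v] up to multiples of [t * u] and [t * v], are free of the shifts, and they are
    nearly equal. *)
Lemma ratio_arith (e D t u v A B x1 x2 x1' x2' l1 l2 l1' l2' k1 k2 k1' k2' : R) :
  0 < e -> D = x1 - x2 -> t * 9 + 4 * (t * e) = e * D -> 0 < t -> 0 < D ->
  0 < u -> 0 < v -> x1' <= x1 + t -> x2 <= x2' + t ->
  `|l1 - A - x1 * u| <= t * u -> `|l2 - A - x2 * u| <= t * u ->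
  `|l1' - A - x1' * u| <= t * u -> `|l2' - A - x2' * u| <= t * u ->
  `|k1 - B - x1 * v| <= t * v -> `|k2 - B - x2 * v| <= t * v ->
  `|k1' - B - x1' * v| <= t * v -> `|k2' - B - x2' * v| <= t * v ->
  k1 <= l1' + t * (u + v) -> l1 <= k1' + t * v ->
  k2' <= l2 + t * (u + v) -> l2' <= k2 + t * v ->
  `|1 - v / u| <= e.
Proof.
move=> e0 DE tE t0 D0 u0 v0 r1 r2.
rewrite !ler_norml => /andP[g1 g2] /andP[g3 g4] /andP[g5 g6] /andP[g7 g8].
move=> /andP[h1 h2] /andP[h3 h4] /andP[h5 h6] /andP[h7 h8] c1 c1' c2 c2'.
have b1 w : 0 < w -> x1' * w <= x1 * w + t * w by move=> w0; rewrite -mulrDl ler_pM2r.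
have b2 w : 0 < w -> x2 * w <= x2' * w + t * w by move=> w0; rewrite -mulrDl ler_pM2r.
have f1 := b1 _ u0; have f2 := b1 _ v0; have f3 := b2 _ u0; have f4 := b2 _ v0.
have du : D * u = x1 * u - x2 * u by rewrite DE mulrBl.
have dv : D * v = x1 * v - x2 * v by rewrite DE mulrBl.
have m1 : D * v <= D * u + 4 * (t * v) + 5 * (t * u) by rewrite du dv; lra.
have m2 : D * u <= D * v + 3 * (t * u) + 6 * (t * v) by rewrite du dv; lra.
clear -e0 tE t0 D0 u0 v0 m1 m2.
have te0 : 0 < t * e by rewrite mulr_gt0.
have Dt : 0 < D - 4 * t.
  have h : e * (D - 4 * t) = 9 * t by rewrite mulrBr mulrCA (mulrC e t); lra.
  by rewrite -(pmulr_rgt0 _ e0) h mulr_gt0.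
have eb : e * u * D = (9 * t + 4 * (t * e)) * u by rewrite mulrAC -tE; ring.
have N : `|u - v| <= e * u.
  rewrite ler_norml; apply/andP; split.
    rewrite lerNl opprB -(ler_pM2l Dt).
    have -> : (D - 4 * t) * (e * u) = 9 * (t * u) by rewrite mulrBl [D * _]mulrC eb; ring.
    by rewrite !mulrBl !mulrBr; lra.
  have [h|h] := leP u v.
    by apply: (@le_trans _ _ 0); [rewrite subr_le0 | rewrite mulr_ge0// ltW].
  rewrite -(ler_pM2l D0) [leRHS]mulrC eb mulrBr mulrDl.
  have : t * v <= t * u by rewrite ler_pM2l// ltW.
  have : 0 <= 4 * (t * e) * u by rewrite mulr_ge0 ?(ltW u0)// mulr_ge0// ltW.
  by lra.
rewrite -ler_norml.
have -> : 1 - v / u = (u - v) / u by rewrite mulrBl divff// gt_eqF.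
by rewrite normrM normfV (gtr0_norm u0) ler_pdivrMr.
Qed.

Lemma norming_ratio : ~ degenerate G -> b d.+1 / b d @[d --> \oo] --> (1 : R).
Proof.
move=> /nondegenerate_levels[e1 [e2 [g1 g2 e12 q12]]].
have [D DE] : exists D, D = q e1 - q e2 by exists (q e1 - q e2).
have D0 : 0 < D by rewrite DE subr_gt0.
apply/cvgrPdist_le => e ep.
(* Solves [9 * t = e * (D - 4 * t)]: the comparison yields [(D - 4 * t) * (v - u) <= 9 * t * u],
   that is [v - u <= e * u]. *)
pose t := e * D / (9 + 4 * e).
have s0 : 0 < 9 + 4 * e by lra.
have t0 : 0 < t by rewrite /t divr_gt0// mulr_gt0.
have tE : t * 9 + 4 * (t * e) = e * D by rewrite /t; field; rewrite gt_eqF.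
have te0 : 0 < t * e by rewrite mulr_gt0.
have [e1' g1' [l1 r1]] := good_left g1 t0.
have [e2' g2' [l2 r2]] := good_right g2 t0.
have A1 := lnrank_asymp g1 t0; have A2 := lnrank_asymp g2 t0.
have A1' := lnrank_asymp g1' t0; have A2' := lnrank_asymp g2' t0.
have C1 := lnrank_compare g1' g1 l1 t0; have C2 := lnrank_compare g2 g2' l2 t0.
near=> d.
have a1 : `|lnrank d e1 - a d - q e1 * b d| <= t * b d by near: d; exact: A1.
have a2 : `|lnrank d e2 - a d - q e2 * b d| <= t * b d by near: d; exact: A2.
have a1' : `|lnrank d e1' - a d - q e1' * b d| <= t * b d by near: d; exact: A1'.
have a2' : `|lnrank d e2' - a d - q e2' * b d| <= t * b d by near: d; exact: A2'.
have s1 : `|lnrank d.+1 e1 - a d.+1 - q e1 * b d.+1| <= t * b d.+1.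
  by near: d; exact: near_succ A1.
have s2 : `|lnrank d.+1 e2 - a d.+1 - q e2 * b d.+1| <= t * b d.+1.
  by near: d; exact: near_succ A2.
have s1' : `|lnrank d.+1 e1' - a d.+1 - q e1' * b d.+1| <= t * b d.+1.
  by near: d; exact: near_succ A1'.
have s2' : `|lnrank d.+1 e2' - a d.+1 - q e2' * b d.+1| <= t * b d.+1.
  by near: d; exact: near_succ A2'.
have [c1 c1'] : lnrank d.+1 e1 <= lnrank d e1' + t * (b d + b d.+1) /\
    lnrank d e1 <= lnrank d.+1 e1' + t * b d.+1 by near: d; exact: C1.
have [c2 c2'] : lnrank d.+1 e2' <= lnrank d e2 + t * (b d + b d.+1) /\
    lnrank d e2' <= lnrank d.+1 e2 + t * b d.+1 by near: d; exact: C2.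
have r2' : q e2 <= q e2' + t by rewrite -lerBlDr.
exact: (ratio_arith ep DE tE t0 D0 (b0 d) (b0 d.+1) r1 r2' a1 a2 a1' a2' s1 s2 s1' s2' c1 c1' c2 c2').
Unshelve. all: by end_near. Qed.

End Sums.

(** * Self-decomposability of the limit *)

Section LawCdf.
Context {R : realType} (mu : probability R R).

Let idR : R -> R := idfun.
#[local] HB.instance Definition _ :=
  @isMeasurableFun.Build _ _ _ _ idR (@measurable_id _ _ setT).

Let cdfE x : cdf (idR : {RV mu >-> R}) x = mu `]-oo, x].
Proof. by []. Qed.

Lemma law_distribution : distribution_function (fun x => fine (mu `]-oo, x])).
Proof.
split.
- move=> x y xy; rewrite fine_le ?fin_num_measure//.
  exact: (cdf_nondecreasing (idR : {RV mu >-> R})).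
- move=> x; apply: fine_cvg; rewrite fineK ?fin_num_measure//.
  have := @cdf_right_continuous _ _ _ mu (idR : {RV mu >-> R}) x.
  by apply: cvg_trans; apply: near_eq_cvg; apply: nearW => y; rewrite cdfE.
- exact/fine_cvg/(cvg_cdfNy0 (idR : {RV mu >-> R})).
- exact/fine_cvg/(cvg_cdfy1 (idR : {RV mu >-> R})).
Qed.

End LawCdf.

Section Ramp.
Context {R : realType}.

(** A substitute for [ind x] that descends from [1] at [x] to [0] at [x + k^-1]. Its Lipschitz
    constant is inherited by the convolved functions in [conv_limit]. *)
Definition ramp (x k y : R) : R := Num.min 1 (Num.max 0 (1 - k * (y - x))).

Lemma ramp01 x k y : 0 <= ramp x k y <= 1.
Proof. by rewrite /ramp ge_min lexx /= le_min ler01 le_max lexx. Qed.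

Lemma ramp_lip x k y z : 0 <= k -> `|ramp x k y - ramp x k z| <= k * `|y - z|.
Proof.
move=> k0; have -> : k * `|y - z| = `|(1 - k * (y - x)) - (1 - k * (z - x))|.
  by rewrite -[k in LHS]ger0_norm// -normrM -normrN; congr (`|_|); ring.
rewrite /ramp; set u := 1 - _; set v := 1 - _.
have := normr_ge0 (u - v); have := ler_norm (u - v); have := ler_norm (- (u - v)).
rewrite normrN ler_norml /Num.min /Num.max => h1 h2 h3.
clearbody u v; case: (ltP 0 u) => ?; case: (ltP 0 v) => ?;
  by do 2! [case: ltP => ?]; apply/andP; split; lra.
Qed.

Lemma ramp_ge x k y : 0 <= k -> ind x y <= ramp x k y.
Proof.
move=> k0; rewrite indE; case: (leP y x) => yx; last by case/andP: (ramp01 x k y).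
rewrite /ramp.
rewrite le_min lexx /= le_max; apply/orP; right.
by rewrite lerDl oppr_ge0 mulr_ge0_le0// subr_le0.
Qed.

Lemma ramp_le x k y : 0 < k -> ramp x k y <= ind (x + k^-1) y.
Proof.
move=> k0; rewrite indE; case: (leP y (x + k^-1)) => yx; first by case/andP: (ramp01 x k y).
rewrite /ramp ge_min; apply/orP; right; rewrite ge_max lexx /= subr_le0.
by rewrite -ler_pdivrMl// mulr1 lerBrDl ltW.
Qed.

Lemma continuous_lip (c : R) (f : R -> R) :
  (forall y z, `|f y - f z| <= c * `|y - z|) -> continuous f.
Proof.
move=> lip x; apply/cvgrPdist_le => e e0.
have c0 : 0 < `|c| + 1 by rewrite ltr_wpDl.
near=> y; apply: le_trans (lip x y) _.
have yx : `|x - y| <= e / (`|c| + 1).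
  near: y; apply: (@cvgr_dist_le _ _ _ _ _ (fun y : R => y) x); first exact: cvg_id.
  by rewrite divr_gt0.
apply: (@le_trans _ _ ((`|c| + 1) * `|x - y|)).
  by rewrite ler_wpM2r// (le_trans (ler_norm c))// lerDl.
by rewrite mulrC -ler_pdivlMr.
Unshelve. all: by end_near. Qed.

Lemma bmeas_continuous (f : R -> R) (K : R) : continuous f ->
  (forall x, `|f x| <= K) -> bmeas f.
Proof. by move=> cf fK; split; [exact: continuous_measurable_fun | exists K]. Qed.

Lemma bmeas_ramp x k : 0 <= k -> bmeas (ramp x k).
Proof.
move=> k0; apply: (@bmeas_continuous _ 1).
  by apply: (@continuous_lip k) => y z; exact: ramp_lip.
by move=> y; have /andP[h1 h2] := ramp01 x k y; rewrite ger0_norm.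
Qed.

(** For [x < y] the ramp of slope [(y - x)^-1] lies between [ind x] and [ind y]; then let [y]
    decrease to [x]. *)
Lemma law_eq_lip (mu1 mu2 : probability R R) :
  (forall x k, 0 < k -> \int[mu1]_y ramp x k y = \int[mu2]_y ramp x k y) ->
  forall x, mu1 `]-oo, x] = mu2 `]-oo, x].
Proof.
have le (m1 m2 : probability R R) :
    (forall x k, 0 < k -> \int[m1]_y ramp x k y = \int[m2]_y ramp x k y) ->
    forall x, fine (m1 `]-oo, x]) <= fine (m2 `]-oo, x]).
  move=> e x; have [_ rc _ _] := law_distribution m2.
  apply: (cvgr_to_ge (rc x)).
  near=> y; have xy : x < y by near: y; exact: nbhs_right_gt.
  have k0 : 0 < (y - x)^-1 by rewrite invr_gt0 subr_gt0.
  rewrite -!Rint_ind; apply: (@le_trans _ _ (\int[m1]_z ramp x (y - x)^-1 z)).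
    by apply: le_Rint => [||z]; [exact: bmeas_ind|exact/bmeas_ramp/ltW|exact/ramp_ge/ltW].
  rewrite e//; apply: le_Rint => [||z]; [exact/bmeas_ramp/ltW|exact: bmeas_ind|].
  by have := ramp_le x z k0; rewrite invrK subrKC.
move=> e x; rewrite -(fineK (fin_num_measure mu1 _ _))// -(fineK (fin_num_measure mu2 _ _))//.
by congr EFin; apply/eqP; rewrite eq_le !le// => y k k0; rewrite e.
Unshelve. all: by end_near. Qed.

End Ramp.

Section Affine.
Context {R : realType} (mu : probability R R).

Definition affine_law (c e : R) (h : R -> R) : R := \int[mu]_s h ((s - c) / e).

Lemma affine_posfun c e : posfun (affine_law c e).
Proof.
have m := measurable_affine c e; split.
- by move=> f g bf bg; rewrite /affine_law RintD//; exact: bmeas_comp.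
- by move=> k f bf; rewrite /affine_law RintZ//; exact: bmeas_comp.
- by move=> f g bf bg fg; apply: le_Rint => //; exact: bmeas_comp.
Qed.

Lemma affine1 c e : affine_law c e (fun=> 1) = 1.
Proof. exact: probability_Rint_cst. Qed.

Lemma affine_ind c e x : 0 < e -> affine_law c e (ind x) = fine (mu `]-oo, c + x * e]).
Proof.
move=> e0; rewrite -Rint_ind; congr (Rintegral _ _ _); apply/funext => s.
by rewrite !indE ler_pdivrMr// lerBlDl.
Qed.

End Affine.

Lemma bmeas_conv_integral {R : realType} (nu : probability R R) (f : R -> R) :
  bmeas f -> bmeas (fun x : R => \int[nu]_y f (x + y)).
Proof.
move=> bf; apply: (bmeas_marginal nu nu (f := fun z => f (z.1 + z.2))).
by apply: bmeas_comp bf; exact: measurable_add_pair.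
Qed.

Lemma bmeas_shift {R : realType} (f : R -> R) (x : R) : bmeas f -> bmeas (fun y : R => f (x + y)).
Proof. by move=> bf; apply: bmeas_comp bf; exact: measurable_funD. Qed.

Lemma Rint_sum_law_split {R : realType} (P : nat -> probability R R) m n (f : R -> R) :
  bmeas f -> \int[sum_law P 0 (m + n)]_s f s =
    \int[sum_law P 0 m]_x \int[sum_law P m n]_y f (x + y).
Proof.
elim: n f => [|n IH] f bf.
  rewrite addn0; congr (Rintegral _ _ _); apply/funext => x /=.
  rewrite /Rintegral integral_dirac//; last first.
    by apply/measurable_EFinP; case: (bmeas_shift x bf).
  by rewrite diracT mul1e /= addr0.
rewrite addnS /= add0n Rint_conv// IH; last exact: bmeas_conv_integral.
congr (Rintegral _ _ _); apply/funext => x.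
rewrite Rint_conv; last exact: bmeas_shift.
by congr (Rintegral _ _ _); apply/funext => y; congr (Rintegral _ _ _); apply/funext => u; rewrite addrA.
Qed.

Section SelfDecomposability.
Context {R : realType} (P : nat -> probability R R) (a b : nat -> R) (G : R -> R).
Hypothesis b0 : forall d, 0 < b d.
Hypothesis boo : b d @[d --> \oo] --> +oo.
Hypothesis GP : distribution_function G.
Hypothesis cvG : cv_law \oo (norm_sum a b P) G.
Hypothesis ratio : b d.+1 / b d @[d --> \oo] --> (1 : R).
Variable alpha : R.
Hypothesis alpha1 : 1 < alpha.

Let alpha0 : 0 < alpha. Proof. exact: lt_trans alpha1. Qed.

(** As [b] need not be monotone, this is the last suitable index rather than a threshold. It is [0]
    when no index qualifies, which cannot happen for large [d]. *)
Let m d : nat := \max_(i < d.+1 | alpha * b i <= b d) i.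

Let m_ge N : \forall d \near \oo, (N <= m d)%N.
Proof.
have /cvgryPge/(_ (alpha * b N)) h := boo.
apply: filterS2 h (nbhs_infty_ge N) => d h Nd.
have lt : (N < d.+1)%N by [].
exact: (@leq_bigmax_cond _ (fun i : 'I_d.+1 => alpha * b i <= b d) (fun i => i : nat) (Ordinal lt) h).
Qed.

Let m_spec : \forall d \near \oo,
  [/\ alpha * b (m d) <= b d, (m d < d)%N & b d < alpha * b (m d).+1].
Proof.
have /cvgryPge/(_ (alpha * b 0%N)) h := boo.
apply: filterS h => d h.
pose A : pred 'I_d.+1 := fun i => alpha * b i <= b d.
have A0 : (0 < #|A|)%N by apply/card_gt0P; exists ord0.
have [i Ai mi] := eq_bigmax_cond (fun i : 'I_d.+1 => i : nat) A0.
have {}mi : m d = i by rewrite /m -mi.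
have h1 : alpha * b (m d) <= b d by rewrite mi; exact: Ai.
have md : (m d < d)%N.
  rewrite ltn_neqAle mi -ltnS ltn_ord andbT; apply/eqP => id.
  by move: Ai; rewrite /A/= unfold_in /A id; apply/negP; rewrite -ltNge ltr_pMl.
split => //; rewrite ltNge; apply/negP => h2.
have lt : ((m d).+1 < d.+1)%N by [].
have := @leq_bigmax_cond _ A (fun i => i : nat) (Ordinal lt) h2.
by rewrite -/(m d) /= ltnn.
Qed.

Let near_m (Q : nat -> Prop) : (\forall d \near \oo, Q d) -> \forall d \near \oo, Q (m d).
Proof. by move=> [N _ hN]; apply: filterS (m_ge N) => d Nd; exact: hN. Qed.

(** By maximality of [m d] the quotient lies between [alpha] and [alpha * (b (m d).+1 / b (m d))],
    and the latter tends to [alpha]. *)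
Let r_cvg : b d / b (m d) @[d --> \oo] --> alpha.
Proof.
apply/cvgrPdist_le => e e0; have ea : 0 < e / alpha by rewrite divr_gt0.
have /cvgrPdist_le/(_ _ ea)/near_m h := ratio.
apply: filterS2 h m_spec => d; rewrite ler_norml => /andP[h1 _] [h2 _ h3].
have p := b0 (m d).
have u1 : alpha <= b d / b (m d) by rewrite ler_pdivlMr.
have u2 : b d / b (m d) <= alpha * (b (m d).+1 / b (m d)).
  by rewrite mulrA ler_pM2r ?invr_gt0// ltW.
have u3 : alpha * (b (m d).+1 / b (m d)) <= alpha + e.
  by rewrite -ler_pdivlMl// mulrDr mulVf ?gt_eqF// [_^-1 * e]mulrC; lra.
by rewrite ler_norml; apply/andP; split; lra.
Qed.

(** [LA] is the first block and [LB] the remaining one; both are divided by [b d], and their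
    centrings add up to [a d]. *)
Let LA d := affine_law (sum_law P 0 (m d)) (a (m d)) (b d).
Let LB d := affine_law (sum_law P (m d) (d - m d)) (a d - a (m d)) (b d).

Let Galpha x := G (alpha * x).

Let Galpha_df : distribution_function Galpha.
Proof.
case: GP => nd rc Ny y1; split.
- by move=> x y xy; apply: nd; rewrite ler_pM2l.
- move=> x; apply/cvgrPdist_le => e e0.
  have /cvgrPdist_le/(_ _ e0)[d /= d0 hd] := rc (alpha * x).
  near=> y; have xy : x < y by near: y; exact: nbhs_right_gt.
  apply: hd; last by rewrite /= ltr_pM2l.
  rewrite /= -mulrBr normrM (gtr0_norm alpha0) -ltr_pdivlMl// distrC gtr0_norm ?subr_gt0//.
  rewrite ltrBlDl; near: y; apply: nbhs_right_lt.
  by rewrite ltrDl mulr_gt0// invr_gt0.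
- apply/cvgrPdist_le => e e0.
  have /cvgrPdist_le/(_ _ e0)[M [Mr hM]] := Ny.
  near=> y; apply: hM; rewrite -ltr_pdivlMl//.
  by near: y; apply: nbhs_ninfty_lt; exact: num_real.
- apply/cvgrPdist_le => e e0.
  have /cvgrPdist_le/(_ _ e0)[M [Mr hM]] := y1.
  near=> y; apply: hM; rewrite -ltr_pdivrMl//.
  by near: y; apply: nbhs_pinfty_gt; exact: num_real.
Unshelve. all: by end_near. Qed.

Let LA_ind d x : LA d (ind x) = norm_sum a b P (m d) (ind (x * (b d / b (m d)))).
Proof.
rewrite /LA affine_ind// norm_sum_ind// /sum_cdf; congr (fine (_ `]-oo, (a _ + _)])).
by rewrite -mulrA divfK// gt_eqF.
Qed.

Let LA_cv : cv_law \oo LA Galpha.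
Proof.
case: cvG => c1 c2; case: (GP) => nd rc _ _.
have rx x : x * (b d / b (m d)) @[d --> \oo] --> x * alpha.
  by apply: cvgM; [exact: cvg_cst|exact: r_cvg].
split.
- move=> x v Gv; rewrite /Galpha mulrC in Gv.
  have [e /= e0 he] := cvgr_lt _ (rc (x * alpha)) _ Gv.
  have xe : x * alpha < x * alpha + e / 2 by rewrite ltrDl divr_gt0.
  have Gz : G (x * alpha + e / 2) < v.
    apply: he => //; rewrite /= opprD addNKr normrN gtr0_norm ?divr_gt0//.
    by rewrite ltr_pdivrMr// ltr_pMr// ltr1n.
  apply: filterS2 (near_m (c1 _ _ Gz)) (cvgr_lt _ (rx x) _ xe) => d h1 h2.
  rewrite LA_ind; apply: le_lt_trans h1.
  by apply: posfun_ind_le (ltW h2); exact: norm_sum_posfun.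
- move=> x x' v xx Gv; rewrite /Galpha mulrC in Gv.
  have h : x' * alpha < x * alpha by rewrite ltr_pM2r.
  pose z := (x' * alpha + x * alpha) / 2.
  have z1 : x' * alpha < z by rewrite /z; lra.
  have z2 : z < x * alpha by rewrite /z; lra.
  apply: filterS2 (near_m (c2 _ _ _ z1 Gv)) (cvgr_gt _ (rx x) _ z2) => d h1 h2.
  rewrite LA_ind; apply: lt_le_trans h1 _.
  by apply: posfun_ind_le (ltW h2); exact: norm_sum_posfun.
Qed.

Let norm_sum_split d f : (m d < d)%N -> bmeas f ->
  norm_sum a b P d f = LA d (fun x => LB d (fun y => f (x + y))).
Proof.
move=> md bf; rewrite /norm_sum /LA /LB /affine_law.
rewrite -{1}(subnKC (ltnW md)) Rint_sum_law_split; last first.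
  by apply: bmeas_comp bf; exact: measurable_affine.
congr (Rintegral _ _ _); apply/funext => x; congr (Rintegral _ _ _); apply/funext => y.
by congr f; field; rewrite gt_eqF.
Qed.

Let LAP d : posfun (LA d). Proof. exact: affine_posfun. Qed.
Let LBP d : posfun (LB d). Proof. exact: affine_posfun. Qed.
Let LA1 d : LA d (fun=> 1) = 1. Proof. exact: affine1. Qed.
Let LB1 d : LB d (fun=> 1) = 1. Proof. exact: affine1. Qed.
Let b1 : bmeas ((fun=> 1) : R -> R). Proof. exact: bmeas_cst. Qed.

Let LA_cst d c : LA d (fun=> c) = c.
Proof. by rewrite (posfun_cst (LAP d)) LA1 mulr1. Qed.

Let LB_cst d c : LB d (fun=> c) = c.
Proof. by rewrite (posfun_cst (LBP d)) LB1 mulr1. Qed.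

Let bLB d f : bmeas f -> bmeas (fun x : R => LB d (fun y => f (x + y))).
Proof.
move=> bf; pose g z : R := f (z.1 + (z.2 - (a d - a (m d))) / b d).
apply: (bmeas_marginal (sum_law P (m d) (d - m d)) (sum_law P (m d) (d - m d)) (f := g)).
apply: bmeas_comp bf; apply: measurable_funD; first exact: measurable_fst.
by apply: (measurableT_comp (measurable_affine _ _)); exact: measurable_snd.
Qed.

(** The second block is the difference of the normed sum and the first block, both tight: if it is
    at most [- (K1 + K2)], then the sum is at most [- K1] or the first block exceeds [K2]. The other
    tail is symmetric. *)
Let LB_tight e : 0 < e -> exists2 K, 0 < K & \forall d \near \oo,
  LB d (ind (- K)) <= e /\ LB d (fun=> 1) - LB d (ind K) <= e.
Proof.
move=> e0; have e2 : 0 < e / 2 by rewrite divr_gt0.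
have [K1 K10 h1] := cv_law_tight GP cvG (@norm_sum1 _ a b P) e2.
have [K2 K20 h2] := cv_law_tight Galpha_df LA_cv LA1 e2.
exists (K1 + K2); first by rewrite addr_gt0.
apply: filterS3 h1 h2 m_spec => d [h1 h1'] [h2 h2'] [_ md _].
have NP := norm_sum_posfun a b P d.
have bK x : bmeas (ind x : R -> R) := bmeas_ind x.
have bKs (x y : R) : bmeas (fun u : R => ind x (y + u)) by apply: bmeas_shift; exact: bmeas_ind.
have bL x : bmeas (fun y : R => LB d (fun u => ind x (y + u))) by exact: bLB.
split.
  rewrite -(LA_cst d (LB d _)).
  apply: (@le_trans _ _ (LA d (fun x => LB d (fun y => ind (- K1) (x + y)) + (1 - ind K2 x)))).
    apply: (le_posfun (LAP d)); [exact: bmeas_cst|by apply: bmeasD => //; exact: bmeasB|].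
    move=> x; rewrite -[1 - _](LB_cst d) -(posfunD (LBP d))//; last exact: bmeas_cst.
    apply: (le_posfun (LBP d)) => //; first by apply: bmeasD => //; exact: bmeas_cst.
    move=> y; rewrite !indE; have [yK|yK] := leP y (- (K1 + K2)); last first.
      by rewrite addr_ge0// subr_ge0 lern1 leq_b1.
    have [xK|xK] := leP x K2; last by rewrite subr0 lerDr.
    by rewrite (_ : x + y <= - K1) ?subrr ?addr0//; lra.
  rewrite (posfunD (LAP d))//; last exact: bmeasB.
  rewrite -norm_sum_split// (posfunB (LAP d))//; lra.
rewrite LB1 -(LA_cst d (1 - _)).
apply: (@le_trans _ _ (LA d (fun x => (1 - LB d (fun y => ind K1 (x + y))) + ind (- K2) x))).
  apply: (le_posfun (LAP d)); [exact: bmeas_cst|by apply: bmeasD => //; exact: bmeasB|].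
  move=> x; rewrite -(LB1 d) -!(posfunB (LBP d))// -[ind (- K2) x](LB_cst d) -(posfunD (LBP d))//; last 2 first.
  - exact: bmeasB.
  - exact: bmeas_cst.
  apply: (le_posfun (LBP d)); [exact: bmeasB|by apply: bmeasD; [exact: bmeasB|exact: bmeas_cst]|].
  move=> y; rewrite !indE; have [yK|yK] := leP y (K1 + K2).
    by rewrite subrr addr_ge0// subr_ge0 lern1 leq_b1.
  rewrite subr0; have [xK|xK] := leP x (- K2); first by rewrite lerDr subr_ge0 lern1 leq_b1.
  by rewrite (_ : (x + y <= K1) = false) ?subr0 ?addr0//; apply/negbTE; rewrite -ltNge; lra.
rewrite (posfunD (LAP d))//; last exact: bmeasB.
rewrite (posfunB (LAP d))// -norm_sum_split//; rewrite (norm_sum1 a b P) in h1'; rewrite LA1; lra.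
Qed.

(** Both factors vary with [d], so pointwise convergence of the integrated function [Hd d] to [H] is
    not enough. The common Lipschitz constant [k] makes it uniform on segments, and tightness of
    [LA] handles the rest. *)
Let conv_limit (U : set_system nat) (UU : UltraFilter U) (nu rho : probability R R)
    (x0 k : R) : \oo `<=` U -> is_law nu Galpha ->
  (forall h : R -> R, bmeas h -> continuous h -> ulim U LB h = \int[rho]_x h x) ->
  0 < k ->
  norm_sum a b P d (ramp x0 k) @[d --> U] --> \int[convolution nu rho]_x ramp x0 k x.
Proof.
move=> sub nuG rhoE k0; have PU : ProperFilter U by exact: ultra_proper.
have bh := bmeas_ramp x0 (ltW k0); set h := ramp x0 k in bh *.
have hlip y z : `|h y - h z| <= k * `|y - z| by exact/ramp_lip/ltW.
have h1 y : `|h y| <= 1 by rewrite ger0_norm; case/andP: (ramp01 x0 k y).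
have bhs x := bmeas_shift x bh.
have LBC : \forall d \near U, LB d (fun=> 1) <= 1 by apply: nearW => d; rewrite LB1.
have LAC : \forall d \near U, LA d (fun=> 1) <= 1 by apply: nearW => d; rewrite LA1.
pose Hd d (x : R) := LB d (fun y => h (x + y)).
pose H (x : R) := \int[rho]_y h (x + y).
have bHd d : bmeas (Hd d) by exact: bLB.
have bH : bmeas H by exact: bmeas_conv_integral.
have shift_lip x x' y : `|h (x + y) - h (x' + y)| <= k * `|x - x'|.
  by apply: le_trans (hlip _ _) _; rewrite opprD addrACA subrr addr0.
have Hdlip d x x' : `|Hd d x - Hd d x'| <= k * `|x - x'|.
  rewrite /Hd -(posfunB (LBP d))// -[leRHS]mulr1 -[X in _ <= _ * X](LB1 d).
  by apply: (norm_posfun_cst (LBP d)) => //; exact: bmeasB.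
have RP := Rint_posfun rho.
have Hlip x x' : `|H x - H x'| <= k * `|x - x'|.
  rewrite /H -(posfunB RP)// -[leRHS]mulr1 -[X in _ <= _ * X](probability_Rint_cst rho).
  by apply: (norm_posfun_cst RP) => //; exact: bmeasB.
have Hd1 d x : `|Hd d x| <= 1.
  by rewrite -[leRHS]mulr1 -[X in _ <= _ * X](LB1 d); apply: (norm_posfun_cst (LBP d)).
have H1 x : `|H x| <= 1.
  by rewrite -[leRHS]mulr1 -[X in _ <= _ * X](probability_Rint_cst rho); apply: (norm_posfun_cst RP).
have HdH x : Hd d x @[d --> U] --> H x.
  rewrite /H -rhoE//; first exact: (cvg_ulim LBP LBC).
  by apply: (@continuous_lip _ k) => y z; apply: le_trans (hlip _ _) _; rewrite opprD addrACA subrr add0r.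
have cH : continuous H by exact: continuous_lip Hlip.
have LAH : LA d H @[d --> U] --> \int[convolution nu rho]_x h x.
  rewrite Rint_conv// -(cv_law_ulim Galpha_df (cv_law_sub sub LA_cv) LAP LA1 nuG bH cH).
  exact: (cvg_ulim LAP LAC).
have LAd : LA d (fun x => Hd d x - H x) @[d --> U] --> (0 : R).
  (* Budget: [e / 5] on the segment, and at most [2] on each of two tails of mass [e / 5]. *)
  apply/cvgrPdist_le => e e0; have e5 : 0 < e / 5 by rewrite divr_gt0.
  have [K K0 hK] := cv_law_tight Galpha_df (cv_law_sub sub LA_cv) LA1 e5.
  (* Compactness in near-covering form: two Lipschitz errors of [e / 20] and one pointwise error of
     [e / 10]. *)
  have unif : \forall d \near U, `[- K, K] `<=` (fun x => `|Hd d x - H x| <= e / 5).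
    have /compact_near_coveringP := @segment_compact R (- K) K; apply => x _.
    have e10 : 0 < e / 10 by rewrite divr_gt0.
    have ek : 0 < e / 20 / k by rewrite !divr_gt0.
    have /cvgrPdist_le/(_ _ e10) hx := HdH x.
    near=> x' d.
    have xx' : `|x - x'| < e / 20 / k.
      by near: x'; apply/nbhs_ballP; exists (e / 20 / k).
    have xx : k * `|x - x'| <= e / 20 by rewrite mulrC -ler_pdivlMr// ltW.
    clear xx'.
    have hd : `|H x - Hd d x| <= e / 10 by near: d; exact: hx.
    have := Hdlip d x x'; have := Hlip x x'; move: xx hd; rewrite /=.
    move: (Hd d x) (Hd d x') (H x) (H x') (k * `|x - x'|) => u u' v v' w.
    by rewrite !ler_norml => ? /andP[? ?] /andP[? ?] /andP[? ?]; apply/andP; split; lra.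
  apply: filterS2 hK unif => d [t1 t2] ud; rewrite sub0r normrN.
  have bi x : bmeas (ind x : R -> R) := bmeas_ind x.
  have bo : bmeas (fun x : R => ind (- K) x + (1 - ind K x)) by apply: bmeasD => //; exact: bmeasB.
  have bg : bmeas (fun x : R => e / 5 * 1 + 2 * (ind (- K) x + (1 - ind K x))).
    by apply: bmeasD; exact: bmeasZ.
  apply: le_trans (norm_posfun (LAP d) (bmeasB (bHd d) bH) bg _) _; last first.
    rewrite (posfunD (LAP d)) ?(posfunZ (LAP d))//; [|exact: bmeasZ..].
    by rewrite (posfunD (LAP d))// ?(posfunB (LAP d))//; [rewrite LA1 in t2 *; lra|exact: bmeasB].
  move=> x; rewrite !indE mulr1; have [xK|xK] := leP x (- K).
    have : 0 <= 1 - (x <= K)%R%:R :> R by rewrite subr_ge0 lern1 leq_b1.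
    by have := Hd1 d x; have := H1 x; rewrite !ler_norml mulr1n => /andP[? ?] /andP[? ?] ?; apply/andP; split; lra.
  rewrite add0r; have [xK'|xK'] := leP x K.
    rewrite subrr mulr0 addr0; apply: ud; rewrite /= in_itv/= xK' andbT; exact: ltW.
  by have := Hd1 d x; have := H1 x; rewrite !ler_norml mulr0n => /andP[? ?] /andP[? ?]; apply/andP; split; lra.
have -> : \int[convolution nu rho]_x h x = 0 + \int[convolution nu rho]_x h x by rewrite add0r.
apply: cvg_trans (cvgD LAd LAH); apply: near_eq_cvg.
have : \forall d \near U, (m d < d)%N by apply: sub; apply: filterS m_spec => d [].
apply: filterS => d md; rewrite norm_sum_split//.
transitivity (LA d (fun x => Hd d x - H x) + LA d H) => //.
rewrite -(posfunD (LAP d))//; last exact: bmeasB.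
by congr (LA d _); apply/funext => x; rewrite subrK.
Unshelve. all: by end_near. Qed.

Lemma self_decomposable_at : exists Fa : R -> R, distribution_function Fa /\
  exists nu : probability R R, is_law nu (fun y => G (alpha * y)) /\
    forall x, (G x)%:E = (\int[nu]_y (Fa (x - y))%:E)%E.
Proof.
have [U [UU sub]] := @ultraFilterLemma nat \oo _.
have PU : ProperFilter U by exact: ultra_proper.
have LBC : \forall d \near U, LB d (fun=> 1) <= 1 by apply: nearW => d; rewrite LB1.
have LBU1 : ulim U LB (fun=> 1) = 1.
  by apply: cvg_lim => //; under eq_fun do rewrite LB1; exact: cvg_cst.
have [|rho [rhoE _]] := posfun_representation (ulim_posfun LBP LBC).
  by apply: (ulim_tight LBP LBC) => e /LB_tight[K K0 h]; exists K => //; exact: sub.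
rewrite LBU1 in rhoE.
have [nu nuG] := law_exists Galpha_df; have [mu muG] := law_exists GP.
exists (fun x => fine (rho `]-oo, x])); split; first exact: law_distribution.
exists nu; split => // x.
have e y : mu `]-oo, y] = convolution nu rho `]-oo, y].
  apply: law_eq_lip => z k k0.
  have ck : continuous (ramp z k) by apply: (@continuous_lip _ k) => *; exact/ramp_lip/ltW.
  have bk := bmeas_ramp z (ltW k0).
  rewrite -(cv_law_ulim GP (cv_law_sub sub cvG) (norm_sum_posfun a b P) (@norm_sum1 _ a b P) muG bk ck).
  apply: cvg_lim => //; apply: conv_limit => // h bh ch.
  by rewrite rhoE// mul1r.
rewrite -muG e.
transitivity (\int[convolution nu rho]_y (\1_(`]-oo, x]) y)%:E)%E; first by rewrite integral_indic// setIT.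
rewrite ge0_integral_conv//; last by apply/measurable_EFinP; exact: measurable_indic.
apply: eq_integral => y _; rewrite fineK ?fin_num_measure//.
transitivity (\int[rho]_u (\1_(`]-oo, x - y]) u)%:E)%E; last by rewrite integral_indic// setIT.
by apply: eq_integral => u _; rewrite -!/(ind _ _) !indE lerBrDl.
Qed.

End SelfDecomposability.

Lemma degenerate_self_decomposable {R : realType} (G : R -> R) :
  degenerate G -> self_decomposable G.
Proof.
move=> [c Gc] alpha alpha1; have alpha0 : 0 < alpha := lt_trans ltr01 alpha1.
exists (fun x => fine ((dirac (c - c / alpha) : probability R R) `]-oo, x])).
split; first exact: law_distribution.
exists (dirac (c / alpha) : probability R R); split.
  move=> x; rewrite /= diracE Gc mem_setE in_itv/= ler_pdivrMr// [x * _]mulrC.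
  by case: leP.
move=> x; rewrite integral_dirac//; last first.
  apply/measurable_EFinP.
  have [nd _ _ _] := law_distribution (dirac (c - c / alpha) : probability R R).
  apply: nonincreasing_measurable => //.
  by move=> u v uv /=; apply: nd; rewrite lerB.
rewrite diracT mul1e /= indicE Gc mem_setE in_itv/= lerD2r.
by case: leP.
Qed.

(** * Characteristic functions *)

Section TrigBounds.
Context {R : realType}.
Implicit Types x y : R.

(** Generates the Taylor bounds below one after the other: each bounded expression is the derivative
    of the next. *)
Lemma ge0_of_derive (f f' : R -> R) : (forall x, is_derive x 1 f (f' x)) ->
  f 0 = 0 -> (forall x, 0 <= x -> 0 <= f' x) -> forall x, 0 <= x -> 0 <= f x.
Proof.
move=> df f00 f'0 x; rewrite le_eqVlt => /predU1P[<-|x0]; first by rewrite f00.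
have cf : {within `[0, x], continuous f}.
  apply: continuous_subspaceT => y; apply: differentiable_continuous.
  by apply/derivable1_diffP; have [] := df y.
have [c] := MVT x0 (fun y _ => df y) cf.
rewrite in_itv/= => /andP[c0 _]; rewrite f00 !subr0 => ->.
by rewrite mulr_ge0 ?f'0// ltW.
Qed.

Lemma is_derive_monomial (c : R) n x :
  is_derive x 1 (fun y => c * y ^+ n.+1) (c * n.+1%:R * x ^+ n).
Proof.
have -> : (fun y => c * y ^+ n.+1) = c \*: ((@idfun R) ^+ n.+1).
  by rewrite exprfctE.
by apply: is_derive_eq; rewrite /GRing.scale /= mulr1 mulrA.
Qed.

Lemma sin_le x : 0 <= x -> 0 <= x - sin x.
Proof.
apply: (@ge0_of_derive (fun y => y - sin y) (fun y => 1 - cos y)); last 2 first.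
- by rewrite sin0 subr0.
- by move=> y _; rewrite subr_ge0 cos_le1.
Qed.

Lemma cos_ge x : 0 <= x -> 0 <= cos x - 1 + 2^-1 * x ^+ 2.
Proof.
apply: (@ge0_of_derive (fun y => cos y - 1 + 2^-1 * y ^+ 2) (fun y => y - sin y)); last 2 first.
- by rewrite cos0 subrr expr0n mulr0 addr0.
- exact: sin_le.
move=> y; have h := is_derive_monomial 2^-1 1 y.
by apply: is_derive_eq; field.
Qed.

Lemma sin_ge x : 0 <= x -> 0 <= sin x - x + 6^-1 * x ^+ 3.
Proof.
apply: (@ge0_of_derive (fun y => sin y - y + 6^-1 * y ^+ 3)
  (fun y => cos y - 1 + 2^-1 * y ^+ 2)); last 2 first.
- by rewrite sin0 subrr expr0n mulr0 addr0.
- exact: cos_ge.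
move=> y; have h := is_derive_monomial 6^-1 2 y.
by apply: is_derive_eq; field.
Qed.

Lemma cos_le x : 0 <= x -> 0 <= 1 - cos x - 2^-1 * x ^+ 2 + 24^-1 * x ^+ 4.
Proof.
apply: (@ge0_of_derive (fun y => 1 - cos y - 2^-1 * y ^+ 2 + 24^-1 * y ^+ 4)
  (fun y => sin y - y + 6^-1 * y ^+ 3)); last 2 first.
- by rewrite cos0 subrr !expr0n !mulr0 subr0 addr0.
- exact: sin_ge.
move=> y; have h := is_derive_monomial 2^-1 1 y; have h' := is_derive_monomial 24^-1 3 y.
by apply: is_derive_eq; field.
Qed.

Lemma sin_le5 x : 0 <= x -> 0 <= x - sin x - 6^-1 * x ^+ 3 + 120^-1 * x ^+ 5.
Proof.
apply: (@ge0_of_derive (fun y => y - sin y - 6^-1 * y ^+ 3 + 120^-1 * y ^+ 5)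
  (fun y => 1 - cos y - 2^-1 * y ^+ 2 + 24^-1 * y ^+ 4)); last 2 first.
- by rewrite sin0 subrr !expr0n !mulr0 subr0 addr0.
- exact: cos_le.
move=> y; have h := is_derive_monomial 6^-1 2 y; have h' := is_derive_monomial 120^-1 4 y.
by apply: is_derive_eq; field.
Qed.

Lemma one_sub_cos_bounds x : 2^-1 * x ^+ 2 - 24^-1 * x ^+ 4 <= 1 - cos x <= 2^-1 * x ^+ 2.
Proof.
wlog x0 : x / 0 <= x.
  move=> W; have [/W//|/ltW] := leP 0 x; rewrite -oppr_ge0 => /W.
  by rewrite cosN sqrrN (_ : (- x) ^+ 4 = x ^+ 4)//; ring.
have := cos_ge x0; have := cos_le x0; by move=> *; apply/andP; split; lra.
Qed.

Lemma one_sub_cos_ge0 x : 0 <= 1 - cos x.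
Proof. by rewrite subr_ge0 cos_le1. Qed.

Lemma norm_cos_sub1 x : `|cos x - 1| <= 2^-1 * x ^+ 2.
Proof.
by rewrite distrC ger0_norm ?one_sub_cos_ge0//; case/andP: (one_sub_cos_bounds x).
Qed.

Lemma norm_cos_sub1_2 x : `|cos x - 1| <= 2.
Proof. by rewrite distrC ger0_norm ?one_sub_cos_ge0//; have := cos_geN1 x; lra. Qed.

Lemma norm_sin_le1 x : `|sin x| <= 1.
Proof. by rewrite ler_norml sin_geN1 sin_le1. Qed.

Lemma norm_sin_sub3 x : `|sin x - x| <= 6^-1 * `|x| ^+ 3.
Proof.
wlog x0 : x / 0 <= x.
  move=> W; have [/W//|/ltW] := leP 0 x; rewrite -oppr_ge0 => /W.
  by rewrite sinN -opprD !normrN.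
have := sin_le x0; have := sin_ge x0; rewrite (ger0_norm x0) => h1 h2.
by rewrite ler_norml; apply/andP; split; lra.
Qed.

Lemma norm_sin_le x : `|sin x| <= `|x|.
Proof.
wlog x0 : x / 0 <= x.
  move=> W; have [/W//|/ltW] := leP 0 x; rewrite -oppr_ge0 => /W.
  by rewrite sinN !normrN.
rewrite (ger0_norm x0); have [x1|x1] := leP x 1; last first.
  exact: le_trans (norm_sin_le1 x) (ltW x1).
have h1 := sin_le x0; have h2 := sin_ge x0.
have h3 : 0 <= 6^-1 * x ^+ 3 by rewrite mulr_ge0// exprn_ge0.
have h4 : 6^-1 * x ^+ 3 <= 6^-1 * x.
  by rewrite ler_pM2l// exprS ler_piMr// expr_le1.
by rewrite ler_norml; apply/andP; split; lra.
Qed.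

Lemma norm_sin_sub2 x : `|sin x - x| <= x ^+ 2.
Proof.
have [x2|x2] := leP `|x| 2.
  apply: le_trans (norm_sin_sub3 x) _; rewrite -[x ^+ 2]real_normK ?num_real//.
  rewrite exprSr [_ ^+ 2 * _]mulrC mulrA ler_piMl ?exprn_ge0//; lra.
apply: le_trans (ler_normB _ _) _; have := norm_sin_le1 x.
rewrite -[x ^+ 2]real_normK ?num_real// expr2.
have : 2 * `|x| <= `|x| * `|x| by rewrite ler_wpM2r// ltW.
lra.
Qed.

End TrigBounds.

Section Complex.
Context {R : realType}.
Implicit Types (x y t : R) (z w : R[i]).

Local Notation normc := Normc.normc.

Definition cis t : R[i] := (cos t +i* sin t)%C.

Lemma cis0 : cis 0 = 1.
Proof. by rewrite /cis cos0 sin0. Qed.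

Lemma cisD x y : cis (x + y) = cis x * cis y.
Proof.
rewrite /cis cosD sinD; apply/eqP; rewrite eq_complex /=; apply/andP; split; apply/eqP; ring.
Qed.

Lemma cis_sum (n : nat) (f : nat -> R) :
  cis (\sum_(j < n) f j) = \prod_(j < n) cis (f j).
Proof.
elim: n => [|n IH]; first by rewrite !big_ord0 cis0.
by rewrite !big_ord_recr /= cisD IH.
Qed.

Lemma normc_le1 z : complex.Re z ^+ 2 + complex.Im z ^+ 2 <= 1 -> normc z <= 1.
Proof.
by case: z => x y /= h; rewrite -[leRHS]sqrtr1 ler_wsqrtr.
Qed.

Lemma normc_cis t : normc (cis t) = 1.
Proof. by rewrite /= cos2Dsin2 sqrtr1. Qed.

Lemma normc_le_add z : normc z <= `|complex.Re z| + `|complex.Im z|.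
Proof.
case: z => x y /=; rewrite -[leRHS]sqr_sqrtr; last by rewrite addr_ge0.
rewrite -[leRHS]ger0_norm ?sqr_ge0// -sqrtr_sqr ler_wsqrtr// sqr_sqrtr ?addr_ge0//.
rewrite sqrrD -[x ^+ 2]real_normK ?num_real// -[y ^+ 2]real_normK ?num_real//.
by rewrite lerD2r lerDl mulrn_wge0// mulr_ge0.
Qed.

Lemma normc_ReIm z : `|complex.Re z| <= normc z /\ `|complex.Im z| <= normc z.
Proof.
case: z => x y /=; split; rewrite -sqrtr_sqr ler_wsqrtr//.
  by rewrite lerDl sqr_ge0.
by rewrite lerDr sqr_ge0.
Qed.

Lemma normc_ge0 z : 0 <= normc z.
Proof. by case: z => x y /=; exact: sqrtr_ge0. Qed.

(** Telescoping over the factors; the second conjunct is carried for the induction. *)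
Lemma norm_prod_sub (n : nat) (z w : nat -> R[i]) :
  (forall j, (j < n)%N -> normc (z j) <= 1) -> (forall j, (j < n)%N -> normc (w j) <= 1) ->
  normc (\prod_(j < n) z j - \prod_(j < n) w j) <= \sum_(j < n) normc (z j - w j) /\
  normc (\prod_(j < n) z j) <= 1.
Proof.
elim: n => [|n IH] z1 w1.
  by rewrite !big_ord0 subrr Normc.normc0 Normc.normc1.
have [] := IH (fun j jn => z1 j (ltnW jn)) (fun j jn => w1 j (ltnW jn)).
rewrite !big_ord_recr /=.
move: (\prod_(j < n) z j) (\prod_(j < n) w j) => Z W h1 h2; split; last first.
  rewrite Normc.normcM -[leRHS]mulr1 ler_pM ?normc_ge0// z1//.
have -> : Z * z n - W * w n = Z * (z n - w n) + (Z - W) * w n by ring.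
apply: le_trans (le_normcD _ _) _; rewrite !Normc.normcM addrC; apply: lerD.
  by rewrite ler_piMl ?normc_ge0.
by apply: le_trans h1; rewrite ler_piMr ?normc_ge0// w1.
Qed.

Definition cexp z : R[i] := (expR (complex.Re z))%:C%C * cis (complex.Im z).

Lemma cexp_sum (n : nat) (f : nat -> R[i]) :
  cexp (\sum_(j < n) f j) = \prod_(j < n) cexp (f j).
Proof.
elim: n => [|n IH]; first by rewrite !big_ord0 /cexp /= expR0 cis0 mul1r.
rewrite !big_ord_recr /= -IH /cexp.
move: (\sum_(i < n) f i) (f n) => [x y] [x' y'] /=.
by rewrite expRD cisD rmorphM; ring.
Qed.

Lemma normc_cexp z : normc (cexp z) = expR (complex.Re z).
Proof.
rewrite /cexp Normc.normcM normc_cis mulr1 /= expr0n /= addr0 sqrtr_sqr ger0_norm//.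
Qed.

(** A second-order estimate without smallness of [z]: on this half-plane the exponential is bounded
    by one. *)
Lemma norm_cexp_sub z : complex.Re z <= 0 ->
  normc (1 + z - cexp z) <= 2 * (`|complex.Re z| + `|complex.Im z|) ^+ 2.
Proof.
case: z => x y x0; apply: le_trans (normc_le_add _) _; move: x0 => /= x0.
rewrite !mul0r subr0 add0r addr0.
have e1 : expR x <= 1 by rewrite expR_le1.
have e0 := expR_ge0 x.
have e2 : expR x - 1 - x <= x ^+ 2.
  have p : 0 < 1 - x by lra.
  have h : expR x <= (1 - x)^-1.
    by rewrite -[expR x]invrK -expRN lef_pV2 ?posrE ?expR_gt0// expR_ge1Dx.
  have : (1 - x)^-1 <= 1 + x + x ^+ 2.
    rewrite -[leLHS]mul1r ler_pdivrMr//.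
    have -> : (1 + x + x ^+ 2) * (1 - x) = 1 + x ^+ 2 * (- x) by ring.
    by rewrite lerDl mulr_ge0 ?sqr_ge0// oppr_ge0.
  by move: h; lra.
have e3 := expR_ge1Dx x.
have n1 : `|expR x - 1 - x| <= x ^+ 2 by rewrite ger0_norm//; lra.
have n2 : `|expR x * (cos y - 1)| <= y ^+ 2.
  rewrite normrM (ger0_norm e0); apply: (@le_trans _ _ (1 * (2^-1 * y ^+ 2))).
    by rewrite ler_pM// norm_cos_sub1.
  by rewrite mul1r ler_piMl ?sqr_ge0//; lra.
have n3 : `|expR x - 1| <= `|x| by rewrite ler0_norm ?subr_le0// ler0_norm//; lra.
have n4 : `|(expR x - 1) * sin y| <= `|x| * `|y| by rewrite normrM ler_pM// norm_sin_le.
have n5 := norm_sin_sub2 y.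
have -> : 1 + x - expR x * cos y = - (expR x - 1 - x) - expR x * (cos y - 1) by ring.
have -> : y - expR x * sin y = - ((expR x - 1) * sin y) - (sin y - y) by ring.
have := ler_normB (- (expR x - 1 - x)) (expR x * (cos y - 1)).
have := ler_normB (- ((expR x - 1) * sin y)) (sin y - y).
rewrite !normrN => h1 h2.
have x2 : x ^+ 2 = `|x| ^+ 2 by rewrite real_normK ?num_real.
have y2 : y ^+ 2 = `|y| ^+ 2 by rewrite real_normK ?num_real.
have xy : 0 <= `|x| * `|y| by rewrite mulr_ge0.
rewrite sqrrD -x2 -y2 -mulr_natl; have := sqr_ge0 x; have := sqr_ge0 y.
lra.
Qed.

Definition cfun (L : (R -> R) -> R) t : R[i] :=
  (L (fun x => cos (t * x)) +i* L (fun x => sin (t * x)))%C.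

Lemma bmeas_cosM t : bmeas (fun x : R => cos (t * x)).
Proof.
apply: (@bmeas_continuous _ _ 1); last first.
  by move=> x; rewrite ler_norml cos_geN1 cos_le1.
move=> x; apply: continuous_comp; last exact: continuous_cos.
by apply: cvgM; [exact: cvg_cst|exact: cvg_id].
Qed.

Lemma bmeas_sinM t : bmeas (fun x : R => sin (t * x)).
Proof.
apply: (@bmeas_continuous _ _ 1); last by move=> x; exact: norm_sin_le1.
move=> x; apply: continuous_comp; last exact: continuous_sin.
by apply: cvgM; [exact: cvg_cst|exact: cvg_id].
Qed.

Lemma cfun_norm (L : (R -> R) -> R) t : posfun L -> L (fun=> 1) = 1 -> normc (cfun L t) <= 1.
Proof.
move=> LP L1; apply: normc_le1; rewrite /cfun /=.
set C := L _; set S := L _.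
have bc := bmeas_cosM t; have bs := bmeas_sinM t.
have b1 : bmeas ((fun=> 1) : R -> R) by exact: bmeas_cst.
have bZ k := bmeasZ k b1.
(* The variance of [exp (i t x)] about its mean [C + i S]; it equals [1 - C ^+ 2 - S ^+ 2]. *)
have h : 0 <= L (fun x => (1 + (C ^+ 2 + S ^+ 2)) * 1 - (2 * C * cos (t * x) + 2 * S * sin (t * x))).
  apply: (posfun_ge0 LP).
    by apply: bmeasB => //; apply: bmeasD; exact: bmeasZ.
  move=> x; rewrite -[X in (X + _) * 1](cos2Dsin2 (t * x)).
  rewrite (_ : _ - _ = (C - cos (t * x)) ^+ 2 + (S - sin (t * x)) ^+ 2); last by ring.
  by rewrite addr_ge0 ?sqr_ge0.
rewrite (posfunB LP) ?(posfunD LP) ?(posfunZ LP)// in h; last first.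
- by apply: bmeasD; exact: bmeasZ.
- exact: bmeasZ.
- exact: bmeasZ.
by rewrite L1 -/C -/S in h; move: h; rewrite !mulr1 -!mulrA -!expr2; lra.
Qed.

End Complex.

Section CharacteristicFunction.
Context {R : realType}.
Implicit Types (mu nu : probability R R) (t c e : R).

Definition chf mu t : R[i] := cfun (fun f => \int[mu]_x f x) t.

Lemma chf_convolution mu nu t : chf (convolution mu nu) t = chf mu t * chf nu t.
Proof.
have bc := bmeas_cosM t; have bs := bmeas_sinM t.
rewrite /chf /cfun !Rint_conv//.
have e1 (x : R) : \int[nu]_y cos (t * (x + y)) =
    cos (t * x) * \int[nu]_y cos (t * y) - sin (t * x) * \int[nu]_y sin (t * y).
  rewrite -!RintZ// -RintB//; try exact: bmeasZ.
  by congr (Rintegral _ _ _); apply/funext => y; rewrite mulrDr cosD.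
have e2 (x : R) : \int[nu]_y sin (t * (x + y)) =
    sin (t * x) * \int[nu]_y cos (t * y) + cos (t * x) * \int[nu]_y sin (t * y).
  rewrite -!RintZ// -RintD//; try exact: bmeasZ.
  by congr (Rintegral _ _ _); apply/funext => y; rewrite mulrDr sinD.
under eq_Rintegral do rewrite e1 mulrC [sin _ * _]mulrC.
under [X in (_ +i* X)%C]eq_Rintegral do rewrite e2 mulrC [cos _ * _]mulrC.
rewrite RintB ?RintD ?RintZ//; try exact: bmeasZ.
apply/eqP; rewrite eq_complex /=; apply/andP; split; apply/eqP; ring.
Qed.

Lemma chf_sum_law (P : nat -> probability R R) d t :
  chf (sum_law P 0 d) t = \prod_(j < d) chf (P j) t.
Proof.
elim: d => [|d IH]; last by rewrite big_ord_recr /= chf_convolution IH add0n.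
rewrite big_ord0 /chf /cfun /= /Rintegral !integral_dirac//; last 2 first.
- by apply/measurable_EFinP; case: (bmeas_sinM t).
- by apply/measurable_EFinP; case: (bmeas_cosM t).
by rewrite !diracT !mul1e /= mulr0 cos0 sin0.
Qed.

Lemma cfun_affine mu c e t :
  cfun (affine_law mu c e) t = cis (- (t * c / e)) * chf mu (t / e).
Proof.
have bc := bmeas_cosM (t / e); have bs := bmeas_sinM (t / e).
have E (s : R) : t * ((s - c) / e) = t / e * s - t * c / e by ring.
rewrite /chf /cfun /affine_law /cis cosN sinN.
under eq_Rintegral do rewrite E cosB mulrC [sin _ * _]mulrC.
under [X in (_ +i* X)%C]eq_Rintegral do rewrite E sinB mulrC [cos _ * _]mulrC.
rewrite RintB ?RintD ?RintZ//; try exact: bmeasZ.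
apply/eqP; rewrite eq_complex /=; apply/andP; split; apply/eqP; ring.
Qed.

End CharacteristicFunction.

(** * Symmetrization *)

Section Uniform.
Context {R : realType}.

Let idTR : measurableTypeR R -> R := idfun.

#[local] HB.instance Definition _ :=
  @isMeasurableFun.Build _ _ _ _ idTR (@measurable_id _ _ setT).

(** Pushing forward along the identity moves the uniform law from [measurableTypeR R] to [R], where
    the other laws live. *)
Definition uniform01 : probability R R :=
  distribution (uniform_prob (@ltr01 R)) idTR.

Lemma integral_uniform01 (f : R -> \bar R) : measurable_fun setT f -> (forall x, 0 <= f x)%E ->
  (\int[uniform01]_x f x = \int[@lebesgue_measure R]_(x in `[0%R, 1%R]) f x)%E.
Proof.
move=> mf f0; rewrite /uniform01 ge0_integral_distribution// integral_uniform//.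
by rewrite subr0 invr1 mul1e.
Qed.

Lemma uniform01_le (f : R -> R) (k : R) : bmeas f -> (forall x, 0 <= f x) ->
  (forall x, 0 <= x <= 1 -> f x <= k) -> \int[uniform01]_x f x <= k.
Proof.
move=> bf f0 fk; have [mf _] := bf.
have mf' : measurable_fun setT (EFin \o f) by exact/measurable_EFinP.
rewrite -lee_fin -integral_bmeas// integral_uniform01//.
apply: (@le_trans _ _ (\int[@lebesgue_measure R]_(x in `[0%R, 1%R]) k%:E)%E).
  apply: ge0_le_integral => //=.
  - by move=> x _; rewrite lee_fin.
  - exact: measurable_funTS.
by rewrite integral_cst//= lebesgue_measure_itv/= lte_fin ltr01 sube0 mule1.
Qed.

Lemma bmeas_one_sub_cosM (s : R) : bmeas (fun u : R => 1 - cos (s * u)).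
Proof. by apply: bmeasB; [exact: bmeas_cst|exact: bmeas_cosM]. Qed.

Lemma uniform01_cos (s : R) : s != 0 ->
  \int[uniform01]_u (1 - cos (s * u)) = 1 - sin s / s.
Proof.
move=> s0; have bf := bmeas_one_sub_cosM s; have [mf _] := bf.
apply: EFin_inj; rewrite -integral_bmeas// integral_uniform01; last 2 first.
- exact/measurable_EFinP.
- by move=> x; rewrite lee_fin one_sub_cos_ge0.
pose F (u : R) := u - sin (s * u) / s.
have dF (x : R) : is_derive x 1 F (1 - cos (s * x)).
  have h1 : is_derive x 1 (fun y : R => s * y) s.
    by apply: is_derive_eq; rewrite /GRing.scale /= mulr1.
  have h2 := @is_derive1_comp R sin (fun y : R => s * y) x _ _ (is_derive_sin (s * x)) h1.
  have h3 : is_derive x 1 (fun y => sin (s * y) / s) (cos (s * x)).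
    have := is_deriveZ s^-1 h2.
    have -> : s^-1 \*: (sin \o (fun y : R => s * y)) = (fun y => sin (s * y) / s).
      by apply/funext => y /=; rewrite /GRing.scale /= mulrC.
    by rewrite /GRing.scale /= mulrCA mulVf ?mulr1.
  exact: is_deriveB.
have cF : continuous F.
  by move=> x; apply: differentiable_continuous; apply/derivable1_diffP; have [] := dF x.
rewrite (@continuous_FTC2 _ _ F)//.
- by rewrite /F !mulr0 sin0 mul0r subrr mulr1 sube0.
- apply: continuous_subspaceT => x; apply: cvgB; first exact: cvg_cst.
  apply: continuous_comp; last exact: continuous_cos.
  by apply: cvgM; [exact: cvg_cst|exact: cvg_id].
- split.
  + by move=> x _; have [] := dF x.
  + by apply: cvg_at_right_filter; exact: cF.
  + by apply: cvg_at_left_filter; exact: cF.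
- by move=> x _; rewrite derive1E; have [_ ->] := dF x.
Qed.

(* 1 - sin s / s, extended by 0 at s = 0 *)
Definition sincgap (s : R) : R := \int[uniform01]_u (1 - cos (s * u)).

Lemma sincgap_ge0 s : 0 <= sincgap s.
Proof.
rewrite -(probability_Rint_cst uniform01 0); apply: le_Rint; first exact: bmeas_cst.
- exact: bmeas_one_sub_cosM.
- by move=> x; exact: one_sub_cos_ge0.
Qed.

Lemma sincgapN s : sincgap (- s) = sincgap s.
Proof. by congr (Rintegral _ _ _); apply/funext => u; rewrite mulNr cosN. Qed.

Lemma sincgap_ge_half s : 2 <= `|s| -> 2^-1 <= sincgap s.
Proof.
wlog s0 : s / 0 <= s.
  move=> W; have [/W//|/ltW] := leP 0 s; rewrite -oppr_ge0 => /W.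
  by rewrite sincgapN normrN.
rewrite ger0_norm// => s2; have s0' : 0 < s by lra.
rewrite /sincgap uniform01_cos ?gt_eqF//.
have : sin s / s <= 2^-1 by rewrite ler_pdivrMr//; have := sin_le1 s; lra.
lra.
Qed.

(** If [|s| >= 2] the gap is at least [1 / 2]. Otherwise it is at least
    [s^2 / 6 - s^4 / 120 >= 2 s^2 / 15], and [8 * 2 / 15 > 1]. *)
Lemma sincgap_ge_min s : Num.min 1 (s ^+ 2) <= 8 * sincgap s.
Proof.
wlog s0 : s / 0 <= s.
  move=> W; have [/W//|/ltW] := leP 0 s; rewrite -oppr_ge0 => /W.
  by rewrite sincgapN sqrrN.
have [s2|s2] := leP 2 s.
  have := @sincgap_ge_half s; rewrite ger0_norm// => /(_ s2) h.
  by rewrite ge_min; apply/orP; left; lra.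
move: s0; rewrite le_eqVlt => /predU1P[<-|s0].
  by rewrite ge_min expr0n; apply/orP; right; rewrite mulr_ge0// sincgap_ge0.
rewrite ge_min; apply/orP; right; rewrite /sincgap uniform01_cos ?gt_eqF//.
have h := sin_le5 (ltW s0).
have : sin s / s <= 1 - 6^-1 * s ^+ 2 + 120^-1 * s ^+ 4.
  by rewrite ler_pdivrMr// -subr_ge0; apply: le_trans h _; rewrite le_eqVlt; apply/orP; left; apply/eqP; ring.
have : s ^+ 4 <= 4 * s ^+ 2.
  have -> : s ^+ 4 = s ^+ 2 * s ^+ 2 by ring.
  by rewrite ler_wpM2r ?sqr_ge0// (_ : 4 = 2 ^+ 2) ?ler_sqr ?nnegrE ?ltW//; ring.
have := sqr_ge0 s; lra.
Qed.

End Uniform.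

Section Clip.
Context {R : realType}.
Implicit Types x y : R.

Definition clip x : R := Num.max (-1) (Num.min 1 x).

Lemma clip_cases x : [\/ x <= -1 /\ clip x = -1, -1 <= x <= 1 /\ clip x = x | 1 <= x /\ clip x = 1].
Proof.
rewrite /clip; have [x1|x1] := leP 1 x.
  by apply: Or33; split=> //; rewrite max_r//; lra.
have [x2|x2] := leP x (-1); first by apply: Or31.
by apply: Or32; split=> //; apply/andP; split; apply: ltW.
Qed.

Lemma norm_clip_le1 x : `|clip x| <= 1.
Proof. by have [[_ ->]|[h ->]|[_ ->]] := clip_cases x; rewrite ?normrN ?normr1// ler_norml. Qed.

Lemma clip_lip x y : `|clip x - clip y| <= `|x - y|.
Proof.
wlog xy : x y / x <= y.
  by move=> W; have [/W//|/ltW/W] := leP x y; rewrite distrC [leRHS]distrC.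
rewrite distrC [leRHS]distrC [leRHS]ger0_norm ?subr_ge0// ler_norml.
by have [[? ->]|[/andP[? ?] ->]|[? ->]] := clip_cases x;
  have [[? ->]|[/andP[? ?] ->]|[? ->]] := clip_cases y; apply/andP; split; lra.
Qed.

Lemma clip_homo x y : x <= y -> clip x <= clip y.
Proof.
by move=> xy; have [[? ->]|[/andP[? ?] ->]|[? ->]] := clip_cases x;
  have [[? ->]|[/andP[? ?] ->]|[? ->]] := clip_cases y; lra.
Qed.

Lemma continuous_clip : continuous clip.
Proof. by apply: (@continuous_lip _ 1) => y z; rewrite mul1r clip_lip. Qed.

Lemma bmeas_clip : bmeas clip.
Proof. by apply: (bmeas_continuous continuous_clip) => x; exact: norm_clip_le1. Qed.

Lemma clip_eq0 x : (clip x == 0) = (x == 0).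
Proof.
by have [[? ->]|[? ->]|[? ->]] := clip_cases x => //; apply/eqP/eqP; lra.
Qed.

Lemma clip0 : clip 0 = 0.
Proof. by apply/eqP; rewrite clip_eq0. Qed.

Lemma clip_sqr x : clip x ^+ 2 = Num.min 1 (x ^+ 2).
Proof.
have [[h ->]|[h ->]|[h ->]] := clip_cases x.
- by rewrite sqrrN expr1n min_l// -(expr1n _ 2) -(sqrrN x) ler_sqr ?nnegrE; lra.
- by rewrite min_r// -(expr1n _ 2) -real_normK ?num_real// ler_sqr ?nnegrE// ler_norml.
- by rewrite expr1n min_l// -(expr1n _ 2) ler_sqr ?nnegrE; lra.
Qed.

Lemma clip_sqr_le1 x : clip x ^+ 2 <= 1.
Proof. by rewrite clip_sqr ge_min lexx. Qed.

Lemma clip_sqr_le x : clip x ^+ 2 <= x ^+ 2.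
Proof. by rewrite clip_sqr ge_min lexx orbT. Qed.

Lemma sqr_clip_sub_le x y : (clip x - clip y) ^+ 2 <= 4 * clip (x - y) ^+ 2.
Proof.
rewrite (clip_sqr (x - y)) minr_pMr ?ler0n// le_min; apply/andP; split.
  rewrite mulr1 (_ : 4 = 2 ^+ 2); last by ring.
  rewrite -real_normK ?num_real// ler_sqr ?nnegrE//.
  by apply: le_trans (ler_normB _ _) _; have := norm_clip_le1 x; have := norm_clip_le1 y; lra.
apply: (@le_trans _ _ ((x - y) ^+ 2)); last by have := sqr_ge0 (x - y); lra.
by rewrite -real_normK ?num_real// -[leRHS]real_normK ?num_real// ler_sqr ?nnegrE// clip_lip.
Qed.

Lemma clip_sqr_scale (c x : R) : 0 < c -> c <= 1 -> c ^+ 2 * clip x ^+ 2 <= clip (c * x) ^+ 2.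
Proof.
move=> c0 c1; rewrite !clip_sqr minr_pMr ?sqr_ge0// mulr1 exprMn.
rewrite le_min !ge_min lexx !orbT andbT; apply/orP; left.
by rewrite expr_le1 ?(ltW c0).
Qed.

End Clip.

Section Symmetrization.
Context {R : realType}.
Implicit Types (mu : probability R R) (c d t x y : R).

Definition opp_fun (x : R) : R := - x.

Lemma measurable_opp_fun : measurable_fun setT opp_fun.
Proof. exact: measurableT_comp. Qed.

HB.instance Definition _ := @isMeasurableFun.Build _ _ _ _ opp_fun measurable_opp_fun.

Definition reflection mu : probability R R := distribution mu opp_fun.

Definition symlaw mu : probability R R := convolution mu (reflection mu).

Lemma Rint_reflection mu (f : R -> R) : bmeas f ->
  \int[reflection mu]_x f x = \int[mu]_x f (- x).
Proof. exact: Rint_distribution. Qed.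

Lemma Rint_symlaw mu (f : R -> R) : bmeas f ->
  \int[symlaw mu]_y f y = \int[mu]_x \int[mu]_y f (x - y).
Proof.
move=> bf; rewrite Rint_conv//; congr (Rintegral _ _ _); apply/funext => x.
by rewrite Rint_reflection//; exact: bmeas_shift.
Qed.

Lemma bmeas_sub_cst (f : R -> R) c : bmeas f -> bmeas (fun x : R => f (x - c)).
Proof.
move=> bf; have := bmeas_shift (- c) bf.
by congr bmeas; apply/funext => x; rewrite addrC.
Qed.

Lemma bmeas_cst_sub (f : R -> R) x : bmeas f -> bmeas (fun y : R => f (x - y)).
Proof.
move=> bf; apply: (@bmeas_comp _ _ _ _ _ (fun y : R => x - y) f) => //.
exact: measurable_funB.
Qed.

Lemma bmeas_sub_integral mu (f : R -> R) : bmeas f -> bmeas (fun x : R => \int[mu]_y f (x - y)).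
Proof.
move=> bf; have := bmeas_conv_integral (reflection mu) bf.
congr bmeas; apply/funext => x.
by rewrite Rint_reflection//; exact: bmeas_shift.
Qed.

Lemma symlaw_cos mu t : \int[symlaw mu]_y cos (t * y) = Normc.normc (chf mu t) ^+ 2.
Proof.
have e : chf (reflection mu) t = (complex.Re (chf mu t) -i* complex.Im (chf mu t))%C.
  rewrite /chf /cfun /= !Rint_reflection; [|exact: bmeas_sinM|exact: bmeas_cosM].
  congr (_ +i* _)%C; first by congr (Rintegral _ _ _); apply/funext => x; rewrite mulrN cosN.
  rewrite -mulN1r -RintZ; last exact: bmeas_sinM.
  by congr (Rintegral _ _ _); apply/funext => x; rewrite mulrN sinN mulN1r.
have -> : \int[symlaw mu]_y cos (t * y) = complex.Re (chf (symlaw mu) t) by [].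
rewrite chf_convolution e; case: (chf mu t) => u v /=.
by rewrite sqr_sqrtr ?addr_ge0 ?sqr_ge0//; ring.
Qed.

Lemma bmeas_one_sub_cos_pair d : bmeas (fun z : R * R => 1 - cos (d * z.1 * z.2)).
Proof.
have := @bmeas_comp _ _ _ _ _ (fun z : R * R => z.1 * z.2) (fun s : R => 1 - cos (d * s)) _
  (bmeas_one_sub_cosM d).
rewrite (_ : (fun z : R * R => 1 - cos (d * z.1 * z.2)) =
  (fun z : R * R => 1 - cos (d * (z.1 * z.2)))); last first.
  by apply/funext => z; rewrite mulrA.
by apply; apply: measurable_funM; [exact: measurable_fst | exact: measurable_snd].
Qed.

Lemma bmeas_sincgapM d : bmeas (fun y : R => sincgap (d * y)).
Proof.
exact: (@bmeas_marginal _ _ _ _ _ uniform01 uniform01 _ (bmeas_one_sub_cos_pair d)).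
Qed.

Lemma Rint_sincgap mu d : \int[mu]_y sincgap (d * y) =
  \int[uniform01]_u (1 - \int[mu]_y cos (d * u * y)).
Proof.
rewrite (Rint_exchange mu uniform01 (bmeas_one_sub_cos_pair d)) /=.
congr (Rintegral _ _ _); apply/funext => u.
rewrite -[X in _ = X - _](probability_Rint_cst mu 1) -RintB.
- by congr (Rintegral _ _ _); apply/funext => y; rewrite mulrAC.
- exact: bmeas_cst.
- exact: bmeas_cosM.
Qed.

Lemma bmeas_clip_sqr : bmeas (fun x : R => clip x ^+ 2).
Proof. by have := bmeasM (@bmeas_clip R) (@bmeas_clip R). Qed.

(** For independent [X], [Y] of law [mu] the centring kills the cross term, so
    [E (clip (X - c) - clip (Y - c))^2] is twice the left side; pointwise the square is at most
    [4 * clip (X - Y) ^+ 2]. *)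
Lemma symlaw_clip mu c : \int[mu]_x clip (x - c) = 0 ->
  \int[mu]_x clip (x - c) ^+ 2 <= 2 * \int[symlaw mu]_y clip y ^+ 2.
Proof.
move=> c0; set s := leLHS.
have bt := bmeas_sub_cst c (@bmeas_clip R); have bt2 := bmeas_sub_cst c bmeas_clip_sqr.
have b2 := bmeas_clip_sqr.
have e1 (x : R) : \int[mu]_y (clip (x - c) - clip (y - c)) ^+ 2 = clip (x - c) ^+ 2 + s.
  transitivity (\int[mu]_y (clip (x - c) ^+ 2 + ((- 2 * clip (x - c)) * clip (y - c) + clip (y - c) ^+ 2))).
    by congr (Rintegral _ _ _); apply/funext => y; ring.
  rewrite RintD; [|exact: bmeas_cst|by apply: bmeasD => //; exact: bmeasZ].
  rewrite probability_Rint_cst (RintD mu (bmeasZ _ bt) bt2) (RintZ mu _ bt).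
  by rewrite c0 mulr0 add0r.
have e2 : \int[mu]_x \int[mu]_y (clip (x - c) - clip (y - c)) ^+ 2 = 2 * s.
  under eq_Rintegral do rewrite e1.
  by rewrite RintD//; [rewrite probability_Rint_cst -/s; ring|exact: bmeas_cst].
suff : 2 * s <= 4 * \int[symlaw mu]_y clip y ^+ 2 by lra.
rewrite -e2 Rint_symlaw// -RintZ; last exact: (bmeas_sub_integral mu b2).
apply: le_Rint.
- under eq_fun do rewrite e1.
  by apply: bmeasD => //; exact: bmeas_cst.
- by apply: bmeasZ; exact: (bmeas_sub_integral mu b2).
move=> x; rewrite -RintZ; last exact: (bmeas_cst_sub x b2).
apply: le_Rint.
- have := bmeasB (bmeas_cst R (clip (x - c))) bt => h; exact: (bmeasM h h).
- by apply: bmeasZ; exact: (bmeas_cst_sub x b2).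
- move=> y; have := sqr_clip_sub_le (x - c) (y - c).
  by rewrite (_ : x - c - (y - c) = x - y)//; ring.
Qed.

(** Weak symmetrization: if [X - c > 3 / d] and the independent copy satisfies [Y <= 1 / d], an
    event of probability at least one half, then [d * (X - Y) > 2] and [sincgap] is at least one
    half there. Hence [4 = 2 * 2]. *)
Lemma symlaw_tail mu c d : 0 < d -> 0 <= c -> 2^-1 <= \int[mu]_y ind d^-1 y ->
  \int[mu]_x (1 - ind (3 / d) (x - c)) <= 4 * \int[symlaw mu]_y sincgap (d * y).
Proof.
move=> d0 c0 half; have bs := bmeas_sincgapM d.
rewrite Rint_symlaw// -RintZ; last exact: (bmeas_sub_integral mu bs).
have bi : bmeas (fun x : R => 1 - ind (3 / d) (x - c)).
  exact: (bmeas_sub_cst _ (bmeas_ind_compl (3 / d))).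
apply: le_Rint => //; first by apply: bmeasZ; exact: (bmeas_sub_integral mu bs).
move=> x; set I := 1 - _.
have I0 : 0 <= I by rewrite /I subr_ge0 ind_le1.
apply: (@le_trans _ _ (2 * (I * \int[mu]_y ind d^-1 y))).
  by rewrite mulrCA ler_peMr//; lra.
rewrite (_ : 4 = 2 * 2); last by ring.
rewrite -mulrA ler_wpM2l// -(RintZ mu I (bmeas_ind _)).
rewrite -(RintZ mu 2 (bmeas_cst_sub x bs)).
apply: le_Rint.
- by apply: bmeasZ; exact: bmeas_ind.
- by apply: bmeasZ; exact: (bmeas_cst_sub x bs).
move=> y; have g0 := sincgap_ge0 (d * (x - y)).
rewrite /I !indE; have [x1|x1] := leP (x - c) (3 / d).
  by rewrite mulr1n subrr mul0r mulr_ge0.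
have [y1|y1] := leP y d^-1; last by rewrite mulr0n mulr0 mulr_ge0.
rewrite mulr0n subr0 mulr1n mulr1.
suff : 2^-1 <= sincgap (d * (x - y)) by lra.
apply: sincgap_ge_half; apply: le_trans (ler_norm _).
have -> : (2 : R) = d * (2 / d) by rewrite mulrC mulfVK// gt_eqF.
rewrite ler_pM2l//.
have : 3 / d = 2 / d + d^-1 by ring.
lra.
Qed.

End Symmetrization.

(** * Centering and the accompanying exponents *)

Section Center.
Context {R : realType}.
Implicit Types (mu : probability R R) (c tau e : R).

(** Stands in for the mean, which may be infinite. The constraint and the default make it
    nonnegative for every [mu], as [symlaw_tail] requires. *)
Definition clip_center mu : R := xget 0 [set c | 0 <= c /\ \int[mu]_x clip (x - c) = 0].

Definition nonneg_law mu := forall f g : R -> R, bmeas f -> bmeas g ->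
  (forall u : R, 0 <= u -> f u <= g u) -> \int[mu]_u f u <= \int[mu]_u g u.

Lemma center_ge0 mu : 0 <= clip_center mu.
Proof. by rewrite /clip_center; case: xgetP => [_ -> [] //|]. Qed.

Lemma clip_integral_lt0 mu tau : 0 < tau -> tau <= 1 ->
  4 * \int[mu]_x (1 - ind tau x) <= tau -> \int[mu]_x clip (x - 2 * tau) < 0.
Proof.
move=> t0 t1 h; have b1 := bmeas_ind_compl tau.
apply: (@le_lt_trans _ _ (\int[mu]_x (- tau + 2 * (1 - ind tau x)))).
  apply: le_Rint.
  - exact/bmeas_sub_cst/bmeas_clip.
  - by apply: bmeasD; [exact: bmeas_cst|exact: bmeasZ].
  move=> x; rewrite indE; have [xt|xt] := leP x tau; last first.
    rewrite mulr0n; have := norm_clip_le1 (x - 2 * tau); rewrite ler_norml; lra.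
  rewrite mulr1n; have : clip (x - 2 * tau) <= clip (- tau) by apply: clip_homo; lra.
  by have [[? ->]|[_ ->]|[? ->]] := clip_cases (- tau); lra.
rewrite RintD ?RintZ ?probability_Rint_cst//; [lra|exact: bmeas_cst|exact: bmeasZ].
Qed.

Lemma continuous_clip_integral mu : continuous (fun c : R => \int[mu]_x clip (x - c)).
Proof.
apply: (@continuous_lip _ 1) => y z; rewrite mul1r.
have bc c : bmeas (fun x : R => clip (x - c)) by exact/bmeas_sub_cst/bmeas_clip.
rewrite -RintB// -[leRHS](probability_Rint_cst mu); apply: le_norm_Rint.
- exact: bmeasB.
- exact: bmeas_cst.
move=> x; apply: le_trans (clip_lip _ _) _.
by rewrite distrC (_ : x - z - (x - y) = y - z)//; ring.
Qed.

(** The clipped integral is continuous and non-increasing in [c], nonnegative at [0] because [mu]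
    is, and negative at [2 * tau] because little mass exceeds [tau]. *)
Lemma centerP mu tau : nonneg_law mu -> 0 < tau -> tau <= 1 ->
  4 * \int[mu]_x (1 - ind tau x) <= tau ->
  \int[mu]_x clip (x - clip_center mu) = 0 /\ clip_center mu <= 2 * tau.
Proof.
move=> mu0 t0 t1 h; have neg := clip_integral_lt0 t0 t1 h.
have pos : 0 <= \int[mu]_x clip (x - 0).
  rewrite -[X in X <= _](probability_Rint_cst mu 0); apply: mu0; first exact: bmeas_cst.
    exact/bmeas_sub_cst/bmeas_clip.
  by move=> u u0; rewrite subr0 -[leLHS]clip0 clip_homo.
have [] : 0 <= clip_center mu /\ \int[mu]_x clip (x - clip_center mu) = 0.
  rewrite /clip_center; case: xgetP => [c -> //|no].
  have t20 : 0 <= 2 * tau by lra.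
  have cc : {within `[0, 2 * tau], continuous (fun c : R => \int[mu]_x clip (x - c))}.
    by apply: continuous_subspaceT; exact: continuous_clip_integral.
  have [|c] := @IVT _ _ _ _ 0 t20 cc.
    by rewrite ge_min le_max pos (ltW neg) orbT.
  by rewrite in_itv/= => /andP[c0 _] e; case: (no c).
move=> c0 e; split => //; rewrite leNgt; apply/negP => lt.
suff : \int[mu]_x clip (x - clip_center mu) <= \int[mu]_x clip (x - 2 * tau) by rewrite e; lra.
apply: le_Rint; [exact/bmeas_sub_cst/bmeas_clip|exact/bmeas_sub_cst/bmeas_clip|].
by move=> x; apply: clip_homo; lra.
Qed.

Definition cvar mu : R := \int[mu]_x clip (x - clip_center mu) ^+ 2.

Lemma cvar_le mu tau : nonneg_law mu -> 0 < tau -> clip_center mu <= tau ->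
  cvar mu <= tau ^+ 2 + \int[mu]_x (1 - ind tau x).
Proof.
move=> mu0 t0 ct; have c0 := center_ge0 mu.
have b1 := bmeas_ind_compl tau.
rewrite -[X in X + _](probability_Rint_cst mu) -RintD//; last exact: bmeas_cst.
apply: mu0; first exact: (bmeas_sub_cst _ bmeas_clip_sqr).
  by apply: bmeasD => //; exact: bmeas_cst.
move=> u u0; rewrite indE; have [ut|ut] := leP u tau.
  rewrite mulr1n subrr addr0; apply: le_trans (clip_sqr_le _) _.
  rewrite -real_normK ?num_real// ler_sqr ?nnegrE//; last exact: ltW.
  by rewrite ler_norml; lra.
by rewrite mulr0n subr0 (le_trans (clip_sqr_le1 _))// lerDr sqr_ge0.
Qed.

End Center.

Lemma Rint_sum d (T : measurableType d) (R : realType) (mu : {finite_measure set T -> \bar R})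
    n (f : nat -> T -> R) : (forall j, bmeas (f j)) ->
  \int[mu]_x (\sum_(j < n) f j x) = \sum_(j < n) \int[mu]_x f j x.
Proof.
move=> bf; elim: n => [|n IH].
  under eq_Rintegral do rewrite big_ord0.
  by rewrite big_ord0 Rint_cst mul0r.
rewrite big_ord_recr -IH /= -RintD//; last by apply: bmeas_sum.
by congr (Rintegral _ _ _); apply/funext => x; rewrite big_ord_recr.
Qed.

(** Used in the form: a product of factors [1 - x j] close to one forces a small sum of the [x j].
    The signs complete the induction. *)
Lemma prod_one_sub_le (R : realFieldType) n (x : nat -> R) :
  (forall j, (j < n)%N -> 0 <= x j <= 1) ->
  (\prod_(j < n) (1 - x j)) * (1 + \sum_(j < n) x j) <= 1 /\
  0 <= \prod_(j < n) (1 - x j) /\ 0 <= \sum_(j < n) x j.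
Proof.
elim: n => [|n IH] x01; first by rewrite !big_ord0 addr0 mulr1.
have [h1 [h2 h3]] := IH (fun j jn => x01 j (ltnW jn)).
have /andP[x0 x1] := x01 n (leqnn _).
rewrite !big_ord_recr /=; move: (\prod_(j < n) _) (\sum_(j < n) _) (x n) h1 h2 h3 x0 x1 => p s y h1 h2 h3 y0 y1.
split; last by split; [rewrite mulr_ge0// subr_ge0|exact: addr_ge0].
have -> : p * (1 - y) * (1 + (s + y)) = p * (1 + s) - p * (y * s) - p * (y * y) by ring.
have := mulr_ge0 h2 (mulr_ge0 y0 h3); have := mulr_ge0 h2 (mulr_ge0 y0 y0); lra.
Qed.

Section Kernels.
Context {R : realType}.
Implicit Types (t x : R).

(* real and imaginary parts of (exp(itx) - 1 - it clip x) / clip x ^+ 2, extended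
   by continuity at 0; as x / 0 = 0, only the real part needs a correction there *)
Definition ker_cos t x : R := (cos (t * x) - 1) / clip x ^+ 2 - t ^+ 2 / 2 * (x == 0)%:R.

Definition ker_sin t x : R := (sin (t * x) - t * clip x) / clip x ^+ 2.

Lemma clip_ker_cos t x : clip x ^+ 2 * ker_cos t x = cos (t * x) - 1.
Proof.
rewrite /ker_cos; have [->|x0] := eqVneq x 0.
  by rewrite clip0 expr0n mul0r mulr0 cos0 subrr.
by rewrite mulr0n mulr0 subr0 mulrC mulfVK// expf_neq0// clip_eq0.
Qed.

Lemma clip_ker_sin t x : clip x ^+ 2 * ker_sin t x = sin (t * x) - t * clip x.
Proof.
rewrite /ker_sin; have [->|x0] := eqVneq x 0.
  by rewrite clip0 expr0n mul0r !mulr0 sin0 subrr.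
by rewrite mulrC mulfVK// expf_neq0// clip_eq0.
Qed.

Lemma clip_id x : `|x| <= 1 -> clip x = x.
Proof. by rewrite ler_norml => /andP[? ?]; have [[? ->]|[? ->]|[? ->]] := clip_cases x; lra. Qed.

Lemma clip_sqr1 x : 1 <= `|x| -> clip x ^+ 2 = 1.
Proof.
rewrite ler_normr => /orP[h|h]; have [[? ->]|[/andP[? ?] ->]|[? ->]] := clip_cases x;
  rewrite ?sqrrN ?expr1n//.
- by rewrite (_ : x = 1) ?expr1n//; lra.
- by rewrite (_ : x = -1) ?sqrrN ?expr1n//; lra.
Qed.

Lemma norm_ker_near0 t x : `|x| <= 1 ->
  `|ker_cos t x| <= t ^+ 2 / 2 /\ `|ker_sin t x| <= t ^+ 2.
Proof.
move=> x1; rewrite /ker_cos /ker_sin clip_id//; have [->|x0] := eqVneq x 0.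
  rewrite expr0n invr0 !mulr0 normr0 add0r mulr1n mulr1 normrN ger0_norm ?sqr_ge0//.
  by rewrite divr_ge0// sqr_ge0.
have x2 : 0 < x ^+ 2 by rewrite exprn_even_gt0.
rewrite mulr0n mulr0 subr0 !normrM normfV (ger0_norm (ltW x2)) !ler_pdivrMr//.
split; first by have := norm_cos_sub1 (t * x); rewrite exprMn mulrA [_ / 2]mulrC.
by have := norm_sin_sub2 (t * x); rewrite exprMn.
Qed.

Lemma norm_ker_far t x : 1 < `|x| ->
  ker_cos t x = cos (t * x) - 1 /\ ker_sin t x = sin (t * x) - t * clip x.
Proof.
move=> x1; have x0 : x != 0 by rewrite -normr_gt0; lra.
by rewrite /ker_cos /ker_sin clip_sqr1 ?(ltW x1)// !divr1 (negbTE x0) mulr0n mulr0 subr0.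
Qed.

Lemma norm_ker_sin_far t x : `|sin (t * x) - t * clip x| <= `|sin (t * x)| + `|t|.
Proof.
by apply: le_trans (ler_normB _ _) _; rewrite lerD2l normrM ler_piMr// norm_clip_le1.
Qed.

Definition ker_bound t : R := 2 + `|t| + t ^+ 2.

Lemma ker_bound_gt0 t : 0 < ker_bound t.
Proof. by have := normr_ge0 t; have := sqr_ge0 t; rewrite /ker_bound; lra. Qed.

Lemma norm_ker_cos t x : `|ker_cos t x| <= ker_bound t.
Proof.
have t0 := normr_ge0 t; have t2 := sqr_ge0 t; rewrite /ker_bound.
have [x1|x1] := leP `|x| 1; first by have [h _] := norm_ker_near0 t x1; lra.
by have [-> _] := norm_ker_far t x1; have := norm_cos_sub1_2 (t * x); lra.
Qed.

Lemma norm_ker_sin t x : `|ker_sin t x| <= ker_bound t.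
Proof.
have t0 := normr_ge0 t; have t2 := sqr_ge0 t; rewrite /ker_bound.
have [x1|x1] := leP `|x| 1; first by have [_ h] := norm_ker_near0 t x1; lra.
have [_ ->] := norm_ker_far t x1; have := norm_ker_sin_far t x.
by have := norm_sin_le1 (t * x); lra.
Qed.

(** Smallness in [t] on bounded sets of [x], needed to show that the drift stays bounded. *)
Lemma norm_ker_le t x (K : R) : 1 <= K -> `|t| <= 1 -> `|x| <= K ->
  `|ker_cos t x| <= 2 * `|t| * K ^+ 2 /\ `|ker_sin t x| <= 2 * `|t| * K ^+ 2.
Proof.
move=> K1 t1 xK; have t0 := normr_ge0 t.
have KK : K <= K ^+ 2 by rewrite expr2 ler_peMr//; lra.
have t2 : t ^+ 2 <= `|t| by rewrite -real_normK ?num_real// expr2 ler_piMl.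
have tK : `|t| * 1 <= `|t| * K by rewrite ler_wpM2l.
have tK2 : `|t| * K <= `|t| * K ^+ 2 by rewrite ler_wpM2l.
rewrite -mulrA; have [x1|x1] := leP `|x| 1.
  by have [h1 h2] := norm_ker_near0 t x1; have := sqr_ge0 t; split; lra.
have [-> ->] := norm_ker_far t x1; split.
  apply: le_trans (norm_cos_sub1 _) _; rewrite exprMn.
  have : t ^+ 2 * x ^+ 2 <= `|t| * K ^+ 2.
    rewrite ler_pM ?sqr_ge0// -[x ^+ 2]real_normK ?num_real// ler_sqr ?nnegrE//; lra.
  have : 0 <= t ^+ 2 * x ^+ 2 by rewrite mulr_ge0 ?sqr_ge0.
  lra.
apply: le_trans (norm_ker_sin_far _ _) _; have := norm_sin_le (t * x).
have : `|t * x| <= `|t| * K by rewrite normrM ler_wpM2l.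
lra.
Qed.

Lemma continuous_off0 (f h : R -> R) (K : R) : (forall x, x != 0 -> f x = h x) ->
  (forall x, x != 0 -> {for x, continuous h}) ->
  (forall x, `|x| <= 1 -> `|f x - f 0| <= K * `|x|) -> continuous f.
Proof.
move=> fh ch fK x; have [->|x0] := eqVneq x 0; last first.
  have ne : \forall y \near x, h y = f y.
    near=> y; rewrite fh//.
    by near: y; apply: open_nbhs_nbhs; split => //; exact: open_neq.
  rewrite /continuous_at fh//; apply: cvg_trans (near_eq_cvg ne) _; exact: ch.
apply/cvgrPdist_le => e e0; near=> y; rewrite distrC.
have y1 : `|y| <= 1.
  by rewrite ltW// -[y]subr0 distrC; near: y; apply/nbhs_ballP; exists 1 => /=.
apply: le_trans (fK _ y1) _; apply: (@le_trans _ _ ((`|K| + 1) * `|y|)).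
  by rewrite ler_wpM2r//; have := ler_norm K; lra.
have K1 : 0 < `|K| + 1 by have := normr_ge0 K; lra.
rewrite mulrC -ler_pdivlMr// ltW// -[y]subr0 distrC.
by near: y; apply/nbhs_ballP; exists (e / (`|K| + 1)) => //=; rewrite divr_gt0.
Unshelve. all: by end_near. Qed.

Lemma continuous_mulr_const t : continuous (fun x : R => t * x).
Proof. by move=> x; apply: cvgM; [exact: cvg_cst|exact: cvg_id]. Qed.

Lemma continuous_clip_sqrV x : x != 0 -> {for x, continuous (fun y : R => (clip y ^+ 2)^-1)}.
Proof.
move=> x0; apply: cvgV; first by rewrite expf_neq0// clip_eq0.
by apply: cvgM; exact: continuous_clip.
Qed.

Lemma continuous_ker_cos t : continuous (ker_cos t).
Proof.
apply: (@continuous_off0 _ (fun x => (cos (t * x) - 1) / clip x ^+ 2) (t ^+ 4)).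
- by move=> x x0; rewrite /ker_cos (negbTE x0) mulr0n mulr0 subr0.
- move=> x x0; apply: cvgM; last exact: continuous_clip_sqrV.
  apply: cvgB; last exact: cvg_cst.
  by apply: continuous_comp; [exact: continuous_mulr_const|exact: continuous_cos].
move=> x x1; have [->|x0] := eqVneq x 0; first by rewrite subrr normr0 mulr0.
rewrite /ker_cos clip0 eqxx (negbTE x0) clip_id// expr0n invr0 !mulr0 add0r mulr1n mulr1.
rewrite subr0 opprK.
have x2 : 0 < x ^+ 2 by rewrite exprn_even_gt0.
have -> : (cos (t * x) - 1) / x ^+ 2 + t ^+ 2 / 2 = (cos (t * x) - 1 + 2^-1 * (t * x) ^+ 2) / x ^+ 2.
  by field.
rewrite normrM normfV (ger0_norm (ltW x2)) ler_pdivrMr//.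
have /andP[h1 h2] := one_sub_cos_bounds (t * x).
rewrite ger0_norm; last by lra.
have h3 : (t * x) ^+ 4 = t ^+ 4 * (x ^+ 2 * x ^+ 2) by ring.
have h4 : x ^+ 2 * x ^+ 2 <= `|x| * x ^+ 2.
  by rewrite ler_wpM2r ?sqr_ge0// -real_normK ?num_real// expr2 ler_piMl.
have h5 : t ^+ 4 * (x ^+ 2 * x ^+ 2) <= t ^+ 4 * (`|x| * x ^+ 2).
  by rewrite ler_wpM2l// exprn_even_ge0.
have h6 : 0 <= t ^+ 4 * (`|x| * x ^+ 2).
  by apply: mulr_ge0; [rewrite exprn_even_ge0|apply: mulr_ge0 => //; exact: sqr_ge0].
by rewrite -mulrA; lra.
Qed.

Lemma continuous_ker_sin t : continuous (ker_sin t).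
Proof.
apply: (@continuous_off0 _ (ker_sin t) (`|t| ^+ 3)) => //.
- move=> x x0; apply: cvgM; last exact: continuous_clip_sqrV.
  apply: cvgB; first by apply: continuous_comp; [exact: continuous_mulr_const|exact: continuous_sin].
  by apply: cvgM; [exact: cvg_cst|exact: continuous_clip].
move=> x x1; have [->|x0] := eqVneq x 0; first by rewrite subrr normr0 mulr0.
rewrite /ker_sin clip0 clip_id// expr0n invr0 !mulr0 subr0.
have x2 : 0 < x ^+ 2 by rewrite exprn_even_gt0.
rewrite normrM normfV (ger0_norm (ltW x2)) ler_pdivrMr//.
apply: le_trans (norm_sin_sub3 _) _; rewrite normrM exprMn.
have -> : `|t| ^+ 3 * `|x| * x ^+ 2 = `|t| ^+ 3 * `|x| ^+ 3.
  by rewrite -[x ^+ 2]real_normK ?num_real//; ring.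
by rewrite ler_piMl ?mulr_ge0 ?exprn_ge0//; lra.
Qed.

Lemma bmeas_ker_cos t : bmeas (ker_cos t).
Proof. by apply: (bmeas_continuous (@continuous_ker_cos t)) => x; exact: norm_ker_cos. Qed.

Lemma bmeas_ker_sin t : bmeas (ker_sin t).
Proof. by apply: (bmeas_continuous (@continuous_ker_sin t)) => x; exact: norm_ker_sin. Qed.

End Kernels.

(** * Measures given by a density *)

Section Density.
Context d (T : measurableType d) (R : realType).
Context (mu : {measure set T -> \bar R}) (rho : T -> R).
Hypothesis mrho : measurable_fun setT rho.
Hypothesis rho0 : forall x, 0 <= rho x.

(* the two unused proofs make the measure instance below inferable *)
Definition with_density & measurable_fun setT rho & (forall x, 0 <= rho x) :
  set T -> \bar R := fun A => (\int[mu]_(x in A) (rho x)%:E)%E.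

Local Notation nu := (with_density mrho rho0).

Let nu0 : nu set0 = 0%E. Proof. by rewrite /with_density integral_set0. Qed.

Let nu_ge0 A : (0 <= nu A)%E.
Proof. by apply: integral_ge0 => x _; rewrite lee_fin. Qed.

Let nu_sigma_additive : semi_sigma_additive nu.
Proof.
move=> /= F mF tF mUF; rewrite /with_density; apply: cvg_toP.
  apply: ereal_nondecreasing_is_cvgn => m n mn.
  apply: lee_sum_nneg_natr => // k _ _.
  by apply: integral_ge0 => /= x _; rewrite lee_fin.
rewrite ge0_integral_bigcup//=.
- by apply: measurable_funTS; exact/measurable_EFinP.
- by move=> x _; rewrite lee_fin.
Qed.

HB.instance Definition _ := isMeasure.Build _ _ _ nu nu0 nu_ge0 nu_sigma_additive.

Definition density_measure : {measure set T -> \bar R} := nu.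

Lemma density_measureE A : density_measure A = (\int[mu]_(x in A) (rho x)%:E)%E.
Proof. by []. Qed.

Let erho : measurable_fun setT (fun x => (rho x)%:E). Proof. exact/measurable_EFinP. Qed.

Import HBNNSimple.

Let integral_density_nnsfun (f : {nnsfun T >-> R}) :
  (\int[density_measure]_x (f x)%:E = \int[mu]_x ((f x)%:E * (rho x)%:E))%E.
Proof.
under [LHS]eq_integral do rewrite fimfunE -fsumEFin//.
rewrite ge0_integral_fsum//; last 2 first.
- by move=> r; exact/measurable_EFinP/measurableT_comp.
- by move=> n x _; rewrite EFinM nnfun_muleindic_ge0.
under [RHS]eq_integral.
  move=> x xD; rewrite fimfunE -fsumEFin// ge0_mule_fsuml; last first.
    by move=> r; rewrite EFinM nnfun_muleindic_ge0.
  over.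
rewrite [RHS]ge0_integral_fsum//; last 2 first.
- by move=> r; apply: emeasurable_funM => //; exact/measurable_EFinP/measurableT_comp.
- by move=> n x _; apply: mule_ge0; [rewrite EFinM nnfun_muleindic_ge0|rewrite lee_fin].
apply: eq_fsbigr => r /[!inE] -[y _ yr].
have r0 : 0 <= r by rewrite -yr.
rewrite integralZl_indic_nnsfun// integral_indic// setIT density_measureE -ge0_integralZl//; last 2 first.
- exact: measurable_funTS.
- by move=> x _; rewrite lee_fin.
rewrite integral_mkcond; apply: eq_integral => x _.
rewrite patchE indicE; case: ifPn => _; first by rewrite mulr1.
by rewrite mulr0 mul0e.
Qed.

Lemma integral_density (f : T -> \bar R) : measurable_fun setT f -> (forall x, 0 <= f x)%E ->
  (\int[density_measure]_x f x = \int[mu]_x (f x * (rho x)%:E))%E.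
Proof.
move=> mf f0; pose f_ := nnsfun_approx measurableT mf.
transitivity (lim (\int[density_measure]_x (f_ n x)%:E @[n --> \oo])%E).
  rewrite -monotone_convergence//=.
  - apply: eq_integral => ? /[!inE] xD; apply/esym/cvg_lim => //=.
    exact: cvg_nnsfun_approx.
  - by move=> n; exact/measurable_EFinP/measurable_funTS.
  - by move=> n ? _; rewrite lee_fin.
  - by move=> ? _ ? ? mn; rewrite lee_fin; exact/lefP/nd_nnsfun_approx.
under eq_fun do rewrite integral_density_nnsfun.
rewrite -monotone_convergence//=.
- apply: eq_integral => x _; apply/cvg_lim => //.
  apply: cvgeZr; first by rewrite ge0_fin_numE ?ltry ?lee_fin.
  exact: cvg_nnsfun_approx.
- by move=> n; apply: emeasurable_funM => //; exact/measurable_EFinP.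
- by move=> n x _; rewrite mule_ge0 ?lee_fin.
- move=> x _ m n mn; rewrite lee_wpmul2r ?lee_fin//.
  exact/lefP/nd_nnsfun_approx.
Qed.

End Density.

Lemma cvg_eq_near (R : realType) (F : set_system nat) {FF : ProperFilter F} (u v : nat -> R) (x y : R) :
  u n @[n --> F] --> x -> v n @[n --> F] --> y ->
  (forall e : R, 0 < e -> \forall n \near F, `|u n - v n| <= e) -> x = y.
Proof.
move=> ux vy uv; apply/eqP; rewrite -subr_eq0 -normr_le0 leNgt; apply/negP => xy.
have e0 : 0 < `|x - y| / 4 by rewrite divr_gt0.
have h1 : \forall n \near F, `|x - u n| < `|x - y| / 4 by exact: cvgr_dist_lt e0.
have h2 : \forall n \near F, `|y - v n| < `|x - y| / 4 by exact: cvgr_dist_lt e0.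
have [n [[h3 h4] h5]] := filter_ex (filterI (filterI h1 h2) (uv _ e0)).
have : `|x - y| <= `|x - u n| + `|u n - v n| + `|y - v n|.
  rewrite (_ : x - y = (x - u n) + (u n - v n) - (y - v n)); last by ring.
  by apply: le_trans (ler_normB _ _) _; rewrite lerD2r ler_normD.
move: h3 h4 h5 => /=; lra.
Qed.

Lemma continuous_cosM (R : realType) (t : R) : continuous (fun x : R => cos (t * x)).
Proof.
by move=> x; apply: continuous_comp; [exact: continuous_mulr_const|exact: continuous_cos].
Qed.

Lemma continuous_sinM (R : realType) (t : R) : continuous (fun x : R => sin (t * x)).
Proof.
by move=> x; apply: continuous_comp; [exact: continuous_mulr_const|exact: continuous_sin].
Qed.

(** * Limits of triangular arrays of nonnegative, uniformly negligible laws *)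

Section Array.
Context {R : realType} (Q : nat -> nat -> probability R R).
Context (Ud : nat -> (R -> R) -> R) (al : nat -> R) (G : R -> R).
Hypothesis Q0 : forall d j, nonneg_law (Q d j).
Hypothesis negl : forall tau e : R, 0 < tau -> 0 < e ->
  \forall d \near \oo, forall j, (j < d)%N -> \int[Q d j]_x (1 - ind tau x) <= e.
Hypothesis GP : distribution_function G.
Hypothesis UdP : forall d, posfun (Ud d).
Hypothesis Ud1 : forall d, Ud d (fun=> 1) = 1.
Hypothesis cvG : cv_law \oo Ud G.
Hypothesis Udchf : forall d t, cfun (Ud d) t = cis (- (t * al d)) * \prod_(j < d) chf (Q d j) t.

Lemma near_center (tau : R) : 0 < tau -> \forall d \near \oo, forall j, (j < d)%N ->
  [/\ \int[Q d j]_x clip (x - clip_center (Q d j)) = 0, clip_center (Q d j) <= tau & cvar (Q d j) <= tau].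
Proof.
(* Then [clip_center <= 2 * s <= tau] and [cvar <= 4 * s ^+ 2 + s / 4 <= tau]. *)
move=> t0; pose s := Num.min 1 (tau / 8).
have s0 : 0 < s by rewrite lt_min ltr01 divr_gt0.
have s1 : s <= 1 by rewrite ge_min lexx.
have st : s <= tau / 8 by rewrite ge_min lexx orbT.
near=> d => j jd.
have h : \int[Q d j]_x (1 - ind s x) <= s / 4.
  by move: j jd; near: d; apply: negl => //; rewrite divr_gt0.
have [|e cs] := centerP (@Q0 d j) s0 s1; first by lra.
have s20 : 0 < 2 * s by lra.
have := cvar_le (@Q0 d j) s20 cs.
have h2 : \int[Q d j]_x (1 - ind (2 * s) x) <= s / 4.
  apply: le_trans h; apply: le_Rint.
  - exact: bmeas_ind_compl.
  - exact: bmeas_ind_compl.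
  move=> x; rewrite !indE; have [xs|xs] := leP x s; last first.
    by rewrite mulr0n lerD2l lerN2 ler0n.
  by rewrite (_ : x <= 2 * s)//; lra.
have : s ^+ 2 <= s by rewrite expr2 ler_piMl// ltW.
by rewrite exprMn => h3 h4; split => //; lra.
Unshelve. all: by end_near. Qed.

(** Tightness makes the characteristic functions of the normed sums equicontinuous at [0]; this is
    the only information on [Ud] that the following bounds use. *)
Lemma near_chf_one (e : R) : 0 < e -> exists delta : R, [/\ 0 < delta, delta <= 1 &
  \forall d \near \oo, forall t, `|t| <= delta ->
    `|Ud d (fun x => cos (t * x)) - 1| <= e /\ `|Ud d (fun x => sin (t * x))| <= e].
Proof.
move=> e0; have e8 : 0 < e / 8 by rewrite divr_gt0.
have [K K0 tightK] := cv_law_tight GP cvG Ud1 e8.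
pose r := Num.min 1 (e / 2); have r0 : 0 < r by rewrite lt_min ltr01 divr_gt0.
have r1 : r <= 1 by rewrite ge_min lexx.
have re : r <= e / 2 by rewrite ge_min lexx orbT.
exists (Num.min 1 (r / K)); split.
- by rewrite lt_min ltr01 divr_gt0.
- by rewrite ge_min lexx.
near=> d => t; rewrite le_min => /andP[_ tK].
have [tN tP] : Ud d (ind (- K)) <= e / 8 /\ Ud d (fun=> 1) - Ud d (ind K) <= e / 8 by near: d.
have b1 : bmeas ((fun=> 1) : R -> R) by exact: bmeas_cst.
pose h x : R := e / 2 * 1 + 2 * (ind (- K) x + (1 - ind K x)).
have bK : bmeas (fun x : R => 1 - ind K x) by apply: bmeasB => //; exact: bmeas_ind.
have bi K' : bmeas (@ind R K') by exact: bmeas_ind.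
have bs : bmeas (fun x : R => ind (- K) x + (1 - ind K x)) by exact: bmeasD.
have bh : bmeas h by apply: bmeasD; exact: bmeasZ.
have Uh : Ud d h <= e.
  rewrite (posfunD (UdP d) (bmeasZ _ b1) (bmeasZ _ bs)) (posfunZ (UdP d) _ b1).
  rewrite (posfunZ (UdP d) _ bs) (posfunD (UdP d) (bi _) bK) (posfunB (UdP d) b1 (bi _)).
  by rewrite Ud1 in tP *; lra.
have hx (x u : R) : `|u| <= 2 -> (`|t * x| <= 1 -> `|u| <= `|t * x|) -> `|u| <= h x.
  move=> u2 u1; rewrite /h !indE.
  have [xK|xK] := leP x (- K).
    rewrite mulr1n; have : (x <= K)%R%:R <= 1 :> R by rewrite lern1 leq_b1.
    lra.
  have [xK'|xK'] := leP x K; last by rewrite mulr0n; lra.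
  have tx : `|t * x| <= r.
    rewrite normrM -(divfK (lt0r_neq0 K0) r) ler_pM// ler_norml; apply/andP; split => //.
    exact: ltW.
  by rewrite mulr0n mulr1n subrr; have := u1 (le_trans tx r1); lra.
split; apply: le_trans _ Uh.
  rewrite -(Ud1 d) -(posfunB (UdP d))//; last exact: bmeas_cosM.
  apply: (norm_posfun (UdP d)) => //; first by apply: bmeasB => //; exact: bmeas_cosM.
  move=> x; apply: hx; first exact: norm_cos_sub1_2.
  move=> tx; apply: le_trans (norm_cos_sub1 _) _.
  rewrite -real_normK ?num_real// expr2 mulrA ler_piMl//.
  by have := normr_ge0 (t * x); lra.
apply: (norm_posfun (UdP d)) => //; first exact: bmeas_sinM.
move=> x; apply: hx; first by have := norm_sin_le1 (t * x); lra.
by move=> _; exact: norm_sin_le.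
Unshelve. all: by end_near. Qed.

Lemma normc_cfun_Ud d t : Normc.normc (cfun (Ud d) t) ^+ 2 =
  \prod_(j < d) (1 - (1 - \int[symlaw (Q d j)]_y cos (t * y))).
Proof.
rewrite Udchf Normc.normcM normc_cis mul1r (big_morph _ (@Normc.normcM R) (@Normc.normc1 R)).
by rewrite -prodrXl; apply: eq_bigr => j _; rewrite symlaw_cos; ring.
Qed.

Lemma near_sum_cos (k : R) : 0 < k -> exists delta : R, [/\ 0 < delta, delta <= 1 &
  \forall d \near \oo, forall t, `|t| <= delta ->
    \sum_(j < d) (1 - \int[symlaw (Q d j)]_y cos (t * y)) <= k].
Proof.
(* Chosen so that [(1 - 2 * e) * (1 + k) = 1]; the squared modulus is at least [1 - 2 * e], so
   [prod_one_sub_le] bounds the sum by [k]. *)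
move=> k0; pose e := k / (2 * (1 + k)).
have k1 : 0 < 1 + k by lra.
have e0 : 0 < e by rewrite divr_gt0// mulr_gt0.
have [delta [d0 d1 near_one]] := near_chf_one e0.
exists delta; split => //; near=> d => t td.
have [h _] : `|Ud d (fun x => cos (t * x)) - 1| <= e /\ `|Ud d (fun x => sin (t * x))| <= e.
  by move: t td; near: d.
pose x j := 1 - \int[symlaw (Q d j)]_y cos (t * y).
have x01 j : (j < d)%N -> 0 <= x j <= 1.
  move=> _; rewrite /x symlaw_cos subr_ge0 lerBlDr lerDl sqr_ge0 andbT.
  rewrite expr_le1// ?normc_ge0//; apply: cfun_norm; first exact: Rint_posfun.
  exact: probability_Rint_cst.
have [h1 [_ h3]] := prod_one_sub_le x01.
rewrite -[X in X * _ <= _]normc_cfun_Ud in h1.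
rewrite -/(\sum_(j < d) x j); move: (\sum_(j < d) x j) h1 h3 => S h1 h3.
pose C := Ud d (fun x => cos (t * x)); rewrite -/C in h.
have N1 : 1 - 2 * e <= Normc.normc (cfun (Ud d) t) ^+ 2.
  rewrite /= sqr_sqrtr ?addr_ge0 ?sqr_ge0//; apply: (@le_trans _ _ (C ^+ 2)); last by rewrite lerDl sqr_ge0.
  move: h; rewrite ler_norml => /andP[h _]; have := sqr_ge0 (C - 1); rewrite sqrrB expr1n mulr1 -mulr_natl; lra.
have e2 : (1 - 2 * e) * (1 + k) = 1 by rewrite /e; field; rewrite ?andbT gt_eqF.
have N2 : (1 - 2 * e) * (1 + S) <= 1 by apply: le_trans h1; rewrite ler_wpM2r//; lra.
have p0 : 0 < 1 - 2 * e by rewrite -(pmulr_lgt0 _ k1) e2.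
have : (1 - 2 * e) * (1 + S) <= (1 - 2 * e) * (1 + k) by rewrite e2.
by rewrite ler_pM2l//; lra.
Unshelve. all: by end_near. Qed.

Lemma near_sum_gap (k : R) : 0 < k -> exists delta : R, [/\ 0 < delta, delta <= 1 &
  \forall d \near \oo,
    \sum_(j < d) \int[symlaw (Q d j)]_y sincgap (delta * y) <= k].
Proof.
move=> k0; have [delta [d0 d1 near_cos]] := near_sum_cos k0.
exists delta; split => //; near=> d.
under eq_bigr do rewrite Rint_sincgap.
have be (mu : probability R R) (u : R) : 1 - \int[mu]_y cos (delta * u * y) =
    \int[mu]_y (1 - cos (delta * u * y)).
  by rewrite RintB ?probability_Rint_cst//; [exact: bmeas_cst|exact: bmeas_cosM].
have bf j : bmeas (fun u : R => 1 - \int[symlaw (Q d j)]_y cos (delta * u * y)).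
  under eq_fun do rewrite be.
  exact: (@bmeas_marginal _ _ _ _ _ uniform01 (symlaw (Q d j)) _ (bmeas_one_sub_cos_pair delta)).
rewrite -(Rint_sum uniform01 d bf); apply: uniform01_le.
- exact: bmeas_sum.
- move=> u; apply: sumr_ge0 => j _; rewrite be -(probability_Rint_cst (symlaw (Q d j)) 0).
  apply: le_Rint; [exact: bmeas_cst|exact: bmeas_one_sub_cosM|].
  by move=> y; exact: one_sub_cos_ge0.
(* The bound on the sum holds at every [t = delta * u], hence for its average over [u] in the unit
   interval. *)
move=> u /andP[u0 u1]; have : `|delta * u| <= delta.
  by rewrite ger0_norm ?mulr_ge0 ?(ltW d0)// ler_piMr// ltW.
by move: (delta * u); near: d.
Unshelve. all: by end_near. Qed.

Lemma near_sum_cvar : exists2 C : R, 0 < C & \forall d \near \oo, \sum_(j < d) cvar (Q d j) <= C.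
Proof.
have [delta [d0 d1 near_gap]] := near_sum_gap ltr01.
have dn0 : delta != 0 by rewrite gt_eqF.
(* A factor [2] from [symlaw_clip], [8] from [sincgap_ge_min], and [delta ^+ 2] from
   [clip_sqr_scale]. *)
exists (16 / delta ^+ 2); first by rewrite divr_gt0// exprn_gt0.
near=> d; apply: (@le_trans _ _ (\sum_(j < d)
    16 / delta ^+ 2 * \int[symlaw (Q d j)]_y sincgap (delta * y))); last first.
  rewrite -mulr_sumr ler_piMr//; first by rewrite divr_ge0// exprn_ge0// ltW.
  by near: d.
apply: ler_sum => j _.
have [e _ _] : [/\ \int[Q d j]_x clip (x - clip_center (Q d j)) = 0, clip_center (Q d j) <= 1 & cvar (Q d j) <= 1].
  by move: (ltn_ord j); move: (nat_of_ord j) => i; move: i; near: d; exact: near_center.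
apply: le_trans (symlaw_clip e) _; have bs := bmeas_sincgapM delta.
rewrite -!RintZ//; last exact: bmeas_clip_sqr.
apply: le_Rint; [exact/bmeasZ/bmeas_clip_sqr|exact: bmeasZ|].
move=> y; have h1 := clip_sqr_scale y d0 d1; have h2 := sincgap_ge_min (delta * y).
rewrite -clip_sqr in h2; rewrite mulrAC ler_pdivlMr ?exprn_gt0//.
have : 2 * clip y ^+ 2 * delta ^+ 2 = 2 * (delta ^+ 2 * clip y ^+ 2) by ring.
lra.
Unshelve. all: by end_near. Qed.

(** Summing [symlaw_tail] with [K = 3 / delta]; negligibility supplies the half of the mass below
    [delta^-1]. *)
Lemma near_sum_tail (e : R) : 0 < e -> exists2 K : R, 1 < K & \forall d \near \oo,
  \sum_(j < d) \int[Q d j]_x (1 - ind K (x - clip_center (Q d j))) <= e.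
Proof.
move=> e0; have e4 : 0 < e / 4 by rewrite divr_gt0.
have [delta [d0 d1 near_gap]] := near_sum_gap e4.
exists (3 / delta); first by rewrite ltr_pdivlMr//; lra.
have dV : 0 < delta^-1 by rewrite invr_gt0.
have h2 : (0 : R) < 2^-1 by [].
near=> d; apply: (@le_trans _ _ (\sum_(j < d)
    4 * \int[symlaw (Q d j)]_y sincgap (delta * y))); last first.
  rewrite -mulr_sumr mulrC -ler_pdivlMr//; by near: d.
apply: ler_sum => j _; apply: symlaw_tail => //; first exact: center_ge0.
have : \int[Q d j]_x (1 - ind delta^-1 x) <= 2^-1.
  move: (ltn_ord j); move: (nat_of_ord j) => i; move: i; near: d; exact: negl.
rewrite RintB ?probability_Rint_cst//; [lra|exact: bmeas_cst|exact: bmeas_ind].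
Unshelve. all: by end_near. Qed.

Local Notation c d j := (clip_center (Q d j)).

Definition clip_part (mu : probability R R) (f : R -> R) : R :=
  \int[mu]_x (clip (x - (clip_center mu : R)) ^+ 2 * f (x - clip_center mu)).

Lemma bmeas_clip_part (mu : probability R R) (f : R -> R) : bmeas f ->
  bmeas (fun x : R => clip (x - clip_center mu) ^+ 2 * f (x - clip_center mu)).
Proof. by move=> bf; exact: (bmeas_sub_cst (clip_center mu) (bmeasM bmeas_clip_sqr bf)). Qed.

Lemma clip_part_posfun mu : posfun (clip_part mu).
Proof.
split; rewrite /clip_part.
- move=> f g bf bg; rewrite -RintD; try exact: bmeas_clip_part.
  by congr (Rintegral _ _ _); apply/funext => x; rewrite mulrDr.
- move=> k f bf; rewrite -RintZ; last exact: bmeas_clip_part.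
  by congr (Rintegral _ _ _); apply/funext => x; rewrite mulrCA.
- move=> f g bf bg fg; apply: le_Rint; try exact: bmeas_clip_part.
  by move=> x; rewrite ler_wpM2l ?sqr_ge0.
Qed.

Lemma clip_part1 mu : clip_part mu (fun=> 1) = cvar mu.
Proof. by congr (Rintegral _ _ _); apply/funext => x; rewrite mulr1. Qed.

(** Khinchin's canonical measure of the array as a functional, with weight [clip x ^+ 2] in place of
    [x^2 / (1 + x^2)]. *)
Definition spread d (f : R -> R) : R := \sum_(j < d) clip_part (Q d j) f.

Lemma spread_posfun d : posfun (spread d).
Proof.
split; rewrite /spread.
- move=> f g bf bg; rewrite -big_split; apply: eq_bigr => j _.
  exact: (posfunD (clip_part_posfun _)).
- by move=> k f bf; rewrite mulr_sumr; apply: eq_bigr => j _; exact: (posfunZ (clip_part_posfun _)).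
- by move=> f g bf bg fg; apply: ler_sum => j _; exact: (le_posfun (clip_part_posfun _)).
Qed.

Lemma near_spread1 : exists2 C : R, 0 < C & \forall d \near \oo, spread d (fun=> 1) <= C.
Proof.
have [C C0 nC] := near_sum_cvar.
exists C => //; near=> d; rewrite /spread; under eq_bigr do rewrite clip_part1.
by near: d.
Unshelve. all: by end_near. Qed.

Lemma near_spread_neg (x : R) : x < 0 -> \forall d \near \oo, spread d (ind x) <= 0.
Proof.
move=> x0; have x2 : 0 < - x / 2 by lra.
near=> d; apply: sumr_le0 => j _.
have [_ cx _] : [/\ \int[Q d j]_x clip (x - c d j) = 0, c d j <= - x / 2 & cvar (Q d j) <= - x / 2].
  by move: (ltn_ord j); move: (nat_of_ord j) => i; move: i; near: d; exact: near_center.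
rewrite -(probability_Rint_cst (Q d j) 0); apply: Q0.
- by apply: bmeas_clip_part; exact: bmeas_ind.
- exact: bmeas_cst.
move=> u u0; rewrite indE (_ : (_ <= x)%R = false) ?mulr0n ?mulr0//.
by apply/negP; lra.
Unshelve. all: by end_near. Qed.

Lemma near_spread_tail (e : R) : 0 < e -> exists2 K : R, 1 < K & \forall d \near \oo,
  spread d (fun=> 1) - spread d (ind K) <= e.
Proof.
move=> e0; have [K K1 tailK] := near_sum_tail e0.
exists K => //; near=> d; rewrite -(posfunB (spread_posfun d)); [|exact: bmeas_cst|exact: bmeas_ind].
apply: (@le_trans _ _ (\sum_(j < d) \int[Q d j]_x (1 - ind K (x - c d j)))); last by near: d.
have b1 := bmeas_ind_compl K.
apply: ler_sum => j _; apply: le_Rint; first exact: (bmeas_clip_part (Q d j) b1).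
  exact: (bmeas_sub_cst (c d j) b1).
by move=> x; rewrite ler_piMl ?clip_sqr_le1// subr_ge0 ind_le1.
Unshelve. all: by end_near. Qed.

Lemma near_spread_tight (e : R) : 0 < e -> exists2 K : R, 0 < K & \forall d \near \oo,
  spread d (ind (- K)) <= e /\ spread d (fun=> 1) - spread d (ind K) <= e.
Proof.
move=> e0; have [K K1 tailK] := near_spread_tail e0; have K0 : 0 < K by lra.
have nK : - K < 0 by lra.
exists K => //; near=> d; split; last by near: d.
by apply: le_trans (ltW e0); near: d; exact: near_spread_neg.
Unshelve. all: by end_near. Qed.

Definition spread_log d t : R[i] := (spread d (ker_cos t) +i* spread d (ker_sin t))%C.

Definition drift d : R := \sum_(j < d) c d j - al d.

Lemma chf_center d t : cfun (Ud d) t = cis (t * drift d) *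
  \prod_(j < d) cfun (affine_law (Q d j) (c d j) 1) t.
Proof.
rewrite Udchf /drift mulrBr addrC cisD mulr_sumr -mulrA; congr (_ * _).
rewrite (cis_sum _ (fun j => t * c d j)) -big_split /=; apply: eq_bigr => j _.
by rewrite cfun_affine !divr1 mulrA -cisD subrr cis0 mul1r.
Qed.

(** An identity without remainder: the term [- i t clip x] hidden in the kernels integrates to zero
    by the choice of the centre. *)
Lemma cfun_center d j t : \int[Q d j]_x clip (x - c d j) = 0 ->
  cfun (affine_law (Q d j) (c d j) 1) t =
  1 + (clip_part (Q d j) (ker_cos t) +i* clip_part (Q d j) (ker_sin t))%C.
Proof.
move=> e0; rewrite /cfun /affine_law /clip_part.
have bc := bmeas_sub_cst (c d j) (bmeas_cosM t); have bs := bmeas_sub_cst (c d j) (bmeas_sinM t).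
have bt := bmeas_sub_cst (c d j) (@bmeas_clip R).
under eq_Rintegral do rewrite divr1.
under [X in (_ +i* X)%C = _]eq_Rintegral do rewrite divr1.
under [X in _ = _ + (X +i* _)%C]eq_Rintegral do rewrite clip_ker_cos.
under [X in _ = _ + (_ +i* X)%C]eq_Rintegral do rewrite clip_ker_sin.
rewrite (RintB _ bc (bmeas_cst _ 1)) (RintB _ bs (bmeasZ t bt)) RintZ// e0 mulr0 subr0.
rewrite probability_Rint_cst; apply/eqP; rewrite eq_complex /=.
by rewrite add0r eqxx andbT; apply/eqP; ring.
Qed.

Lemma complex_sum n (x y : nat -> R) :
  \sum_(j < n) (x j +i* y j)%C = ((\sum_(j < n) x j) +i* (\sum_(j < n) y j))%C.
Proof. by elim: n => [|n IH]; rewrite ?big_ord0// !big_ord_recr /= IH. Qed.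

Lemma norm_clip_part_ker mu t :
  `|clip_part mu (ker_cos t)| <= ker_bound t * cvar mu /\
  `|clip_part mu (ker_sin t)| <= ker_bound t * cvar mu.
Proof.
rewrite -clip_part1; split; apply: (norm_posfun_cst (clip_part_posfun mu)).
- exact: bmeas_ker_cos.
- exact: norm_ker_cos.
- exact: bmeas_ker_sin.
- exact: norm_ker_sin.
Qed.

Lemma clip_part_ker_cos_le0 mu t : clip_part mu (ker_cos t) <= 0.
Proof.
rewrite -(probability_Rint_cst mu 0); apply: le_Rint; last 2 first.
- exact: bmeas_cst.
- by move=> x; rewrite clip_ker_cos subr_le0 cos_le1.
by apply: bmeas_clip_part; exact: bmeas_ker_cos.
Qed.

Lemma affine_norm_le1 mu (x : R) t : Normc.normc (cfun (affine_law mu x 1) t) <= 1.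
Proof. by apply: cfun_norm; [exact: affine_posfun|exact: affine1]. Qed.

(** Passage to the accompanying laws: each factor [1 + psi j] is replaced by [cexp (psi j)]. The
    errors are quadratic in [cvar], so their sum is bounded by the largest [cvar], which vanishes,
    times the bounded sum of all. *)
Lemma near_spread_log t (e : R) : 0 < e -> \forall d \near \oo,
  Normc.normc (cfun (Ud d) t - cis (t * drift d) * cexp (spread_log d t)) <= e.
Proof.
move=> e0; have [C C0 nC] := near_spread1; have B0 := ker_bound_gt0 t.
(* One factor costs at most [2 * (2 * B * cvar)^2 = 8 * B^2 * cvar^2]; with [cvar <= tau] and sum at
   most [C] the total is [e]. *)
set B := ker_bound t in B0; pose tau := e / (8 * B ^+ 2 * C).
have BC0 : 0 < 8 * B ^+ 2 * C by rewrite !mulr_gt0// exprn_gt0.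
have tau0 : 0 < tau by rewrite divr_gt0.
near=> d; rewrite chf_center -mulrBr Normc.normcM normc_cis mul1r.
have nc j : (j < d)%N -> [/\ \int[Q d j]_x clip (x - c d j) = 0, c d j <= tau & cvar (Q d j) <= tau].
  by move: j; near: d; exact: near_center.
pose psi j := (clip_part (Q d j) (ker_cos t) +i* clip_part (Q d j) (ker_sin t))%C.
have -> : spread_log d t = \sum_(j < d) psi j.
  exact/esym/(complex_sum d (fun j => clip_part (Q d j) _) (fun j => clip_part (Q d j) _)).
rewrite cexp_sum; have [] := @norm_prod_sub R d
  (fun j => cfun (affine_law (Q d j) (c d j) 1) t) (fun j => cexp (psi j)).
- by move=> j _; exact: affine_norm_le1.
- by move=> j _; rewrite normc_cexp -expR0 ler_expR /= clip_part_ker_cos_le0.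
move=> h _; apply: le_trans h _.
apply: (@le_trans _ _ (\sum_(j < d) 8 * B ^+ 2 * tau * cvar (Q d j))); last first.
  rewrite -mulr_sumr; apply: (@le_trans _ _ (8 * B ^+ 2 * tau * C)).
    rewrite ler_wpM2l//; last by under eq_bigr do rewrite -clip_part1; near: d.
    by rewrite ltW// mulr_gt0// mulr_gt0// exprn_gt0.
  by rewrite mulrAC /tau mulrC divfK// gt_eqF.
apply: ler_sum => j _; have [e1 _ vt] := nc j (ltn_ord j).
rewrite cfun_center//; apply: le_trans (norm_cexp_sub _) _ => /=; first exact: clip_part_ker_cos_le0.
have [h1 h2] := norm_clip_part_ker (Q d j) t.
have v0 : 0 <= cvar (Q d j).
  rewrite -(probability_Rint_cst (Q d j) 0); apply: le_Rint; first exact: bmeas_cst.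
    exact: (bmeas_sub_cst _ bmeas_clip_sqr).
  by move=> x; exact: sqr_ge0.
set X := `|_| in h1 *; set Y := `|_| in h2 *.
apply: (@le_trans _ _ (2 * (2 * (B * cvar (Q d j))) ^+ 2)).
  rewrite ler_wpM2l// ler_sqr ?nnegrE; [rewrite /B; lra|by rewrite /X /Y addr_ge0|].
  by rewrite mulr_ge0// mulr_ge0// ltW.
have -> : 2 * (2 * (B * cvar (Q d j))) ^+ 2 = 8 * B ^+ 2 * cvar (Q d j) * cvar (Q d j) by ring.
by rewrite ler_wpM2r// ler_wpM2l// mulr_ge0// sqr_ge0.
Unshelve. all: by end_near. Qed.

Lemma norm_nonneg_Rint d j (f g : R -> R) : bmeas f -> bmeas g ->
  (forall u, 0 <= u -> `|f u| <= g u) -> `|\int[Q d j]_x f x| <= \int[Q d j]_x g x.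
Proof.
move=> bf bg fg; rewrite ler_norml -mulN1r -RintZ//; apply/andP; split; apply: Q0 => //.
- exact: bmeasZ.
- by move=> u u0; rewrite mulN1r; have := fg u u0; rewrite ler_norml => /andP[].
- by move=> u u0; have := fg u u0; rewrite ler_norml => /andP[].
Qed.

Lemma norm_clip_part_small d j t (K : R) : 1 <= K -> `|t| <= 1 -> c d j <= 1 ->
  `|clip_part (Q d j) (ker_cos t)| + `|clip_part (Q d j) (ker_sin t)| <=
  4 * `|t| * K ^+ 2 * cvar (Q d j) + 8 * \int[Q d j]_x (1 - ind K (x - c d j)).
Proof.
move=> K1 t1 c1; have b2 := bmeas_sub_cst (c d j) (@bmeas_clip_sqr R).
have b1 : bmeas (fun x : R => 1 - ind K (x - c d j)).
  exact: (bmeas_sub_cst _ (bmeas_ind_compl K)).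
have t0 := normr_ge0 t; have t2 : t ^+ 2 <= 1 by rewrite -real_normK ?num_real// expr_le1.
pose g x : R := 2 * `|t| * K ^+ 2 * clip (x - c d j) ^+ 2 + 4 * (1 - ind K (x - c d j)).
have bg : bmeas g by apply: bmeasD; exact: bmeasZ.
have -> : 4 * `|t| * K ^+ 2 * cvar (Q d j) + 8 * \int[Q d j]_x (1 - ind K (x - c d j)) =
    \int[Q d j]_x g x + \int[Q d j]_x g x.
  rewrite (RintD (Q d j) (bmeasZ _ b2) (bmeasZ _ b1)) (RintZ (Q d j) _ b2) (RintZ (Q d j) _ b1).
  by rewrite -/(cvar (Q d j)); ring.
have key (k : R -> R) : (forall x, `|k x| <= ker_bound t) ->
    (forall x, `|x| <= K -> `|k x| <= 2 * `|t| * K ^+ 2) ->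
    forall u, 0 <= u -> `|clip (u - c d j) ^+ 2 * k (u - c d j)| <= g u.
  move=> kB kK u u0; rewrite normrM (ger0_norm (sqr_ge0 _)) mulrC /g indE.
  (* Only the upper side needs a case distinction: [u - c d j >= -1 >= - K], since [u >= 0] and the
     centre is at most one. *)
  have [uK|uK] := leP (u - c d j) K.
    rewrite mulr1n subrr mulr0 addr0 ler_wpM2r ?sqr_ge0// kK//.
    by rewrite ler_norml uK andbT; lra.
  rewrite mulr0n subr0 mulr1; apply: (@le_trans _ _ 4).
    apply: (@le_trans _ _ (ker_bound t * 1)); last by rewrite /ker_bound; lra.
    by rewrite ler_pM ?sqr_ge0 ?clip_sqr_le1.
  by rewrite lerDr; apply: mulr_ge0; [apply: mulr_ge0; [rewrite mulr_ge0|exact: sqr_ge0]|exact: sqr_ge0].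
apply: lerD; apply: norm_nonneg_Rint => //.
- by apply: bmeas_clip_part; exact: bmeas_ker_cos.
- by apply: key; [exact: norm_ker_cos|move=> x xK; have [] := norm_ker_le K1 t1 xK].
- by apply: bmeas_clip_part; exact: bmeas_ker_sin.
- by apply: key; [exact: norm_ker_sin|move=> x xK; have [] := norm_ker_le K1 t1 xK].
Qed.

(** If the drift were large, [t = pi / drift d] would be small while [cis (t * drift d) = -1]. At
    such [t] both the characteristic function of the normed sum and the centred product are within
    [1 / 2] of one, which puts [cis (t * drift d)] at distance at most one from [1], not two. *)
Lemma near_norm_drift : exists K : R, \forall d \near \oo, `|drift d| <= K.
Proof.
have [C C0 nC] := near_spread1.
have e1 : (0 : R) < 16^-1 by []. have e2 : (0 : R) < 8^-1 by [].
have [d1 [d10 d11 nd1]] := near_chf_one e2.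
have [K K1 nK] := near_sum_tail (divr_gt0 e1 (ltr0n _ 4)).
have KC0 : 0 < 32 * K ^+ 2 * C by rewrite !mulr_gt0//; lra.
(* For [|t| <= d0] the variance part [4 * |t| * K^2 * C] is at most [1 / 8]; the tail part is at
   most [8 / 64]. *)
pose d0 := Num.min d1 (32 * K ^+ 2 * C)^-1.
have d00 : 0 < d0 by rewrite lt_min d10 invr_gt0.
have d01 : d0 <= 1 by rewrite ge_min d11.
exists (pi / d0); near=> d; rewrite leNgt; apply/negP => lt.
have pi0 := @pi_gt0 R.
have dn0 : 0 < `|drift d| by apply: lt_trans lt; rewrite divr_gt0.
pose t := pi / drift d.
have td : `|t| <= d0.
  by rewrite normrM normfV (ger0_norm (ltW pi0)) ler_pdivrMr// mulrC -ler_pdivrMr// ltW.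
have : Normc.normc (cis (t * drift d) - 1) = 2.
  rewrite /t divfK -?normr_gt0// /cis cospi sinpi /= subr0 expr0n addr0 sqrtr_sqr.
  by rewrite -opprD normrN ger0_norm//; ring.
suff : Normc.normc (cis (t * drift d) - 1) <= 1 by lra.
pose Pi : R[i] := \prod_(j < d) cfun (affine_law (Q d j) (c d j) 1) t.
have -> : cis (t * drift d) - 1 = cis (t * drift d) * (1 - Pi) + (cfun (Ud d) t - 1).
  by rewrite chf_center -/Pi; ring.
apply: le_trans (le_normcD _ _) _; rewrite Normc.normcM normc_cis mul1r.
have h1 : Normc.normc (cfun (Ud d) t - 1) <= 2^-1.
  apply: le_trans (normc_le_add _) _ => /=; rewrite subr0.
  have [] : `|Ud d (fun x => cos (t * x)) - 1| <= 8^-1 /\ `|Ud d (fun x => sin (t * x))| <= 8^-1.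
    have td1 : `|t| <= d1 by apply: le_trans td _; rewrite ge_min lexx.
    by move: t td1 {td Pi}; near: d.
  lra.
suff h2 : Normc.normc (1 - Pi) <= 2^-1 by lra.
have [] := @norm_prod_sub R d (fun=> 1) (fun j => cfun (affine_law (Q d j) (c d j) 1) t).
- by move=> j _; rewrite Normc.normc1.
- by move=> j _; exact: affine_norm_le1.
rewrite prodr_const expr1n => h _; apply: le_trans h _.
apply: (@le_trans _ _ (\sum_(j < d) (4 * `|t| * K ^+ 2 * cvar (Q d j) +
    8 * \int[Q d j]_x (1 - ind K (x - c d j))))).
  apply: ler_sum => j _.
  have [e0 c1 _] : [/\ \int[Q d j]_x clip (x - c d j) = 0, c d j <= 1 & cvar (Q d j) <= 1].
    by move: (ltn_ord j); move: (nat_of_ord j) => i; move: i; near: d; exact: near_center.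
  rewrite cfun_center// opprD addrA subrr add0r normcN; apply: le_trans (normc_le_add _) _ => /=.
  by apply: norm_clip_part_small => //; [exact: ltW|exact: le_trans td d01].
rewrite big_split /= -!mulr_sumr.
have h3 : \sum_(j < d) \int[Q d j]_x (1 - ind K (x - c d j)) <= 16^-1 / 4 by near: d.
have h4 : \sum_(j < d) cvar (Q d j) <= C.
  by under eq_bigr do rewrite -clip_part1; near: d.
have : 4 * `|t| * K ^+ 2 * \sum_(j < d) cvar (Q d j) <= 8^-1.
  apply: (@le_trans _ _ (4 * `|t| * K ^+ 2 * C)).
    by rewrite ler_wpM2l//; apply: mulr_ge0; [exact: mulr_ge0|exact: sqr_ge0].
  have : `|t| * (32 * K ^+ 2 * C) <= 1.
    rewrite -ler_pdivlMr// mul1r; apply: le_trans td _.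
    by rewrite ge_min lexx orbT.
  by rewrite (_ : `|t| * _ = 8 * (4 * `|t| * K ^+ 2 * C)); [lra|ring].
lra.
Unshelve. all: by end_near. Qed.

(** The limit of [spread] is represented as [m * M]. If [m = 0] then [M] carries no information, so
    the negative half-line is excluded for the product only. *)
Lemma limit_representation : exists (mu : probability R R) (kappa m : R) (M : probability R R),
  [/\ is_law mu G, 0 <= m, (forall x : R, x < 0 -> m * fine (M `]-oo, x]) = 0) &
    forall t, let A := m * \int[M]_x ker_cos t x in
      let B := t * kappa + m * \int[M]_x ker_sin t x in
      \int[mu]_x cos (t * x) = expR A * cos B /\ \int[mu]_x sin (t * x) = expR A * sin B].
Proof.
have [mu muG] := law_exists GP.
have [U [UU sub]] := @ultraFilterLemma nat \oo _.
have UP : ProperFilter U by exact: ultra_proper.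
have [C C0 nC] := near_spread1.
have nCU : \forall d \near U, spread d (fun=> 1) <= C by exact: sub.
have sP := spread_posfun.
have LP : posfun (ulim U spread) by exact: (ulim_posfun sP nCU).
have LT : tight (ulim U spread).
  apply: (ulim_tight sP nCU) => e e0.
  have [K K0 nK] := near_spread_tight e0.
  by exists K => //; exact: sub.
have [M [MR Mle]] := posfun_representation LP LT.
have [Kd nKd] := near_norm_drift.
have cvd : cvg (drift d @[d --> U]).
  by apply: ultra_bounded_cvg; exact: sub nKd.
have b1 : bmeas ((fun=> 1) : R -> R) by exact: bmeas_cst.
set m := ulim U spread (fun=> 1) in MR Mle.
have m0 : 0 <= m.
  by apply: (posfun_ge0 LP).
exists mu, (lim (drift d @[d --> U])), m, M; split => //.
  move=> x x0; apply/eqP; rewrite eq_le; apply/andP; split; last first.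
    by rewrite mulr_ge0// fine_ge0.
  (* The representation bounds [M] on a half-line by the functional on a strictly larger one;
     [x / 2] is larger and still negative. *)
  have x2 : x < x / 2 by lra.
  apply: le_trans (Mle _ _ x2) _; apply: (ulim_le sP nCU); first exact: bmeas_ind.
  by apply: sub; apply: near_spread_neg; lra.
move=> t A B.
have Ud1U : \forall d \near U, Ud d (fun=> 1) <= 1 by near=> d; rewrite Ud1.
have cvU (h : R -> R) : bmeas h -> continuous h -> Ud d h @[d --> U] --> \int[mu]_x h x.
  move=> bh ch; rewrite -(cv_law_ulim GP (cv_law_sub sub cvG) UdP Ud1 muG bh ch).
  exact: (cvg_ulim UdP Ud1U bh).
have cvS (h : R -> R) : bmeas h -> continuous h -> spread d h @[d --> U] --> m * \int[M]_x h x.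
  by move=> bh ch; rewrite -MR//; exact: (cvg_ulim sP nCU bh).
have cA := cvS _ (bmeas_ker_cos t) (@continuous_ker_cos R t).
have cS := cvS _ (bmeas_ker_sin t) (@continuous_ker_sin R t).
pose Ad d := expR (spread d (ker_cos t)).
pose Bd d := t * drift d + spread d (ker_sin t).
have cAd : Ad d @[d --> U] --> expR A.
  by apply: (@cvg_comp _ _ _ _ expR _ _ _ cA); exact: continuous_expR.
have cBd : Bd d @[d --> U] --> B by apply: cvgD cS; apply: cvgM => //; exact: cvg_cst.
have near_log (e : R) : 0 < e -> \forall d \near U,
    `|Ud d (fun x => cos (t * x)) - Ad d * cos (Bd d)| <= e /\
    `|Ud d (fun x => sin (t * x)) - Ad d * sin (Bd d)| <= e.
  move=> e0; have := near_spread_log t e0.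
  move=> /sub; apply: filterS => d h.
  have E : cis (t * drift d) * cexp (spread_log d t) =
      ((Ad d * cos (Bd d)) +i* (Ad d * sin (Bd d)))%C.
    rewrite /cexp mulrCA -cisD /= /cis; apply/eqP; rewrite eq_complex /=.
    by rewrite !mul0r subr0 addr0 !eqxx.
  rewrite E in h; have [h1 h2] := normc_ReIm (cfun (Ud d) t - ((Ad d * cos (Bd d)) +i* (Ad d * sin (Bd d)))%C).
  by split; [apply: le_trans h1 h|apply: le_trans h2 h].
split.
- apply: (@cvg_eq_near _ U) => [||e e0].
  + exact: (cvU _ (bmeas_cosM t) (@continuous_cosM R t)).
  + by apply: cvgM cAd _; apply: (@cvg_comp _ _ _ _ cos _ _ _ cBd); exact: continuous_cos.
  + by apply: filterS (near_log e e0) => d [].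
- apply: (@cvg_eq_near _ U) => [||e e0].
  + exact: (cvU _ (bmeas_sinM t) (@continuous_sinM R t)).
  + by apply: cvgM cAd _; apply: (@cvg_comp _ _ _ _ sin _ _ _ cBd); exact: continuous_sin.
  + by apply: filterS (near_log e e0) => d [].
Unshelve. all: by end_near. Qed.

End Array.

(** * The Levy measure *)

Lemma measurable_fun_off0 (R : realType) (h : R -> R) :
  (forall x, x != 0 -> {for x, continuous h}) -> measurable_fun setT h.
Proof.
move=> ch; rewrite -(setUv [set (0 : R)]); apply/measurable_funU => //.
  exact: measurableC.
split; first exact: measurable_fun_set1.
apply: open_continuous_measurable_fun.
  rewrite (_ : [set~ 0] = [set x : R | x != 0]); first exact: open_neq.
  by apply/seteqP; split => x /= /eqP.
by move=> x /[!inE] /= /eqP; exact: ch.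
Qed.

Section LevyMeasure.
Context {R : realType} (M : probability R R) (m : R).
Hypothesis m0 : 0 <= m.

(* x / 0 = 0, so that this vanishes at 0 *)
Definition clip_weight (x : R) : R := m / clip x ^+ 2.

Lemma measurable_clip_weight : measurable_fun setT clip_weight.
Proof.
apply: measurable_fun_off0 => x x0.
by apply: cvgM; [exact: cvg_cst|exact: continuous_clip_sqrV].
Qed.

Lemma clip_weight_ge0 x : 0 <= clip_weight x.
Proof. by rewrite divr_ge0// sqr_ge0. Qed.

Lemma clip_weight0 : clip_weight 0 = 0.
Proof. by rewrite /clip_weight clip0 expr0n invr0 mulr0. Qed.

Lemma clip_weightE x : clip x ^+ 2 * clip_weight x = m * (x != 0)%:R.
Proof.
rewrite /clip_weight; have [->|x0] := eqVneq x 0.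
  by rewrite clip0 expr0n mul0r mulr0n mulr0.
by rewrite mulrC mulfVK ?mulr1n ?mulr1// expf_neq0// clip_eq0.
Qed.

Definition unclipped_measure := density_measure M measurable_clip_weight clip_weight_ge0.

Local Notation nu := unclipped_measure.

Lemma bmeas_neq0 : bmeas (fun x : R => (x != 0)%:R : R).
Proof.
have : bmeas (fun x : R => 1 - \1_[set (0:R)] x : R).
  by apply: bmeasB; [exact: bmeas_cst|exact: bmeas_indic].
congr bmeas; apply/funext => x; rewrite indicE.
rewrite (_ : (x \in [set 0]) = (x == 0)); last by apply/idP/idP => [/[!inE] /= ->//|/eqP ->]; rewrite inE.
by case: eqP; rewrite ?mulr1n ?mulr0n ?subrr ?subr0.
Qed.

(** Integrals against the possibly infinite measure [nu] become integrals of bounded functions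
    against [M]. The indicator removes the atom of [M] at [0], which belongs to the Gaussian
    part. *)
Lemma Rint_unclipped (f h : R -> R) : measurable_fun setT f -> bmeas h ->
  (forall x, f x = clip x ^+ 2 * h x) ->
  Rintegral nu [set~ 0] f = m * \int[M]_x (h x * (x != 0)%:R).
Proof.
move=> mf bh fh; have bk := bmeasM bh bmeas_neq0.
have fk x : f x * clip_weight x = m * (h x * (x != 0)%:R).
  by rewrite fh mulrAC clip_weightE -mulrA [X in m * X]mulrC.
rewrite -RintZ// /Rintegral; congr fine.
have -> : (\int[nu]_(x in [set~ 0%R]) (f x)%:E = \int[nu]_x (f x)%:E)%E.
  rewrite integral_mkcond; apply: eq_integral => x _; rewrite patchE; case: ifPn => //.
  by rewrite notin_setE /= => /contrapT ->; rewrite fh clip0 expr0n mul0r.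
have w0 := clip_weight_ge0.
(* [integral_density] is for nonnegative functions, so positive and negative parts are treated
   separately. *)
rewrite [LHS]integralE [RHS]integralE; congr (_ - _)%E.
  rewrite integral_density; last 2 first.
  - by apply: measurable_funepos; exact/measurable_EFinP.
  - by move=> x; exact: funepos_ge0.
  apply: eq_integral => x _; rewrite !funeposE -!EFin_max -EFinM; congr EFin.
  by rewrite maxr_pMl// fk mul0r.
rewrite integral_density; last 2 first.
- by apply: measurable_funeneg; exact/measurable_EFinP.
- by move=> x; exact: funeneg_ge0.
apply: eq_integral => x _; rewrite !funenegE -!EFinN -!EFin_max -EFinM; congr EFin.
by rewrite maxr_pMl// mulNr fk mul0r.
Qed.

Lemma unclipped_levy_measure : levy_measure nu.
Proof.
split.
  rewrite density_measureE; apply: integral0_eq => x /= ->.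
  by rewrite clip_weight0.
apply: (@le_lt_trans _ _ (m%:E)); last exact: ltry.
have min0 (x : R) : 0 <= Num.min 1 (x ^+ 2) by rewrite le_min ler01 sqr_ge0.
rewrite integral_density; last 2 first.
- by apply/measurable_EFinP; apply: measurable_minr => //; exact: measurable_funX.
- by move=> x; rewrite lee_fin.
under eq_integral do rewrite -clip_sqr -EFinM clip_weightE.
rewrite integral_bmeas; last by apply: bmeasZ; exact: bmeas_neq0.
rewrite lee_fin -[leRHS](probability_Rint_cst M); apply: le_Rint.
- by apply: bmeasZ; exact: bmeas_neq0.
- exact: bmeas_cst.
- by move=> x; rewrite ler_piMr// lern1 leq_b1.
Qed.

Lemma unclipped_spectral (x : R) : x < 0 -> m * fine (M `]-oo, x]) = 0 -> levy_spectral nu x = 0.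
Proof.
move=> x0 Mx; rewrite /levy_spectral x0 density_measureE.
suff -> : (\int[M]_(y in `]-oo, x]) (clip_weight y)%:E = 0)%E by [].
have cx : 0 < clip x ^+ 2 by rewrite exprn_even_gt0//= clip_eq0 lt_eqF.
apply/eqP; rewrite eq_le; apply/andP; split; last first.
  by apply: integral_ge0 => y _; rewrite lee_fin clip_weight_ge0.
(* For [y <= x < 0] monotonicity of [clip] gives [clip x ^+ 2 <= clip y ^+ 2], so the weight is
   bounded away from the origin. *)
apply: (@le_trans _ _ (\int[M]_(y in `]-oo, x]) (m / clip x ^+ 2)%:E)%E).
  apply: ge0_le_integral => //=.
  - by move=> y _; rewrite lee_fin clip_weight_ge0.
  - by apply: measurable_funTS; apply/measurable_EFinP; exact: measurable_clip_weight.
  move=> y; rewrite in_itv/= => yx; rewrite lee_fin ler_wpM2l//.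
  have cxy : clip x ^+ 2 <= clip y ^+ 2.
    rewrite -[leRHS]sqrrN -[leLHS]sqrrN ler_sqr ?nnegrE; first by rewrite lerN2 clip_homo.
      by rewrite oppr_ge0 -[leRHS]clip0 clip_homo// ltW.
    by rewrite oppr_ge0 -[leRHS]clip0 clip_homo// (le_trans yx)// ltW.
  by rewrite lef_pV2 ?posrE// (lt_le_trans cx).
rewrite integral_cst//= -[M _]fineK; last exact: fin_num_measure.
by rewrite -EFinM mulrAC Mx mul0r.
Qed.

End LevyMeasure.

Section Canonical.
Context {R : realType}.
Implicit Types (t x : R).

(* replaces the truncation x / (1 + x^2) of the Levy representation by clip x *)
Definition trunc_gap x : R := (x / (1 + x ^+ 2) - clip x) / clip x ^+ 2.

Lemma one_add_sqr_gt0 x : 0 < 1 + x ^+ 2.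
Proof. by have := sqr_ge0 x; lra. Qed.

Lemma clip_trunc_gap x : clip x ^+ 2 * trunc_gap x = x / (1 + x ^+ 2) - clip x.
Proof.
rewrite /trunc_gap; have [->|x0] := eqVneq x 0.
  by rewrite clip0 expr0n !mul0r subrr.
by rewrite mulrC mulfVK// expf_neq0// clip_eq0.
Qed.

Lemma norm_trunc x : `|x / (1 + x ^+ 2)| <= 1.
Proof.
have p := one_add_sqr_gt0 x; rewrite normrM normfV (gtr0_norm p) ler_pdivrMr// mul1r.
have := sqr_ge0 (`|x| - 1); rewrite sqrrB expr1n mulr1 real_normK ?num_real// -mulr_natl.
have := normr_ge0 x; lra.
Qed.

Lemma norm_trunc_gap x : `|trunc_gap x| <= 2.
Proof.
have p := one_add_sqr_gt0 x; rewrite /trunc_gap.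
have [x1|x1] := leP `|x| 1; last first.
  rewrite clip_sqr1 ?(ltW x1)// divr1; apply: le_trans (ler_normB _ _) _.
  by have := norm_trunc x; have := norm_clip_le1 x; lra.
rewrite clip_id//; have [->|x0] := eqVneq x 0; first by rewrite expr0n invr0 mulr0 normr0.
have -> : (x / (1 + x ^+ 2) - x) / x ^+ 2 = - (x / (1 + x ^+ 2)).
  by field; rewrite x0 gt_eqF.
by rewrite normrN; have := norm_trunc x; lra.
Qed.

Lemma continuous_trunc : continuous (fun x : R => x / (1 + x ^+ 2)).
Proof.
move=> x; apply: cvgM; first exact: cvg_id.
apply: cvgV; first by rewrite gt_eqF// one_add_sqr_gt0.
by apply: cvgD; [exact: cvg_cst|exact: exprn_continuous].
Qed.

Lemma bmeas_trunc_gap : bmeas trunc_gap.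
Proof.
split; last by exists 2 => x; exact: norm_trunc_gap.
apply: measurable_fun_off0 => x x0; apply: cvgM; last exact: continuous_clip_sqrV.
by apply: cvgB; [exact: continuous_trunc|exact: continuous_clip].
Qed.

Lemma levy_spectral_vanishes_neg_of_clip (G : R -> R) (mu M : probability R R) (kappa m : R) :
  is_law mu G -> 0 <= m -> (forall x : R, x < 0 -> m * fine (M `]-oo, x]) = 0) ->
  (forall t, let A := m * \int[M]_x ker_cos t x in
     let B := t * kappa + m * \int[M]_x ker_sin t x in
     \int[mu]_x cos (t * x) = expR A * cos B /\ \int[mu]_x sin (t * x) = expR A * sin B) ->
  levy_spectral_vanishes_neg G.
Proof.
move=> muG m0 Mneg chfG; have bn := @bmeas_neq0 R.
have br := bmeasM bmeas_trunc_gap bn.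
(* Since [ker_cos t 0 = - t ^+ 2 / 2] and [ker_sin t 0 = 0], the atom at the origin contributes
   [- sigma2 * t ^+ 2 / 2] to the exponent. *)
pose sigma2 := m * fine (M [set 0]).
(* The second summand of the drift pays for changing the truncation from [clip x] to
   [x / (1 + x ^+ 2)]. *)
exists (kappa + m * \int[M]_x (trunc_gap x * (x != 0)%:R)), sigma2, (unclipped_measure M m0).
split; last by move=> x x0; exact: unclipped_spectral (Mneg x x0).
- by rewrite mulr_ge0// fine_ge0.
- exact: unclipped_levy_measure.
exists mu; split => // t; have [h1 h2] := chfG t.
have bc := bmeasM (bmeas_ker_cos t) bn; have bs := bmeasM (bmeas_ker_sin t) bn.
have mcos : measurable_fun setT (fun x : R => cos (t * x) - 1).
  by have [] := bmeasB (bmeas_cosM t) (bmeas_cst R 1).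
have eA : - sigma2 * t ^+ 2 / 2 +
    Rintegral (unclipped_measure M m0) [set~ 0] (fun x => cos (t * x) - 1) =
    m * \int[M]_x ker_cos t x.
  rewrite (Rint_unclipped M m0 mcos (bmeas_ker_cos t)); last by move=> x; rewrite clip_ker_cos.
  have e x : ker_cos t x = ker_cos t x * (x != 0)%:R + - (t ^+ 2 / 2) * \1_[set 0] x.
    rewrite indicE; have [->|x0] := eqVneq x 0.
      rewrite mem_set// mulr0n mulr0 add0r mulr1n mulr1 /ker_cos clip0 expr0n invr0 mulr0.
      by rewrite eqxx mulr1n mulr1 sub0r.
    by rewrite memNset ?mulr0n ?mulr0 ?addr0 ?mulr1n ?mulr1//; exact/eqP.
  have b0 : bmeas (fun x : R => \1_[set (0:R)] x : R) by exact: bmeas_indic.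
  have -> : \int[M]_x ker_cos t x = \int[M]_x (ker_cos t x * (x != 0)%:R) +
      - (t ^+ 2 / 2) * fine (M [set 0]).
    rewrite -(Rint_indic M (measurable_set1 0)) -(RintZ M _ b0) -(RintD M bc (bmeasZ _ b0)).
    by congr (Rintegral _ _ _); apply/funext => x; exact: e.
  by rewrite /sigma2; ring.
have msin : measurable_fun setT (fun x : R => sin (t * x) - t * x / (1 + x ^+ 2)).
  apply: measurable_funB; first by have [] := bmeas_sinM t.
  apply: (continuous_measurable_fun) => x.
  under eq_fun do rewrite -mulrA.
  by apply: cvgM; [exact: cvg_cst|exact: continuous_trunc].
have eB : (kappa + m * \int[M]_x (trunc_gap x * (x != 0)%:R)) * t +
    Rintegral (unclipped_measure M m0) [set~ 0] (fun x => sin (t * x) - t * x / (1 + x ^+ 2)) =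
    t * kappa + m * \int[M]_x ker_sin t x.
  rewrite (Rint_unclipped M m0 msin (bmeasB (bmeas_ker_sin t) (bmeasZ t bmeas_trunc_gap))); last first.
    by move=> x; rewrite mulrBr clip_ker_sin mulrCA clip_trunc_gap -mulrA; ring.
  have -> : \int[M]_x ((ker_sin t x - t * trunc_gap x) * (x != 0)%:R) =
      \int[M]_x ker_sin t x - t * \int[M]_x (trunc_gap x * (x != 0)%:R).
    rewrite -RintZ// -(RintB M (bmeas_ker_sin t) (bmeasZ t br)).
    congr (Rintegral _ _ _); apply/funext => x; have [->|x0] := eqVneq x 0.
      by rewrite /ker_sin clip0 expr0n invr0 !mulr0 subr0.
    by rewrite mulr1n !mulr1.
  by ring.
by split; rewrite ?h1 ?h2 /= eA ?[(_ + _) * t]mulrC ?[t * (_ + _)]mulrC eB.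
Qed.

End Canonical.

(** * Rescaled summands and conclusion *)

Section Scaling.
Context {R : realType}.

Definition div_fun (b x : R) : R := x / b.

Lemma measurable_div_fun b : measurable_fun setT (div_fun b).
Proof. by apply: measurable_funM => //; exact: measurable_cst. Qed.

HB.instance Definition _ b :=
  @isMeasurableFun.Build _ _ _ _ (div_fun b) (measurable_div_fun b).

Definition scaled_law (mu : probability R R) (b : R) : probability R R :=
  distribution mu (div_fun b).

Lemma Rint_scaled_law mu b (f : R -> R) : bmeas f ->
  \int[scaled_law mu b]_x f x = \int[mu]_x f (x / b).
Proof. exact: Rint_distribution. Qed.

Lemma chf_scaled_law mu b t : chf (scaled_law mu b) t = chf mu (t / b).
Proof.
rewrite /chf /cfun !Rint_scaled_law; [|exact: bmeas_sinM|exact: bmeas_cosM].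
by congr (_ +i* _)%C; congr (Rintegral _ _ _); apply/funext => x; rewrite mulrA mulrAC.
Qed.

End Scaling.

Theorem theorem2 (R : realType) (lam : nat -> nat -> R) (a b : nat -> R)
  (q G : R -> R) :
  (* lam j = eigenvalues of K^{X_{1,j+1}}; X_d = (x)_{j<d} X_{1,j+1} *)
  (forall j, eigen_seq (lam j)) ->
  (forall d, 0 < b d) ->
  b d @[d --> \oo] --> +oo ->
  (* uniform negligibility *)
  (forall tau : R, 0 < tau ->
     (fun d => \big[maxe/0%E]_(j < d)
        (\sum_(0 <= k <oo)
           (lbar (lam j) k * (lbar (lam j) k < expR (- tau * b d))%R%:R)%:E)%E)
       @ \oo --> 0%E) ->
  (* q : (0,1) -> R non-increasing *)
  (forall x y : R, 0 < x -> x <= y -> y < 1 -> q y <= q x) ->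
  distribution_function G ->
  (forall eps : R, 0 < eps < 1 -> {for eps, continuous q} ->
     q eps = inf [set x | 1 - eps ^+ 2 <= G x]) ->
  (forall eps : R, 0 < eps < 1 -> {for eps, continuous q} ->
     (fun d => (ln ((complexity lam d eps)%:R) - a d - q eps * b d) / b d)
       @ \oo --> (0:R)) ->
  [/\ self_decomposable G,
      levy_spectral_vanishes_neg G &
      (~ degenerate G -> (fun d => b d.+1 / b d) @ \oo --> (1:R))].
Proof.
move=> lamP b0 boo negl qni GP qG lnn.
have [P PP] := info_laws lamP.
have cvG := norm_sum_cv_law lamP b0 boo qni GP qG lnn PP.
have ratio := norming_ratio lamP b0 boo negl qni GP qG lnn PP.
split => //.
  have [deg|ndeg] := pselect (degenerate G); first exact: degenerate_self_decomposable.
  by move=> alpha alpha1; exact: (self_decomposable_at b0 boo GP cvG (ratio ndeg) alpha1).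
have bneq d : b d != 0 by rewrite gt_eqF.
(* The array to which the limit theory applies: the laws of [U_j / b_d], with shifts [a d / b d]. *)
pose Q d j := scaled_law (P j) (b d).
have Q0 d j : nonneg_law (Q d j).
  move=> f g bf bg fg; rewrite !Rint_scaled_law//.
  have bdiv (h : R -> R) : bmeas h -> bmeas (fun x : R => h (x / b d)).
    by move=> bh; apply: bmeas_comp bh; exact: measurable_div_fun.
  apply: (info_law_support lamP PP j (bdiv f bf) (bdiv g bg)) => u u0.
  by apply: fg; rewrite divr_ge0// ltW.
have neglQ (tau e : R) : 0 < tau -> 0 < e ->
    \forall d \near \oo, forall j, (j < d)%N -> \int[Q d j]_x (1 - ind tau x) <= e.
  move=> tau0 e0; have := info_law_negligible lamP negl PP tau0 e0.
  apply: filterS => d h j jd; apply: le_trans (h j jd).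
  rewrite Rint_scaled_law; last exact: bmeas_ind_compl.
  rewrite le_eqVlt; apply/orP; left; apply/eqP; congr (Rintegral _ _ _); apply/funext => x.
  by rewrite !indE ler_pdivrMr.
have chfU d t : cfun (norm_sum a b P d) t =
    cis (- (t * (a d / b d))) * \prod_(j < d) chf (Q d j) t.
  rewrite -[norm_sum a b P d]/(affine_law (sum_law P 0 d) (a d) (b d)) cfun_affine chf_sum_law.
  by rewrite mulrA; congr (_ * _); apply: eq_bigr => j _; rewrite chf_scaled_law.
have [mu [kappa [m [M [muG m0 Mneg chfG]]]]] :=
  limit_representation Q0 neglQ GP (norm_sum_posfun a b P) (norm_sum1 a b P) cvG chfU.
exact: (levy_spectral_vanishes_neg_of_clip muG m0 Mneg chfG).
Qed.
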